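(* For a quasicategory $\mathcal{C}$, the maps $\max^*\colon\mathcal{C}\to\mathrm{Ex}_+(\mathcal{C}^\natural)$ and $\min^*\colon\mathcal{C}\to\mathrm{Ex}^{\mathrm{op}}_+(\mathcal{C}^\natural)$ are equivalences of quasicategories (weak equivalences in the Joyal model structure).
   Context: A marked simplicial set is a pair $(X,W)$ where $X$ is a simplicial set and $W \subseteq X_1$ contains all degenerate $1$-simplices. For a quasicategory $\mathcal{C}$, $\mathcal{C}^\natural$ denotes $\mathcal{C}$ marked at its equivalences (invertible $1$-simplices). $[n]=\{0<\dots<n\}$. $\mathrm{sd}_+[n]$ is the nerve of the poset of non-empty subsets of $[n]$ ordered by inclusion, with $A_0\subseteq A_1$ marked iff $\max A_0=\max A_1$; $\mathrm{sd}^{\mathrm{op}}_+[n]$ is the nerve of the opposite poset, with $A_0\supseteq A_1$ marked iff $\min A_0=\min A_1$; both are cosimplicial objects via direct image. $\mathrm{Ex}_+(X,W)_n$ is the set of marked maps $\mathrm{sd}_+[n]\to(X,W)$ and $\mathrm{Ex}^{\mathrm{op}}_+(X,W)_n$ the set of marked maps $\mathrm{sd}^{\mathrm{op}}_+[n]\to(X,W)$. The map $\max^*\colon X\to \mathrm{Ex}_+(X,W)$ sends an $n$-simplex $\sigma\colon\Delta^n\to X$ to $\sigma\circ\max$, where $\max\colon\mathrm{sd}_+[n]\to[n]$, $A\mapsto\max A$; similarly $\min^*$ sends $\sigma$ to $\sigma\circ\min$ with $\min\colon\mathrm{sd}^{\mathrm{op}}_+[n]\to[n]$. *)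

(* Defs.v *)
From mathcomp Require Import all_boot.
From Stdlib Require Import ProofIrrelevance FunctionalExtensionality.
From mathcomp Require Import zify.



Unset Printing Implicit Defensive.

Record mono (m n : nat) := Mono {
  monof :> 'I_m.+1 -> 'I_n.+1;
  monoP : forall i j : 'I_m.+1, i <= j -> monof i <= monof j }.

Arguments monof {m n} _ _.
Arguments monoP {m n} _ {i j} _.
Arguments Mono {m n} _ _.

Definition mono_id n : mono n n := Mono id (fun i j h => h).

Definition mono_comp m n p (g : mono n p) (f : mono m n) : mono m p :=
  Mono (fun i => g (f i)) (fun i j h => monoP g (monoP f h)).

Arguments mono_comp {m n p} _ _.

Definition cst m n (v : 'I_n.+1) : mono m n :=
  Mono (fun _ => v) (fun i j _ => leqnn v).

Arguments cst m {n} _.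

Lemma bump_mono (i : nat) {a b : nat} : a <= b -> bump i a <= bump i b.
Proof. rewrite /bump => h; case: (leqP i a); case: (leqP i b) => /= ? ?; lia. Qed.

Definition coface (i : 'I_3) : mono 1 2 :=
  Mono (fun j => lift i j) (fun a b h => bump_mono i h).

Record sset := SSet {
  sobj :> nat -> Type;
  sact : forall m n, mono m n -> sobj n -> sobj m }.
Arguments sact s {m n} _ _.

Definition is_sset (X : sset) : Prop :=
  [/\ (forall n (x : X n), sact X (mono_id n) x = x),
      (forall m n p (f : mono m n) (g : mono n p) (x : X p),
          sact X f (sact X g x) = sact X (mono_comp g f) x) &
      (forall m n (f g : mono m n) (x : X n),
          (forall i, f i = g i) -> sact X f x = sact X g x)].

Record smap (X Y : sset) := SMap {
  scomp :> forall n, X n -> Y n;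
  snat : forall m n (f : mono m n) (x : X n),
           scomp m (sact X f x) = sact Y f (scomp n x) }.

Arguments scomp {X Y} _ _ _.
Arguments snat {X Y} _ _ _ _ _.
Arguments SMap {X Y} _ _.

Set Implicit Arguments.
Unset Strict Implicit.

Definition smap_comp X Y Z (G : smap Y Z) (F : smap X Y) : smap X Z.
Proof.
  refine (SMap (fun n x => G n (F n x)) _).
  by move=> m n f x; rewrite snat snat.
Defined.

Lemma smap_ext X Y (F G : smap X Y) :
  (forall n x, F n x = G n x) -> F = G.
Proof.
  case: F G => [F hF] [G hG] /= h.
  have E : F = G.
    by apply: functional_extensionality_dep => n; apply: functional_extensionality.
  subst G; f_equal; apply: proof_irrelevance.
Qed.

(* Nerve of a relation (we apply it only to posets).                   *)
Definition chain (T : Type) (R : T -> T -> Prop) (n : nat) :=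
  {s : 'I_n.+1 -> T | forall i j : 'I_n.+1, i <= j -> R (s i) (s j)}.

Definition chain_act T R m n (f : mono m n) (s : @chain T R n) : @chain T R m :=
  exist (fun s' : 'I_m.+1 -> T => forall i j : 'I_m.+1, i <= j -> R (s' i) (s' j))
        (fun i => proj1_sig s (f i))
          (fun i j h => proj2_sig s _ _ (monoP f h)).

Definition nerve T (R : T -> T -> Prop) : sset :=
  @SSet (@chain T R) (@chain_act T R).

Definition nerve_map T U (R : T -> T -> Prop) (S : U -> U -> Prop)
  (phi : T -> U) (phiP : forall a b, R a b -> S (phi a) (phi b)) :
  smap (nerve R) (nerve S).
Proof.
  refine (@SMap (nerve R) (nerve S)
           (fun n (s : chain R n) => exist (fun s' : 'I_n.+1 -> U => forall i j : 'I_n.+1, i <= j -> S (s' i) (s' j))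
                        (fun i => phi (proj1_sig s i))
                        (fun i j h => phiP _ _ (proj2_sig s i j h))) _).
  move=> m n f x; rewrite /=; apply: eq_exist_uncurried; exists erefl.
  exact: proof_irrelevance.
Defined.

Definition horn_obj (n : nat) (k : 'I_n.+1) (m : nat) :=
  {f : mono m n | exists j : 'I_n.+1, j != k /\ forall i, f i != j}.

Definition horn_act (n : nat) (k : 'I_n.+1) m p (g : mono m p) (f : horn_obj k p) : horn_obj k m.
Proof.
  exists (mono_comp (proj1_sig f) g).
  case: (proj2_sig f) => j [hj hi]; exists j; split => // i; exact: hi.
Defined.

Definition horn n (k : 'I_n.+1) : sset := @SSet (horn_obj k) (@horn_act n k).

Definition quasicategory (X : sset) : Prop :=
  forall (n : nat) (k : 'I_n.+1), 0 < k < n ->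
  forall h : smap (horn k) X,
  exists s : X n, forall m (f : horn_obj k m), h m f = sact X (proj1_sig f) s.

Definition face (X : sset) (i : nat) (s : X 2) : X 1 := sact X (coface (inord i)) s.
Definition src (X : sset) (e : X 1) : X 0 := sact X (cst 0 (ord0 : 'I_2)) e.
Definition tgt (X : sset) (e : X 1) : X 0 := sact X (cst 0 (ord_max : 'I_2)) e.
Definition idedge (X : sset) (x : X 0) : X 1 := sact X (cst 1 (ord0 : 'I_1)) x.

Definition degenerate1 (X : sset) (e : X 1) : Prop := exists x : X 0, e = idedge x.

(* e : x -> y is invertible: there are g and 2-simplices witnessing
   g o e ~ id_x and e o g ~ id_y. *)
Definition is_equiv (X : sset) (e : X 1) : Prop :=
  exists (g : X 1) (s t : X 2),
    [/\ face 2 s = e, face 0 s = g & face 1 s = idedge (src e)] /\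
    [/\ face 2 t = g, face 0 t = e & face 1 t = idedge (tgt e)].

(* C^natural : C marked at its equivalences (and, as for every marked
   simplicial set, at its degenerate edges; these are equivalences anyway). *)
Definition natmark (X : sset) (e : X 1) : Prop := is_equiv e \/ degenerate1 e.

Definition sdT (n : nat) := {A : {set 'I_n.+1} | A != set0}.
Definition sd_le n (A B : sdT n) : Prop := proj1_sig A \subset proj1_sig B.
Definition sdop_le n (A B : sdT n) : Prop := proj1_sig B \subset proj1_sig A.

Definition maxS n (A : {set 'I_n.+1}) : nat := \max_(i in A) (i : nat).
Definition minS n (A : {set 'I_n.+1}) : nat := \big[minn/n]_(i in A) (i : nat).

Definition sd (n : nat) : sset := nerve (@sd_le n).
Definition sdop (n : nat) : sset := nerve (@sdop_le n).

Definition sd_marked n (e : sd n 1) : Prop :=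
  maxS (proj1_sig (proj1_sig e ord0)) = maxS (proj1_sig (proj1_sig e ord_max)).
Definition sdop_marked n (e : sdop n 1) : Prop :=
  minS (proj1_sig (proj1_sig e ord0)) = minS (proj1_sig (proj1_sig e ord_max)).

Definition dimg m n (f : mono m n) (A : sdT m) : sdT n.
Proof.
  exists (f @: proj1_sig A); rewrite imset_eq0; exact: (proj2_sig A).
Defined.

Definition sd_map m n (f : mono m n) : smap (sd m) (sd n) :=
  @nerve_map _ _ (@sd_le m) (@sd_le n) (dimg f)
    (fun a b h => imsetS f h).
Definition sdop_map m n (f : mono m n) : smap (sdop m) (sdop n) :=
  @nerve_map _ _ (@sdop_le m) (@sdop_le n) (dimg f)
    (fun a b h => imsetS f h).

Lemma maxS_ex n (A : {set 'I_n.+1}) : A != set0 -> exists2 a, a \in A & maxS A = a.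
Proof.
  move=> hA; have hc : 0 < #|A| by rewrite card_gt0.
  case: (eq_bigmax_cond (fun i : 'I_n.+1 => i : nat) hc) => a ha e; by exists a.
Qed.
Lemma maxS_ub n (A : {set 'I_n.+1}) a : a \in A -> a <= maxS A.
Proof. by move=> h; apply: leq_bigmax_cond. Qed.
Lemma maxS_lub n (A : {set 'I_n.+1}) k : (forall a, a \in A -> a <= k) -> maxS A <= k.
Proof. by move=> h; apply/bigmax_leqP => i /h. Qed.

Lemma minS_lb n (A : {set 'I_n.+1}) a : a \in A -> minS A <= a.
Proof.
  move=> h; rewrite /minS.
  have : a \in index_enum 'I_n.+1 by rewrite mem_index_enum.
  elim: (index_enum _) => [//|b r IH]; rewrite big_cons in_cons.
  case/orP=> [/eqP <-|hr]; first by rewrite h geq_minl.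
  case: (b \in A); last exact: IH.
  exact: leq_trans (geq_minr _ _) (IH hr).
Qed.
Lemma minS_ex n (A : {set 'I_n.+1}) : A != set0 -> exists2 a, a \in A & minS A = a.
Proof.
  move=> hA.
  have : minS A = n \/ exists2 a, a \in A & minS A = a.
    rewrite /minS; apply: (big_ind (fun x => x = n \/ exists2 a, a \in A & x = a)).
    - by left.
    - by move=> x y hx hy; rewrite /minn; case: ifP.
    - by move=> i hi; right; exists i.
  case=> [h|//]; case/set0Pn: hA => a ha; exists a => //.
  have := minS_lb ha; have := ltn_ord a; rewrite h; lia.
Qed.
Lemma minS_glb n (A : {set 'I_n.+1}) k :
  A != set0 -> (forall a, a \in A -> k <= a) -> k <= minS A.
Proof. by move=> /minS_ex [a ha ->]; apply. Qed.

Lemma maxS_img m n (f : mono m n) (A : {set 'I_m.+1}) a :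
  a \in A -> maxS A = a -> maxS (f @: A) = f a.
Proof.
  move=> ha hm; apply/eqP; rewrite eqn_leq; apply/andP; split.
  - apply: maxS_lub => y /imsetP [b hb ->]; apply: monoP; rewrite -hm; exact: maxS_ub.
  - apply: maxS_ub; exact: imset_f.
Qed.
Lemma minS_img m n (f : mono m n) (A : {set 'I_m.+1}) a :
  a \in A -> minS A = a -> minS (f @: A) = f a.
Proof.
  move=> ha hm; apply/eqP; rewrite eqn_leq; apply/andP; split.
  - apply: minS_lb; exact: imset_f.
  - apply: minS_glb; first by apply/set0Pn; exists (f a); exact: imset_f.
    move=> y /imsetP [b hb ->]; apply: monoP; rewrite -hm; exact: minS_lb.
Qed.

Lemma sd_map_marked m n (f : mono m n) (e : sd m 1) :
  sd_marked e -> sd_marked (sd_map f 1 e).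
Proof.
  rewrite /sd_marked /=.
  case: (maxS_ex (proj2_sig (proj1_sig e ord0))) => a ha ea.
  case: (maxS_ex (proj2_sig (proj1_sig e ord_max))) => b hb eb.
  rewrite (maxS_img f ha ea) (maxS_img f hb eb) ea eb => h.
  by rewrite (val_inj h).
Qed.
Lemma sdop_map_marked m n (f : mono m n) (e : sdop m 1) :
  sdop_marked e -> sdop_marked (sdop_map f 1 e).
Proof.
  rewrite /sdop_marked /=.
  case: (minS_ex (proj2_sig (proj1_sig e ord0))) => a ha ea.
  case: (minS_ex (proj2_sig (proj1_sig e ord_max))) => b hb eb.
  rewrite (minS_img f ha ea) (minS_img f hb eb) ea eb => h.
  by rewrite (val_inj h).
Qed.

Definition Ex_obj (X : sset) (W : X 1 -> Prop) (n : nat) :=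
  {h : smap (sd n) X | forall e : sd n 1, sd_marked e -> W (h 1 e)}.
Definition Exop_obj (X : sset) (W : X 1 -> Prop) (n : nat) :=
  {h : smap (sdop n) X | forall e : sdop n 1, sdop_marked e -> W (h 1 e)}.

Definition Ex_act X W m n (f : mono m n) (h : @Ex_obj X W n) : @Ex_obj X W m.
Proof.
  exists (smap_comp (proj1_sig h) (sd_map f)).
  move=> e he; apply: (proj2_sig h); exact: sd_map_marked.
Defined.
Definition Exop_act X W m n (f : mono m n) (h : @Exop_obj X W n) : @Exop_obj X W m.
Proof.
  exists (smap_comp (proj1_sig h) (sdop_map f)).
  move=> e he; apply: (proj2_sig h); exact: sdop_map_marked.
Defined.

Definition Ex_plus (X : sset) (W : X 1 -> Prop) : sset := @SSet (@Ex_obj X W) (@Ex_act X W).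
Definition Exop_plus (X : sset) (W : X 1 -> Prop) : sset :=
  @SSet (@Exop_obj X W) (@Exop_act X W).

Lemma maxS_lt n (A : {set 'I_n.+1}) : maxS A < n.+1.
Proof. apply: leq_ltn_trans (maxS_lub (k := n) _) _ => // a _; exact: leq_ord. Qed.
Lemma minS_lt n (A : sdT n) : minS (proj1_sig A) < n.+1.
Proof. case: (minS_ex (proj2_sig A)) => a _ ->; exact: ltn_ord. Qed.

Definition maxo n (A : sdT n) : 'I_n.+1 := Ordinal (maxS_lt (proj1_sig A)).
Definition mino n (A : sdT n) : 'I_n.+1 := Ordinal (minS_lt A).

Definition max_mono n m (s : sd n m) : mono m n.
Proof.
  refine (Mono (fun i => maxo (proj1_sig s i)) _).
  move=> i j h; rewrite /=; apply: maxS_lub => a ha; apply: maxS_ub.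
  exact: (subsetP (proj2_sig s i j h)).
Defined.
Definition min_mono n m (s : sdop n m) : mono m n.
Proof.
  refine (Mono (fun i => mino (proj1_sig s i)) _).
  move=> i j h; rewrite /=; apply: minS_glb; first exact: (proj2_sig (proj1_sig s j)).
  move=> a ha; apply: minS_lb; exact: (subsetP (proj2_sig s i j h)).
Defined.

Section MaxMin.
Variables (C : sset) (hC : is_sset C).

Definition max_simp n (x : C n) : smap (sd n) C.
Proof.
  refine (@SMap (sd n) C (fun m s => sact C (max_mono s) x) _).
  move=> m p f s; case: hC => _ hcomp hext.
  by rewrite hcomp; apply: hext.
Defined.
Definition min_simp n (x : C n) : smap (sdop n) C.
Proof.
  refine (@SMap (sdop n) C (fun m s => sact C (min_mono s) x) _).
  move=> m p f s; case: hC => _ hcomp hext.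
  by rewrite hcomp; apply: hext.
Defined.

Lemma ord2_cases (i : 'I_2) : i = ord0 \/ i = ord_max.
Proof. case: i => [[|[|k]] h] //; [left|right]; exact: val_inj. Qed.

Lemma max_simp_marked n (x : C n) (e : sd n 1) :
  sd_marked e -> natmark (max_simp x 1 e).
Proof.
  move=> he; right; case: hC => _ hcomp hext.
  exists (sact C (cst 0 (maxo (proj1_sig e ord0))) x).
  rewrite /idedge hcomp /=; apply: hext => i /=.
  case: (ord2_cases i) => -> //; apply: val_inj; rewrite /= -he //.
Qed.
Lemma min_simp_marked n (x : C n) (e : sdop n 1) :
  sdop_marked e -> natmark (min_simp x 1 e).
Proof.
  move=> he; right; case: hC => _ hcomp hext.
  exists (sact C (cst 0 (mino (proj1_sig e ord0))) x).
  rewrite /idedge hcomp /=; apply: hext => i /=.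
  case: (ord2_cases i) => -> //; apply: val_inj; rewrite /= -he //.
Qed.

Definition maxstar_comp n (x : C n) : Ex_plus (@natmark C) n :=
  exist _ (max_simp x) (@max_simp_marked n x).
Definition minstar_comp n (x : C n) : Exop_plus (@natmark C) n :=
  exist _ (min_simp x) (@min_simp_marked n x).

Definition maxstar : smap C (Ex_plus (@natmark C)).
Proof.
  refine (@SMap C (Ex_plus (@natmark C)) maxstar_comp _).
  move=> m n f x; apply: eq_exist_uncurried.
  have E : max_simp (sact C f x) = smap_comp (max_simp x) (sd_map f).
    apply: smap_ext => p s /=; case: hC => _ hcomp hext.
    rewrite hcomp; apply: hext => i /=; apply: val_inj => /=.
    case: (maxS_ex (proj2_sig (proj1_sig s i))) => a ha ea.
    by rewrite (maxS_img f ha ea); congr (monof f _); apply: val_inj.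
  exists E; exact: proof_irrelevance.
Defined.

Definition minstar : smap C (Exop_plus (@natmark C)).
Proof.
  refine (@SMap C (Exop_plus (@natmark C)) minstar_comp _).
  move=> m n f x; apply: eq_exist_uncurried.
  have E : min_simp (sact C f x) = smap_comp (min_simp x) (sdop_map f).
    apply: smap_ext => p s /=; case: hC => _ hcomp hext.
    rewrite hcomp; apply: hext => i /=; apply: val_inj => /=.
    case: (minS_ex (proj2_sig (proj1_sig s i))) => a ha ea.
    by rewrite (minS_img f ha ea); congr (monof f _); apply: val_inj.
  exists E; exact: proof_irrelevance.
Defined.
End MaxMin.

(* Equivalences of quasicategories: homotopy equivalences with respect *)
(* to J, the nerve of the free-living isomorphism {0 ~= 1}             *)
(* (n-simplices of J = all maps [n] -> {0,1}).                         *)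
Definition prodJ (X : sset) : sset :=
  @SSet (fun n => (X n * ('I_n.+1 -> bool))%type)
        (fun m n f p => (sact X f p.1, fun i => p.2 (f i))).

Definition qcat_equiv (X Y : sset) (F : smap X Y) : Prop :=
  exists (G : smap Y X) (H : smap (prodJ X) X) (K : smap (prodJ Y) Y),
    [/\ (forall n (x : X n), H n (x, fun _ => false) = G n (F n x)),
        (forall n (x : X n), H n (x, fun _ => true) = x),
        (forall n (y : Y n), K n (y, fun _ => false) = F n (G n y)) &
        (forall n (y : Y n), K n (y, fun _ => true) = y)].

(* Main.v *)
(**
Let D[n] be the preorder of non-empty subsets of [n] in which A <= B when
max A <= max B, and let T be the simplicial set of maps from its nerve to C.
Restriction along the inclusion of sd[n] defines a map from T to Ex_+(C), and
the theorem follows once it is a trivial fibration: it then has a section S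
sending max^* c to c o max.  Restricting S(e) along i |-> {i} gives a retraction
G of max^*, and the maps A |-> A or {max A}, according to the value of a map
[n] -> {0,1} at max A, give a J-homotopy between max^* o G and the identity.
Moreover Ex_+(C) is a quasicategory because it is a retract of T, which is one.

For the trivial fibration, a map given on subset chains and on the faces of
[n] is first extended to the flags m_0 < ... < m_i in x_1 < ... < x_k whose
initial vertices are singletons, by inner horns inserting the set
{m_0, ..., m_i} and one special outer horn.  The flags are stable under the
homotopy {max x} -> x, whose components are equivalences, so homotopy extension
gives the extension to the nerve of D[n].  Homotopy extension and the special
outer horn rest on Joyal's theorem that horns whose first edge is an equivalence
have fillers; it is proved by lifting equivalences along the right fibration
of slices over a simplex and over its boundary.  The map min^* is the opposite
of max^*.
*)
Require Import Defs.
From mathcomp Require Import all_boot.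
From mathcomp Require Import zify.
From Stdlib Require Import ProofIrrelevance FunctionalExtensionality.
From Stdlib Require Import Classical IndefiniteDescription.

Set Implicit Arguments.
Unset Strict Implicit.

(** * Monotone maps, faces and horns *)

(** The obstacle is that max : sd[n] -> [n] has no section natural in n: singletons are carried to
    singletons by direct images but do not form a chain for inclusion, while the initial segments
    form a chain that direct images do not preserve. Comparing sets by their maxima turns the
    singletons into a chain, which is why D[n] replaces sd[n]. Subset chains alone are not stable
    under the homotopy {max x} -> x, because {max A} need not lie in {max B} when A lies in B; flags
    are the simplices that the homotopy produces from them, so they must be reached before homotopy
    extension applies. The faces of [n] are carried along throughout, since a trivial fibration asks
    for extensions relative to the boundary. Lifting in slices and extending homotopies are both
    phrased as finding a section of a trivial fibration that is prescribed on a subobject. *)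

Lemma mono_eq m n (f g : mono m n) : (forall i, f i = g i :> nat) -> f = g.
Proof.
case: f g => [f hf] [g hg] /= h.
have E : f = g by apply: functional_extensionality => i; apply: val_inj; apply: h.
by subst g; rewrite (proof_irrelevance _ hf hg).
Qed.

Lemma sact_id X (hX : is_sset X) n (x : X n) : sact X (mono_id n) x = x.
Proof. by case: hX. Qed.

Lemma sact_comp X (hX : is_sset X) m n p (f : mono m n) (g : mono n p) (x : X p) :
  sact X f (sact X g x) = sact X (mono_comp g f) x.
Proof. by case: hX. Qed.

Lemma sact_eq (X : sset) m n (f g : mono m n) (x : X n) :
  (forall i, f i = g i :> nat) -> sact X f x = sact X g x.
Proof. by move=> h; rewrite (mono_eq h). Qed.

Definition delta n (i : 'I_n.+2) : mono n n.+1 :=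
  Mono (fun j => lift i j) (fun a b h => bump_mono i h).

Lemma delta_inj n (i : 'I_n.+2) : injective (delta i).
Proof. exact: lift_inj. Qed.

Lemma delta_neq n (i : 'I_n.+2) a : delta i a != i.
Proof. by rewrite eq_sym; apply: neq_lift. Qed.

Lemma mono_factor m n (f : mono m n.+1) (i : 'I_n.+2) :
  (forall a, f a != i) -> exists g : mono m n, f = mono_comp (delta i) g.
Proof.
move=> h.
have bd a : unbump i (f a) < n.+1.
  have := h a; rewrite -val_eqE /= /unbump.
  by have := ltn_ord (f a); have := ltn_ord i; case: ltnP => /=; lia.
have hm (a b : 'I_m.+1) : a <= b -> Ordinal (bd a) <= Ordinal (bd b).
  move=> /(monoP f) /=; rewrite /unbump; have := h a; have := h b.
  by rewrite -!val_eqE /=; case: ltnP; case: ltnP => /=; lia.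
exists (Mono (fun a => Ordinal (bd a)) hm); apply: mono_eq => a /=.
by rewrite unbumpKcond; move: (h a); rewrite -val_eqE => /negbTE -> /=.
Qed.

Definition surj m n (f : mono m n) := forall j, exists i, f i = j.

Lemma nsurjP m n (f : mono m n) : surj f \/ exists j, forall i, f i != j.
Proof.
case: (classic (surj f)) => [|h]; [by left|right].
case/not_all_ex_not: h => j hj; exists j => i; apply/eqP => e; apply: hj; by exists i.
Qed.

Lemma mono_factor_lt m n (f : mono m n) (j : 'I_n.+1) : (forall i, f i != j) ->
  exists n' (d : mono n' n) (g : mono m n'), n' < n /\ f = mono_comp d g.
Proof.
case: n f j => [|n] f j h; first by have := h ord0; rewrite (ord1 (f ord0)) (ord1 j).
by case: (mono_factor h) => g e; exists n, (delta j), g.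
Qed.

(** The section can be made to pass through a prescribed point [a]; this lets two surjections be
    compared pointwise in the Eilenberg-Zilber lemma. *)
Lemma mono_section m n (e : mono m n) (a : 'I_m.+1) : surj e ->
  exists d : mono n m, (forall j, e (d j) = j) /\ d (e a) = a.
Proof.
move=> he.
pose d j := if j == e a then a else odflt ord0 [pick i | e i == j].
have ed j : e (d j) = j.
  rewrite /d; case: eqP => [->//|_]; case: pickP => [i /eqP //|h].
  by case: (he j) => i hi; move: (h i); rewrite hi eqxx.
have hm (i j : 'I_n.+1) : i <= j -> d i <= d j.
  rewrite leq_eqVlt => /orP [/eqP /val_inj -> //|lt].
  rewrite leqNgt; apply/negP => /ltnW /(monoP e); rewrite !ed; lia.
by exists (Mono d hm); split=> //=; rewrite /d eqxx.
Qed.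

Lemma mono_nat_ge n (f : mono n n) : injective f -> forall i : 'I_n.+1, i <= f i.
Proof.
move=> hf [k hk]; elim: k hk => [//|k IH] hk /=.
have hk' : k < n.+1 by lia.
have /= h1 := IH hk'.
have h2 : f (Ordinal hk') <= f (Ordinal hk) by apply: monoP => /=; lia.
have h3 : (f (Ordinal hk') : nat) <> f (Ordinal hk).
  by move=> /val_inj /hf /(congr1 val) /=; lia.
by lia.
Qed.

Definition revm m n (f : mono m n) : mono m n.
Proof.
refine (Mono (fun i => rev_ord (f (rev_ord i))) _) => i j h /=.
have : f (rev_ord j) <= f (rev_ord i) by apply: monoP => /=; lia.
lia.
Defined.

Lemma revmK m n (f : mono m n) : revm (revm f) = f.
Proof. by apply: mono_eq => i /=; rewrite rev_ordK; have := ltn_ord (f i); lia. Qed.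

Lemma mono_inj_id n (f : mono n n) : injective f -> forall i, f i = i.
Proof.
move=> hf i; apply: val_inj; apply/eqP; rewrite eqn_leq mono_nat_ge // andbT.
(* [mono_nat_ge] applied to the order reversal of [f] gives the opposite inequality. *)
have hr : injective (revm f) by move=> a b /= /rev_ord_inj /hf /rev_ord_inj.
have /= := mono_nat_ge hr (rev_ord i); rewrite rev_ordK.
have := ltn_ord (f i); have := ltn_ord i; lia.
Qed.

Lemma mono_surj_id n (f : mono n n) : surj f -> forall i, f i = i.
Proof.
move=> hf i; case: (mono_section ord0 hf) => d [fd _].
have di : injective d by move=> a b /(congr1 (monof f)); rewrite !fd.
by rewrite -{1}(mono_inj_id di i) fd.
Qed.

Lemma mono_inj_delta n (f : mono n n.+1) : injective f -> exists l, f = delta l.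
Proof.
move=> hf; case: (nsurjP f) => [hs|[l hl]].
  case: (mono_section ord0 hs) => d [fd _].
  have : #|'I_n.+2| <= #|'I_n.+1|.
    by apply: (leq_card d) => a b /(congr1 (monof f)); rewrite !fd.
  by rewrite !card_ord; lia.
case: (mono_factor hl) => g eg; exists l; rewrite eg; apply: mono_eq => i /=.
rewrite (@mono_inj_id _ g) // => a b h; apply: hf; rewrite eg /=; congr (lift l _); exact: h.
Qed.

(* Every pair of equal faces of faces comes from the simplicial identity. *)
Lemma delta_pullback N m (i j : 'I_N.+3) (u v : mono m N.+1) : i < j ->
  (forall a, delta i (u a) = delta j (v a)) ->
  exists w, u = mono_comp (delta (inord j.-1)) w /\ v = mono_comp (delta (inord i)) w.
Proof.
move=> ij e.
have hi : (inord i : 'I_N.+2) = i :> nat by rewrite inordK //; have := ltn_ord j; lia.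
have hj : (inord j.-1 : 'I_N.+2) = j.-1 :> nat by rewrite inordK //; have := ltn_ord j; lia.
have h a : u a != inord j.-1.
  rewrite -val_eqE /= hj; have /(congr1 val) /= := e a.
  rewrite /bump; case: (leqP i (u a)); case: (leqP j (v a)) => /=; lia.
case: (mono_factor h) => w ew; exists w; split=> //; apply: mono_eq => a /=.
have /(congr1 val) /= := e a; rewrite ew /= hi hj /bump.
lia.
Qed.

Lemma delta_delta N (i j : 'I_N.+3) : i < j ->
  mono_comp (delta i) (delta (inord j.-1)) = mono_comp (delta j) (delta (inord i)) :> mono N _.
Proof.
move=> ij; apply: mono_eq => a /=; by rewrite /bump !inordK; have := ltn_ord j; lia.
Qed.

(** A horn or a boundary is encoded as its family of faces, agreeing on every common simplex.
    Ranging over all [u] and [v] instead of using the simplicial identities covers [N = 0], where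
    faces of faces do not exist. *)
Definition compat (X : sset) N (J : 'I_N.+2 -> Prop) (t : 'I_N.+2 -> X N) :=
  forall i j, J i -> J j -> forall m (u v : mono m N),
  (forall a, delta i (u a) = delta j (v a)) -> sact X u (t i) = sact X v (t j).

Lemma compat0 (X : sset) (J : 'I_2 -> Prop) (t : 'I_2 -> X 0) : compat J t.
Proof.
move=> i j _ _ m u v h.
have E : i = j.
  have /(congr1 val) /= := h ord0; rewrite (ord1 (u ord0)) (ord1 (v ord0)) /bump /=.
  move=> E; apply: val_inj => /=; have := ltn_ord i; have := ltn_ord j; lia.
subst j; apply: sact_eq => a.
by rewrite (ord1 (u a)) (ord1 (v a)).
Qed.

Lemma compat_faces (X : sset) (hX : is_sset X) N (J : 'I_N.+3 -> Prop) (t : 'I_N.+3 -> X N.+1) :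
  (forall i j : 'I_N.+3, i < j -> J i -> J j ->
    sact X (delta (inord j.-1)) (t i) = sact X (delta (inord i)) (t j)) ->
  compat J t.
Proof.
move=> h.
have main (i j : 'I_N.+3) : i < j -> J i -> J j -> forall m (u v : mono m N.+1),
   (forall a, delta i (u a) = delta j (v a)) -> sact X u (t i) = sact X v (t j).
  move=> ij Ji Jj m u v e; case: (delta_pullback ij e) => w [-> ->].
  by rewrite -!sact_comp // h.
move=> i j Ji Jj m u v e; case: (ltngtP i j) => [ij|ji|].
- exact: main.
- by symmetry; apply: main => // a; rewrite e.
- move=> /val_inj E; subst j; apply: sact_eq => a; congr (val _); exact: (delta_inj (e a)).
Qed.

Lemma compat_eq (X : sset) N (J : 'I_N.+3 -> Prop) (t : 'I_N.+3 -> X N.+1) (i j : 'I_N.+3) :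
  compat J t -> i < j -> J i -> J j ->
  sact X (delta (inord j.-1)) (t i) = sact X (delta (inord i)) (t j).
Proof.
move=> ct ij Ji Jj; apply: ct => // a.
by have := congr1 (fun f : mono _ _ => f a) (delta_delta ij).
Qed.

(** Maps are glued from pieces as functional relations: some piece must give a value and all pieces
    must agree, without deciding which piece a simplex belongs to. *)
Lemma smap_of_rel (X Y : sset) (Rel : forall n, X n -> Y n -> Prop) :
  (forall n x, exists y, @Rel n x y) ->
  (forall n x y y', @Rel n x y -> Rel n x y' -> y = y') ->
  (forall m n (f : mono m n) x y, Rel n x y -> Rel m (sact X f x) (sact Y f y)) ->
  exists F : smap X Y, forall n x, Rel n x (F n x).
Proof.
move=> tot uniq stab.
pose F n x := proj1_sig (constructive_indefinite_description _ (tot n x)).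
have FP n x : Rel n x (F n x) by rewrite /F; case: constructive_indefinite_description.
have Fn m n (f : mono m n) (x : X n) : F m (sact X f x) = sact Y f (F n x).
  by apply: (uniq _ (sact X f x)); [exact: FP | apply: stab; exact: FP].
by exists (SMap F Fn).
Qed.

Definition act_closed (B : sset) (P : forall n, B n -> Prop) :=
  forall m n (f : mono m n) b, P n b -> P m (sact B f b).

Lemma exist_eq (T : Type) (P : T -> Prop) (x y : T) (hx : P x) (hy : P y) :
  x = y -> exist P x hx = exist P y hy.
Proof. by move=> e; subst y; rewrite (proof_irrelevance _ hx hy). Qed.

Lemma sig_eq (T : Type) (P : T -> Prop) (x y : sig P) : sval x = sval y -> x = y.
Proof. by case: x y => [x hx] [y hy] /= e; apply: exist_eq. Qed.

Section Sub.
Variables (B : sset) (P : forall n, B n -> Prop) (hP : act_closed P).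

Definition sub : sset :=
  @SSet (fun n => {b : B n | P b})
    (fun m n f b => exist (fun b => P b) (sact B f (sval b)) (hP f (proj2_sig b))).

Lemma is_sset_sub : is_sset B -> is_sset sub.
Proof.
move=> hB; split=> [n x|m n p f g x|m n f g x h]; apply: sig_eq => /=.
- exact: sact_id.
- exact: sact_comp.
- by apply: sact_eq => i; rewrite h.
Qed.

Definition sub_incl : smap sub B := @SMap sub B (fun n b => sval b) (fun _ _ _ _ => erefl).
End Sub.

Definition innerfill (X : sset) := forall N (k : 'I_N.+2), 0 < k < N.+1 ->
  forall t : 'I_N.+2 -> X N, compat (fun j => j != k) t ->
  exists c : X N.+1, forall j, j != k -> sact X (delta j) c = t j.

Lemma delta_horn N (k j : 'I_N.+2) : j != k ->
  exists j0 : 'I_N.+2, j0 != k /\ forall i, delta j i != j0.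
Proof. by move=> h; exists j; split=> // i; apply: delta_neq. Qed.

(** The value at a simplex of the horn is read through any face containing it; [compat] says that
    the choice of the face does not matter. *)
Lemma horn_glue (X : sset) (hX : is_sset X) N (k : 'I_N.+2) (t : 'I_N.+2 -> X N) :
  compat (fun j => j != k) t ->
  exists h : smap (horn k) X, forall j (hj : j != k), h N (exist _ (delta j) (delta_horn hj)) = t j.
Proof.
move=> ct.
pose Rel n (f : horn k n) (v : X n) := forall j g, j != k ->
  sval f = mono_comp (delta j) g -> v = sact X g (t j).
have [|||h hP] := @smap_of_rel (horn k) X Rel.
- move=> n [f [j [hj hf]]]; case: (mono_factor hf) => g eg.
  exists (sact X g (t j)) => i g' hi /= e; apply: ct => // a.
  by move: e; rewrite eg => /(congr1 (fun f : mono _ _ => f a)).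
- move=> n [f [j [hj hf]]] y y' h h'; case: (mono_factor hf) => g eg.
  by rewrite (h j g) // (h' j g).
- move=> m n f [u [j [hj hu]]] y h i g' hi /= e; case: (mono_factor hu) => g eg.
  rewrite (h j g) // sact_comp //; apply: ct => // a.
  by move: e; rewrite eg => /(congr1 (fun f : mono _ _ => f a)).
exists h => j hj.
have /= := hP _ (exist _ (delta j) (delta_horn hj)) j (mono_id _) hj => -> //.
by rewrite sact_id.
Qed.

Lemma qcat_innerfill (X : sset) : is_sset X -> quasicategory X -> innerfill X.
Proof.
move=> hX hq N k hk t ct; case: (horn_glue hX ct) => h hh.
by case: (hq _ k hk h) => s hs; exists s => j hj; rewrite -hh hs.
Qed.

Lemma innerfill_qcat (X : sset) : is_sset X -> innerfill X -> quasicategory X.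
Proof.
move=> hX hi [|N] k hk h; first by lia.
have [t ht] : exists t : 'I_N.+2 -> X N,
    forall j (hj : j != k), t j = h N (exist _ (delta j) (delta_horn hj)).
  apply: (functional_choice (fun j v => forall hj : j != k, v = h N (exist _ (delta j) (delta_horn hj)))) => j.
  have [ej|hj] : j == k \/ j != k by case: eqP; [left|right].
    have h0 : ord0 != k by rewrite -val_eqE /=; lia.
    by exists (h N (exist _ (delta ord0) (delta_horn h0))) => hj; exfalso; move: hj; rewrite ej.
  by exists (h N (exist _ (delta j) (delta_horn hj))) => hj'; congr (h _ _); apply: exist_eq.
case: (hi N k hk t) => [|c hc].
  move=> i j hi' hj' m u v e; rewrite !ht -!snat; congr (h _ _); apply: sig_eq => /=.
  by apply: mono_eq => a; exact: (congr1 val (e a)).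
exists c => m f; case: (f) => [f0 [j [hj hf]]] /=; case: (mono_factor hf) => g eg.
transitivity (sact X (mono_comp (delta j) g) c); last by rewrite -eg.
rewrite -sact_comp // hc // ht -snat; congr (h _ _); apply: sig_eq => /=; exact: eg.
Qed.

(** * Sections of trivial fibrations *)

(** Lifting against boundary inclusions; the point, with its empty boundary, is a separate
    clause. *)
Definition trivfib (T B : sset) (p : smap T B) :=
  (forall b : B 0, exists t, p 0 t = b) /\
  (forall N (b : B N.+1) (t : 'I_N.+2 -> T N),
    (forall j, p N (t j) = sact B (delta j) b) -> compat (fun _ => True) t ->
    exists c, p N.+1 c = b /\ forall j, sact T (delta j) c = t j).

(** * The Eilenberg-Zilber lemma *)

Section EilenbergZilber.
Variables (B : sset) (hB : is_sset B).

(** For the least such [m] this is the Eilenberg-Zilber representation: [e] is then a degeneracy and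
    [y] is non-degenerate. *)
Definition rep n (b : B n) m := exists (e : mono n m) (y : B m), b = sact B e y.

Lemma min_rep n (b : B n) : exists m, rep b m /\ forall m', rep b m' -> m <= m'.
Proof.
have [m hm] : exists m, rep b m by exists n, (mono_id n), b; rewrite sact_id.
elim/ltn_ind: m hm => m IH hm.
case: (classic (exists m', rep b m' /\ m' < m)) => [[m' [h1 h2]]|h]; first exact: IH h2 h1.
exists m; split=> // m' h'; rewrite leqNgt; apply/negP => lt; apply: h; by exists m'.
Qed.

Lemma min_rep_surj n (b : B n) m (e : mono n m) (y : B m) :
  (forall m', rep b m' -> m <= m') -> b = sact B e y -> surj e.
Proof.
move=> hm eb; case: (nsurjP e) => // [[j hj]]; exfalso.
case: (mono_factor_lt hj) => n' [d [g [lt eg]]].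
have : m <= n'; last lia.
by apply: hm; exists g, (sact B d y); rewrite sact_comp // -eg.
Qed.

(** For a section [d] of [e], the composite of [e'] and [d] represents [y] through [y'], so
    minimality makes it surjective, hence the identity. Thus every section of [e] is a section of
    [e'], and sections of [e] pass through every point. *)
Lemma min_rep_uniq n (b : B n) m (e e' : mono n m) (y y' : B m) :
  (forall m', rep b m' -> m <= m') -> b = sact B e y -> b = sact B e' y' ->
  e = e' /\ y = y'.
Proof.
move=> hm eb eb'.
have se := min_rep_surj hm eb; have se' := min_rep_surj hm eb'.
have key (d : mono m n) : (forall j, e (d j) = j) -> forall j, e' (d j) = j.
  move=> ed; have E : y = sact B (mono_comp e' d) y'.
    rewrite -sact_comp // -eb' eb sact_comp // -{1}[y](sact_id hB).
    by apply: sact_eq => i /=; rewrite ed.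
  have hs : surj (mono_comp e' d).
    apply: (@min_rep_surj _ y _ _ y' _ E) => m' [u [z ez]].
    by apply: hm; exists (mono_comp u e), z; rewrite -sact_comp // -ez.
  exact: (mono_surj_id hs).
have E : e = e'.
  apply: mono_eq => i; case: (mono_section i se) => d [ed di].
  by rewrite -{2}di key.
split=> //; subst e'; case: (mono_section ord0 se) => d [ed _].
have := congr1 (sact B d) eb'; rewrite eb !sact_comp //.
have -> : mono_comp e d = mono_id m by apply: mono_eq => i /=; rewrite ed.
by rewrite !sact_id.
Qed.
End EilenbergZilber.

Section Sections.
Variables (T B A : sset) (hT : is_sset T) (hB : is_sset B).
Variables (p : smap T B) (hp : trivfib p) (i : smap A B) (tau : smap A T).
Hypothesis i_inj : forall n, injective (i n).
Hypothesis p_tau : forall n a, p n (tau n a) = i n a.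

(** [S] is a total family constrained only below [N], so that the induction on [N] needs no
    truncated types. *)
Definition partial_section N (S : forall n, B n -> T n) :=
  [/\ (forall n b, n < N -> p n (S n b) = b),
      (forall n a, n < N -> S n (i n a) = tau n a) &
      (forall m n (f : mono m n) b, m < N -> n < N -> S m (sact B f b) = sact T f (S n b))].

(** A partial section is consistent on degenerate simplices: every representation is compared with
    the minimal one. If [u] is not surjective, it factors through a smaller simplex; if it is, [z]
    is itself pulled back from [y0]. *)
Lemma partial_section_rep N S n (b : B n) : partial_section N S ->
  forall m (e : mono n m) y m' (e' : mono n m') y', m < N -> m' < N ->
  b = sact B e y -> b = sact B e' y' -> sact T e (S m y) = sact T e' (S m' y').
Proof.
move=> [_ _ nat] m e y m' e' y' lt lt' eb eb'.
case: (min_rep hB b) => m0 [[e0 [y0 eb0]] hm0].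
suff key k (u : mono n k) z : k < N -> b = sact B u z ->
    sact T u (S k z) = sact T e0 (S m0 y0) by rewrite (key _ _ _ lt eb) (key _ _ _ lt' eb').
have lt0 : m0 < N by apply: leq_ltn_trans (hm0 _ _) lt; exists e, y.
elim/ltn_ind: k u z => k IH u z hk ez.
have le0 : m0 <= k by apply: hm0; exists u, z.
have [ek|hlt] : k = m0 \/ m0 < k by lia.
  by subst k; case: (min_rep_uniq hB hm0 ez eb0) => -> ->.
case: (nsurjP u) => [su|[j hj]].
- case: (mono_section ord0 su) => d [ud _].
  have ezz : z = sact B (mono_comp e0 d) y0.
    rewrite -sact_comp // -eb0 ez sact_comp // -[LHS](sact_id hB).
    by apply: sact_eq => a /=; rewrite ud.
  rewrite ezz nat // sact_comp //.
  have E : b = sact B (mono_comp (mono_comp e0 d) u) y0 by rewrite -sact_comp // -ezz.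
  by case: (min_rep_uniq hB hm0 E eb0) => -> _.
- case: (mono_factor_lt hj) => n' [d [g [ltn eg]]].
  rewrite eg -sact_comp // -nat //; last lia.
  by apply: IH => //; [lia | rewrite sact_comp // -eg].
Qed.

Lemma partial_section_step N S : partial_section N S ->
  exists S', partial_section N.+1 S' /\ forall n, n < N -> S' n = S n.
Proof.
move=> hS; have [sec ext nat] := hS.
pose degen (b : B N) := exists m (e : mono N m) y, m < N /\ b = sact B e y.
(* The clauses of [Q] concern one simplex [b] at a time, so its value can be chosen independently of
   the others. *)
pose Q (b : B N) (v : T N) := [/\ p N v = b,
  (forall m (e : mono N m) y, m < N -> b = sact B e y -> v = sact T e (S m y)),
  (forall a, b = i N a -> v = tau N a) &
  (forall m (f : mono m N), m < N -> S m (sact B f b) = sact T f v)].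
have tot b : exists v, Q b v.
  (* Degenerate simplices have a forced value, those in the image of [i] are given by [tau], and all
     others are filled from their boundary. *)
  case: (classic (degen b)) => [[m [e [y [lt eb]]]]|nd].
    exists (sact T e (S m y)); split.
    - by rewrite snat sec.
    - by move=> m' e' y' lt' eb'; apply: (partial_section_rep hS lt lt' eb eb').
    - move=> a ea; case: (min_rep hB b) => m0 [[e0 [y0 eb0]] hm0].
      have lt0 : m0 < N by apply: leq_ltn_trans (hm0 _ _) lt; exists e, y.
      rewrite (partial_section_rep hS lt lt0 eb eb0).
      (* [y0] comes from [A] too: it is the restriction of [a] along a section of [e0]. *)
      case: (mono_section ord0 (min_rep_surj hB hm0 eb0)) => d [ed _].
      have ey : y0 = i m0 (sact A d a).
        rewrite snat -ea eb0 sact_comp // -[LHS](sact_id hB).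
        by apply: sact_eq => j /=; rewrite ed.
      rewrite ey ext // -snat; congr (tau _ _); apply: i_inj.
      by rewrite snat -ey -eb0.
    - by move=> k f lt'; rewrite eb sact_comp // nat // -sact_comp.
  have noteq m (e : mono N m) y : m < N -> b = sact B e y -> False.
    by move=> lt eb; apply: nd; exists m, e, y.
  case: (classic (exists a, b = i N a)) => [[a ea]|na].
    exists (tau N a); split.
    - by rewrite p_tau.
    - by move=> m e y lt eb; case: (noteq _ _ _ lt eb).
    - by move=> a'; rewrite ea => /i_inj ->.
    - by move=> m f lt; rewrite ea -!snat ext.
  have [v [v1 v2]] : exists v, p N v = b /\
      forall m (f : mono m N), m < N -> S m (sact B f b) = sact T f v.
    case: N b S hS sec ext nat @degen @Q nd noteq na => [|N] b S hS sec ext nat degen Q nd noteq na.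
      by case: hp => h _; case: (h b) => v hv; exists v.
    case: hp => _ h; case: (h N b (fun j => S N (sact B (delta j) b))) => [j||v [hv fv]].
    - by rewrite sec.
    - case: N b S hS sec ext nat {degen Q nd noteq na h} => [|N] b S hS sec ext nat.
        exact: compat0.
      apply: compat_faces => // j k jk _ _.
      by rewrite -!nat // !sact_comp // delta_delta.
    exists v; split=> // m f lt.
    case: (nsurjP f) => [su|[j hj]].
      case: (mono_section ord0 su) => d [fd _].
      have : #|'I_N.+2| <= #|'I_m.+1|.
        by apply: (leq_card d) => a c /(congr1 (monof f)); rewrite !fd.
      by rewrite !card_ord; lia.
    case: (mono_factor hj) => g ->; rewrite -!sact_comp // fv nat //.
  exists v; split=> //.
  - by move=> m e y lt eb; case: (noteq _ _ _ lt eb).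
  - by move=> a ea; case: na; exists a.
case: (functional_choice _ tot) => V hV.
pose S' n (b : B n) : T n :=
  match eqVneq n N with
  | EqNotNeq e => eq_rect N (fun n => B n -> T n) V n (esym e) b
  | NeqNotEq _ => S n b
  end.
have S'N b : S' N b = V b.
  rewrite /S'; case: eqVneq => [e|]; last by rewrite eqxx.
  by rewrite (eq_irrelevance e erefl).
have S'n n b : n < N -> S' n b = S n b.
  by move=> lt; rewrite /S'; case: eqVneq => // e; exfalso; lia.
exists S'; split; last first.
  by move=> n lt; apply: functional_extensionality => b; rewrite S'n.
have low n : n < N.+1 -> n < N \/ n = N by lia.
split.
- move=> n b /low [lt|e]; first by rewrite S'n // sec.
  by subst n; rewrite S'N; case: (hV b).
- move=> n a /low [lt|e]; first by rewrite S'n // ext.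
  by subst n; rewrite S'N; case: (hV (i N a)) => _ _ h _; apply: h.
have caseA n (f : mono N n) b : n < N -> S' N (sact B f b) = sact T f (S' n b).
  move=> lt; rewrite S'N (S'n n) //; case: (hV (sact B f b)) => _ h _ _; exact: h.
move=> m n f b /low [lm|em] /low [ln|en].
- by rewrite !S'n // nat.
- by subst n; rewrite S'n // S'N; case: (hV b) => _ _ _ h; apply: h.
- by subst m; apply: caseA.
- subst m n; case: (nsurjP f) => [su|[j hj]].
    have -> : f = mono_id N by apply: mono_eq => a; rewrite mono_surj_id.
    by rewrite !sact_id.
  case: (mono_factor_lt hj) => n' [d [g [lt ->]]].
  rewrite -!sact_comp // caseA // S'n // S'N.
  by case: (hV b) => _ _ _ h; rewrite h.
Qed.

(** Monomorphisms lift against trivial fibrations. Stage [N] of the iteration agrees with all later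
    ones below dimension [N], so dimension [n] is read off at stage [n + 1]. *)
Theorem trivfib_section : exists s : smap B T,
  (forall n b, p n (s n b) = b) /\ (forall n a, s n (i n a) = tau n a).
Proof.
have [S0 hS0] : exists S, partial_section 0 S.
  suff h0 : exists S : forall n, B n -> T n, True by case: h0 => S _; exists S; split.
  (* An arbitrary starting value: a constant simplex on some vertex of [T]. *)
  have inh n (b : B n) : exists t : T n, True.
    have := sact B (cst 0 ord0) b; case: hp => h _ b0; case: (h b0) => t _.
    by exists (sact T (cst n ord0) t).
  by exists (fun n b => proj1_sig (constructive_indefinite_description _ (inh n b))).
pose St N := {S | partial_section N S}.
pose next N (s : St N) : St N.+1 :=
  let: exist S1 hS := s in
  let: exist S' hS' := constructive_indefinite_description _ (partial_section_step hS) in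
  exist _ S' (proj1 hS').
have nextP N (s : St N) n : n < N -> sval (next N s) n = sval s n.
  by case: s => S1 hS /=; case: constructive_indefinite_description => S' [h1 h2] /=; apply: h2.
pose st := fix st N : St N := if N is N'.+1 then next N' (st N') else exist _ S0 hS0.
have stP N n : n < N -> sval (st N) n = sval (st n.+1) n.
  elim: N => [//|N IH] lt.
  have [e|lt'] : n = N \/ n < N by lia.
    by subst n.
  by rewrite -IH // -(nextP _ (st N)).
pose s n := sval (st n.+1) n.
have sE N n : n < N -> s n = sval (st N) n by move=> lt; rewrite stP.
have sn m n (f : mono m n) b : s m (sact B f b) = sact T f (s n b).
  have [h1 h2] : m < (m + n).+1 /\ n < (m + n).+1 by lia.
  rewrite (sE _ m h1) (sE _ n h2); case: (st _) => S1 /= [_ _ h]; exact: h.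
exists (SMap s sn); split=> n x /=; rewrite /s; case: (st n.+1) => S1 /= [h1 h2 _]; auto.
Qed.
End Sections.

(** * Right fibrations and equivalences *)

Definition rightfib X Y (p : smap X Y) := forall N (k : 'I_N.+2), 0 < k ->
  forall (y : Y N.+1) (t : 'I_N.+2 -> X N), compat (fun j => j != k) t ->
  (forall j, j != k -> p N (t j) = sact Y (delta j) y) ->
  exists c, p N.+1 c = y /\ forall j, j != k -> sact X (delta j) c = t j.

Lemma compat_map X Y (p : smap X Y) N J (t : 'I_N.+2 -> X N) :
  compat J t -> compat J (fun j => p N (t j)).
Proof. by move=> h i j Ji Jj m u v e; rewrite -!snat (h _ _ Ji Jj _ _ _ e). Qed.

Lemma rightfib_innerfill X Y (p : smap X Y) : rightfib p -> innerfill Y -> innerfill X.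
Proof.
move=> hp hY N k hk t ct; case: (hY N k hk _ (compat_map p ct)) => y hy.
case: (hp N k _ y t ct) => [|j hj|c [_ hc]]; first by case/andP: hk.
  by rewrite hy.
by exists c.
Qed.

Definition o0 : 'I_3 := Ordinal (isT : 0 < 3).
Definition o1 : 'I_3 := Ordinal (isT : 1 < 3).
Definition o2 : 'I_3 := Ordinal (isT : 2 < 3).

(** The 2-simplex exhibits [c] as a composite of [a] followed by [b]. *)
Definition tri (X : sset) (a b c : X 1) := exists s : X 2,
  [/\ sact X (delta o2) s = a, sact X (delta o0) s = b & sact X (delta o1) s = c].

Lemma face_delta (X : sset) (i : 'I_3) (s : X 2) : face i s = sact X (delta i) s.
Proof. by apply: sact_eq => j /=; rewrite inord_val. Qed.

Lemma is_equivP (X : sset) (f : X 1) : is_equiv f <->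
  exists g, tri f g (idedge (src f)) /\ tri g f (idedge (tgt f)).
Proof.
split=> [[g [s [t]]]|[g [[s hs] [t ht]]]].
  rewrite !(face_delta o0) !(face_delta o1) !(face_delta o2) => [[hs ht]].
  by exists g; split; [exists s | exists t].
by exists g, s, t; rewrite !(face_delta o0) !(face_delta o1) !(face_delta o2).
Qed.

Section LowDim.
Variables (X : sset) (hX : is_sset X).

Lemma src_delta (e : X 1) : src e = sact X (delta (inord 1)) e.
Proof. by apply: sact_eq => i /=; rewrite (ord1 i) inordK. Qed.
Lemma tgt_delta (e : X 1) : tgt e = sact X (delta (inord 0)) e.
Proof. by apply: sact_eq => i /=; rewrite (ord1 i) inordK. Qed.

Lemma tri_tgt_src (a b c : X 1) : tri a b c -> tgt a = src b.
Proof.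
case=> s [<- <- _]; rewrite /src /tgt !sact_comp //; apply: sact_eq => i; by rewrite (ord1 i).
Qed.
Lemma tri_src (a b c : X 1) : tri a b c -> src a = src c.
Proof.
case=> s [<- _ <-]; rewrite /src /tgt !sact_comp //; apply: sact_eq => i; by rewrite (ord1 i).
Qed.
Lemma tri_tgt (a b c : X 1) : tri a b c -> tgt b = tgt c.
Proof.
case=> s [_ <- <-]; rewrite /src /tgt !sact_comp //; apply: sact_eq => i; by rewrite (ord1 i).
Qed.
Lemma src_idedge (x : X 0) : src (idedge x) = x.
Proof.
rewrite /src sact_comp // -[RHS](sact_id hX); apply: sact_eq => i; by rewrite (ord1 i).
Qed.
Lemma tgt_idedge (x : X 0) : tgt (idedge x) = x.
Proof.
rewrite /tgt sact_comp // -[RHS](sact_id hX); apply: sact_eq => i; by rewrite (ord1 i).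
Qed.


(** The degeneracy collapsing 0 and 1: the truncated predecessor sends both to 0. *)
Definition dg0 : mono 2 1.
Proof.
refine (Mono (fun i => inord i.-1) _) => i j h.
by rewrite !inordK; have := ltn_ord i; have := ltn_ord j; lia.
Defined.
Lemma tri_idl (f : X 1) : tri (idedge (src f)) f f.
Proof.
exists (sact X dg0 f); rewrite /idedge /src !sact_comp //; split.
- by apply: sact_eq => i; case: (ord2_cases i) => -> /=; rewrite inordK.
- by rewrite -[RHS](sact_id hX); apply: sact_eq => i; case: (ord2_cases i) => -> /=; rewrite inordK.
- by rewrite -[RHS](sact_id hX); apply: sact_eq => i; case: (ord2_cases i) => -> /=; rewrite inordK.
Qed.

Lemma is_equiv_idedge (x : X 0) : is_equiv (idedge x).
Proof.
apply/is_equivP; exists (idedge x); rewrite src_idedge tgt_idedge.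
by have := tri_idl (idedge x); rewrite src_idedge.
Qed.

Lemma sact2_eq (i j i' j' : nat) (s : X 3) : i < 4 -> i' < 4 -> j < 3 -> j' < 3 ->
  (forall a : nat, a < 2 -> bump i (bump j a) = bump i' (bump j' a)) ->
  sact X (delta (inord j : 'I_3)) (sact X (delta (inord i : 'I_4)) s) =
  sact X (delta (inord j' : 'I_3)) (sact X (delta (inord i' : 'I_4)) s).
Proof.
move=> h1 h2 h3 h4 h; rewrite !sact_comp //; apply: sact_eq => a /=.
by rewrite !inordK // h.
Qed.

Lemma oE : [/\ o0 = inord 0, o1 = inord 1 & o2 = inord 2].
Proof. by split; apply: val_inj; rewrite /= inordK. Qed.

Lemma ord4_cases (i : 'I_4) : [\/ i = inord 0, i = inord 1, i = inord 2 | i = inord 3].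
Proof.
by case: i => [[|[|[|[|?]]]] h] //; [constructor 1|constructor 2|constructor 3|constructor 4];
  apply: val_inj; rewrite /= inordK.
Qed.

(** An inner horn in dimension 3: the given triangles are the faces 3, 0 and 2 of a simplex with
    spine [a], [b], [f], and face 1 is obtained. *)
Lemma tri_assoc1 (a b c f u w : X 1) : innerfill X ->
  tri a b c -> tri b f u -> tri a u w -> tri c f w.
Proof.
rewrite /tri; case: oE => -> -> -> hI [s3 [a3 b3 c3]] [s0 [a0 b0 c0]] [s2 [a2 b2 c2]].
pose t (j : 'I_4) := if j == 0 :> nat then s0 else if j == 2 :> nat then s2 else s3.
case: (hI 2 (inord 1) _ t) => [|i j|c' hc]; first by rewrite inordK.
  move: i j; apply: (@compat_faces X hX 1 (fun j => j != inord 1)) => i j.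
  case: (ord4_cases i) => ->; case: (ord4_cases j) => ->; rewrite /t !inordK //= ?eqxx // => _ _ _.
  - by rewrite c0 b2.
  - by rewrite a0 b3.
  - by rewrite a2 a3.
have neq k : k < 4 -> k != 1 -> (inord k : 'I_4) != inord 1.
  by move=> h1 h2; rewrite -val_eqE /= !inordK.
have f0 := hc _ (neq 0 isT isT); have f2 := hc _ (neq 2 isT isT); have f3 := hc _ (neq 3 isT isT).
rewrite /t !inordK //= in f0 f2 f3.
exists (sact X (delta (inord 1)) c'); split.
- rewrite -c3 -f3; apply: sact2_eq => //; do 2 case=> //.
- rewrite -b0 -f0; apply: sact2_eq => //; do 2 case=> //.
- rewrite -c2 -f2; apply: sact2_eq => //; do 2 case=> //.
Qed.

(** The same tetrahedron with face 2 missing. *)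
Lemma tri_assoc2 (a b c f u w : X 1) : innerfill X ->
  tri a b c -> tri b f u -> tri c f w -> tri a u w.
Proof.
rewrite /tri; case: oE => -> -> -> hI [s3 [a3 b3 c3]] [s0 [a0 b0 c0]] [s1 [a1 b1 c1]].
pose t (j : 'I_4) := if j == 0 :> nat then s0 else if j == 1 :> nat then s1 else s3.
case: (hI 2 (inord 2) _ t) => [|i j|c' hc]; first by rewrite inordK.
  move: i j; apply: (@compat_faces X hX 1 (fun j => j != inord 2)) => i j.
  case: (ord4_cases i) => ->; case: (ord4_cases j) => ->; rewrite /t !inordK //= ?eqxx // => _ _ _.
  - by rewrite b0 b1.
  - by rewrite a0 b3.
  - by rewrite a1 c3.
have neq k : k < 4 -> k != 2 -> (inord k : 'I_4) != inord 2.
  by move=> h1 h2; rewrite -val_eqE /= !inordK.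
have f0 := hc _ (neq 0 isT isT); have f1 := hc _ (neq 1 isT isT); have f3 := hc _ (neq 3 isT isT).
rewrite /t !inordK //= in f0 f1 f3.
exists (sact X (delta (inord 2)) c'); split.
- rewrite -a3 -f3; apply: sact2_eq => //; do 2 case=> //.
- rewrite -c0 -f0; apply: sact2_eq => //; do 2 case=> //.
- rewrite -c1 -f1; apply: sact2_eq => //; do 2 case=> //.
Qed.

(** Here [g] is a right inverse of [f] and [h] one of [g]. Associativity identifies [h] with [f] up
    to homotopy ([hf]), so [g] is a two-sided inverse. *)
Lemma is_equiv_of_tri (f g h : X 1) : innerfill X ->
  tri g f (idedge (tgt f)) -> tri h g (idedge (tgt g)) -> is_equiv f.
Proof.
move=> hI gf hg; apply/is_equivP; exists g; split=> //.
have xE := tri_tgt_src gf.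
have yE : tgt f = src g by rewrite (tri_src gf) src_idedge.
have hf : tri h (idedge (tgt f)) f.
  by apply: (tri_assoc2 hI hg gf); rewrite xE; apply: tri_idl.
apply: (tri_assoc1 hI hf (u := g)); first by rewrite yE; apply: tri_idl.
by rewrite -xE.
Qed.
End LowDim.

Lemma tri_map X Y (p : smap X Y) (a b c : X 1) : tri a b c -> tri (p 1 a) (p 1 b) (p 1 c).
Proof. by case=> s [<- <- <-]; exists (p 2 s); rewrite !snat. Qed.

Lemma idedge_map X Y (p : smap X Y) (x : X 0) : p 1 (idedge x) = idedge (p 0 x).
Proof. by rewrite /idedge snat. Qed.
Lemma src_map X Y (p : smap X Y) (x : X 1) : p 0 (src x) = src (p 1 x).
Proof. by rewrite /src snat. Qed.
Lemma tgt_map X Y (p : smap X Y) (x : X 1) : p 0 (tgt x) = tgt (p 1 x).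
Proof. by rewrite /tgt snat. Qed.

Lemma is_equiv_map X Y (p : smap X Y) (e : X 1) : is_equiv e -> is_equiv (p 1 e).
Proof.
case/is_equivP => g [h1 h2]; apply/is_equivP; exists (p 1 g).
by rewrite -src_map -tgt_map -!idedge_map; split; apply: tri_map.
Qed.

Section RightFibrations.
Variables (X Y : sset) (hX : is_sset X) (hY : is_sset Y) (p : smap X Y) (hp : rightfib p).

(** The horn of index 1 in dimension 1; [rightfib21] and [rightfib22] treat the indices 1 and 2 in
    dimension 2. *)
Lemma rightfib1 (y : Y 1) (x : X 0) : tgt y = p 0 x ->
  exists e, p 1 e = y /\ tgt e = x.
Proof.
move=> h; case: (hp (N := 0) (k := ord_max) isT (y := y) (t := fun _ => x)).
- exact: compat0.
- move=> j hj; rewrite -h tgt_delta; congr (sact _ (delta _) _); apply: val_inj.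
  by rewrite /= inordK //; case: (ord2_cases j) hj => ->.
by move=> e [pe he]; exists e; rewrite tgt_delta -(he (inord 0)) // -val_eqE /= inordK.
Qed.

Lemma rightfib21 (a b : X 1) (y : Y 2) : tgt a = src b ->
  sact Y (delta o2) y = p 1 a -> sact Y (delta o0) y = p 1 b ->
  exists c, p 1 c = sact Y (delta o1) y /\ tri a b c.
Proof.
move=> ab ya yb; case: (hp (N := 1) (k := o1) isT (y := y)
  (t := fun j => if j == 0 :> nat then b else a)).
- apply: (@compat_faces X hX 0 (fun j => j != o1)) => i j ij hi hj.
  have [-> ->] : i = o0 /\ j = o2.
    by move: i j hi hj ij => [[|[|[|?]]] ?] [[|[|[|?]]] ?] //= _ _ _; split; apply: val_inj.
  by rewrite /= -src_delta // -tgt_delta.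
- case=> [[|[|[|?]]] hj] //= _; rewrite -?yb -?ya; apply: sact_eq.
- move=> c [pc hc]; exists (sact X (delta o1) c); rewrite snat pc; split=> //.
  by exists c; rewrite (hc o2) // (hc o0).
Qed.

Lemma rightfib22 (b c : X 1) (y : Y 2) : tgt b = tgt c ->
  sact Y (delta o1) y = p 1 c -> sact Y (delta o0) y = p 1 b ->
  exists a, p 1 a = sact Y (delta o2) y /\ tri a b c.
Proof.
move=> bc yc yb; case: (hp (N := 1) (k := o2) isT (y := y)
  (t := fun j => if j == 0 :> nat then b else c)).
- apply: (@compat_faces X hX 0 (fun j => j != o2)) => i j ij hi hj.
  have [-> ->] : i = o0 /\ j = o1.
    by move: i j hi hj ij => [[|[|[|?]]] ?] [[|[|[|?]]] ?] //= _ _ _; split; apply: val_inj.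
  by rewrite /= -!tgt_delta.
- case=> [[|[|[|?]]] hj] //= _; rewrite -?yb -?yc; apply: sact_eq.
- move=> a [pa ha]; exists (sact X (delta o2) a); rewrite snat pa; split=> //.
  by exists a; rewrite (ha o1) // (ha o0).
Qed.

(* Lift [g] to some [g1] ending at the source of [f]; the composite [u] of [g1]
   and [f] lies over an identity, so it has a right inverse [w], and [g'] is
   the composite of [w] and [g1]. *)
Lemma rightfib_right_inverse (f : X 1) (g : Y 1) : innerfill X ->
  tri g (p 1 f) (idedge (tgt (p 1 f))) ->
  exists g', p 1 g' = g /\ tri g' f (idedge (tgt f)).
Proof.
move=> hI gf.
case: (@rightfib1 g (src f)) => [|g1 [pg1 tg1]]; first by rewrite src_map (tri_tgt_src hY gf).
case: (gf) => t [t2 t0 t1].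
case: (@rightfib21 g1 f t) => [//|||u [pu tu]]; rewrite ?pg1 //.
case: (tri_idl hY (idedge (tgt (p 1 f)))) => d [d2 d0 d1].
rewrite src_idedge // in d2.
case: (@rightfib22 u (idedge (tgt f)) d) => [|||w [pw tw]].
- by rewrite tgt_idedge // (tri_tgt hX tu).
- by rewrite d1 idedge_map tgt_map.
- by rewrite d0 pu t1.
rewrite d2 in pw.
have ew : src g = tgt (p 1 f) by rewrite (tri_src hY gf) src_idedge.
case: (tri_idl hY g) => q [q2 q0 q1].
case: (@rightfib21 w g1 q) => [|||g' [pg' tg']].
- by rewrite (tri_tgt_src hX tw) (tri_src hX tu).
- by rewrite q2 pw ew.
- by rewrite q0 pg1.
rewrite q1 in pg'; exists g'; split=> //.
exact: (tri_assoc1 hX hI tg' tu tw).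
Qed.

(** Lift the inverse [g] to a right inverse [g'] of [f], then lift [p 1 f], a right inverse of [g],
    to a right inverse of [g']. *)
Lemma rightfib_conservative (f : X 1) : innerfill X -> is_equiv (p 1 f) -> is_equiv f.
Proof.
move=> hI /is_equivP [g [fg gf]].
case: (rightfib_right_inverse hI gf) => g' [pg' tg'].
case: (@rightfib_right_inverse g' (p 1 f) hI) => [|h [_ th]].
  by rewrite pg' (tri_tgt hY fg) tgt_idedge.
exact: (is_equiv_of_tri hX hI tg' th).
Qed.

(** A right fibration lifts edges with prescribed target. So the inverse [g] lifts to an edge ending
    at [x], and a right inverse of that edge lying over [f] starts at [x]. *)
Lemma rightfib_lift_equiv (f : Y 1) (x : X 0) : innerfill X -> is_equiv f -> src f = p 0 x ->
  exists f', p 1 f' = f /\ src f' = x.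
Proof.
move=> hI /is_equivP [g [fg gf]] sx.
have tg : tgt g = src f by rewrite (tri_tgt_src hY gf).
case: (@rightfib1 g x) => [|g' [pg' tg']]; first by rewrite tg.
case: (@rightfib_right_inverse g' f hI) => [|f' [pf' tf']]; first by rewrite pg' tg.
by exists f'; split=> //; rewrite (tri_src hX tf') src_idedge.
Qed.
End RightFibrations.

(** * Slices and special outer horns *)

(** Equalities of dimensions act as monotone maps, which avoids transporting simplices along
    them. *)
Definition castm m n (e : m = n) : mono m n :=
  Mono (cast_ord (congr1 S e)) (fun i j h => h).

(* The join of [b] and [a], with [b] acting on the initial vertices. *)
Section Join.
Variables (k' k p' p : nat) (a : mono k' k) (b : mono p' p).

Definition joinm_fun (i : nat) : nat :=
  if i <= p' then b (inord i) : nat else p.+1 + a (inord (i - p'.+1)).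

Lemma joinm_fun_lt (i : 'I_(k' + p').+2) : joinm_fun i < (k + p).+2.
Proof.
rewrite /joinm_fun; case: ifP => h.
  by have := ltn_ord (b (inord i)); lia.
by have := ltn_ord (a (inord (i - p'.+1))); lia.
Qed.

Lemma joinm_fun_mono (i j : 'I_(k' + p').+2) : i <= j -> Ordinal (joinm_fun_lt i) <= Ordinal (joinm_fun_lt j).
Proof.
move=> h /=; rewrite /joinm_fun; case: ifP => hi; case: ifP => hj.
- by apply: monoP; rewrite !inordK; lia.
- by have := ltn_ord (b (inord i)); lia.
- by lia.
- rewrite leq_add2l; apply: monoP.
  by rewrite !inordK; have := ltn_ord i; have := ltn_ord j; lia.
Qed.

Definition joinm : mono (k' + p').+1 (k + p).+1 := Mono (fun i => Ordinal (joinm_fun_lt i)) joinm_fun_mono.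
End Join.

Lemma joinm_comp k'' k' k p'' p' p (a : mono k' k) (a' : mono k'' k') (b : mono p' p) (b' : mono p'' p') :
  mono_comp (joinm a b) (joinm a' b') = joinm (mono_comp a a') (mono_comp b b').
Proof.
apply: mono_eq => i /=; rewrite /joinm_fun; case: (leqP i p'') => h.
  have h' : b' (inord i) <= p' by have := ltn_ord (b' (inord i)); lia.
  by rewrite h' inord_val.
have -> : (p'.+1 + a' (inord (i - p''.+1)) <= p') = false by lia.
by rewrite addKn inord_val.
Qed.

Lemma joinm_id k p : joinm (mono_id k) (mono_id p) = mono_id (k + p).+1.
Proof.
apply: mono_eq => i /=; rewrite /joinm_fun /=; have := ltn_ord i.
by case: (leqP i p) => h h'; rewrite inordK; lia.
Qed.

Lemma joinm_inl_lt k p (i : 'I_p.+1) : i < (k + p).+2.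
Proof. by have := ltn_ord i; lia. Qed.

Definition joinm_inl k p : mono p (k + p).+1 :=
  Mono (fun i => Ordinal (joinm_inl_lt k i)) (fun i j hij => hij).

Lemma joinm_comp_inl k' k p' p (a : mono k' k) (b : mono p' p) :
  mono_comp (joinm a b) (joinm_inl k' p') = mono_comp (joinm_inl k p) b.
Proof.
apply: mono_eq => i /=; have h : i <= p' by have := ltn_ord i; lia.
by rewrite /joinm_fun h inord_val.
Qed.

Lemma joinm_deltar k p (x : 'I_p.+2) i : joinm (mono_id k) (delta x) i = bump x i :> nat.
Proof.
rewrite /= /joinm_fun /=; have := ltn_ord i; have := ltn_ord x; rewrite /bump.
by case: (leqP i p) => h h1 h2; rewrite inordK; lia.
Qed.

Lemma joinm_deltal k p (x : 'I_k.+2) i : joinm (delta x) (mono_id p) i = bump (p.+1 + x) i :> nat.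
Proof.
rewrite /= /joinm_fun /=; have := ltn_ord i; have := ltn_ord x; rewrite /bump.
by case: (leqP i p) => h h1 h2; rewrite inordK; lia.
Qed.

Section Slice.
Variables (C : sset) (hC : is_sset C).

(* A [p]-simplex of the slice over [K] is a map from the join of the standard
   [p]-simplex [b] with [K], given on the joins with the simplices of [K]. *)
Definition slice_ax (K : sset) p (b : C p) (y : forall k, K k -> C (k + p).+1) :=
  (forall k k' (a : mono k' k) s, y k' (sact K a s) = sact C (joinm a (mono_id p)) (y k s)) /\
  (forall k s, sact C (joinm_inl k p) (y k s) = b).

(** The simplex [b] is part of the data because for empty [K] there is no [y] to recover it from;
    the slice over the empty simplicial set is [C]. *)
Definition slice_obj (K : sset) p :=
  {z : C p * (forall k, K k -> C (k + p).+1) | slice_ax z.1 z.2}.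

Definition slice_act K p' p (b : mono p' p) (z : slice_obj K p) : slice_obj K p'.
Proof.
exists (sact C b (sval z).1, fun k s => sact C (joinm (mono_id k) b) ((sval z).2 k s)).
case: z => [[c y] [h1 h2]]; rewrite /= in h1 h2 *; split=> /= [k k' a s|k s].
  rewrite h1 !sact_comp // !joinm_comp; congr (sact C (joinm _ _) _); exact: mono_eq.
by rewrite sact_comp // joinm_comp_inl -sact_comp // h2.
Defined.

Definition slice (K : sset) : sset := @SSet (slice_obj K) (@slice_act K).

Lemma slice_eq K p (z z' : slice K p) : (sval z).1 = (sval z').1 ->
  (forall k s, (sval z).2 k s = (sval z').2 k s) -> z = z'.
Proof.
case: z z' => [[c y] h] [[c' y'] h'] /= e1 e2; apply: sig_eq => /=; congr pair => //.
apply: functional_extensionality_dep => k; apply: functional_extensionality => s; exact: e2.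
Qed.

Lemma is_sset_slice K : is_sset (slice K).
Proof.
split=> [n x|m n p f g x|m n f g x h].
- by apply: slice_eq => [|k s] /=; rewrite ?joinm_id sact_id.
- by apply: slice_eq => [|k s] /=; rewrite sact_comp // joinm_comp.
- by have -> : f = g by apply: mono_eq => i; rewrite h.
Qed.

Definition slice_base K : smap (slice K) C :=
  @SMap (slice K) C (fun p z => (sval z).1) (fun _ _ _ _ => erefl).

Definition slice_restr_fun A K (i : smap A K) p (z : slice K p) : slice A p.
Proof.
exists ((sval z).1, fun k s => (sval z).2 k (i k s)).
by case: z => [[c y] [h1 h2]]; rewrite /= in h1 h2 *; split=> /= [k k' a s|k s]; rewrite ?snat.
Defined.

Definition slice_restr A K (i : smap A K) : smap (slice K) (slice A).
Proof.
apply: (@SMap (slice K) (slice A) (@slice_restr_fun A K i)) => m n f x.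
by apply: slice_eq.
Defined.

Section Lift.
Variables (A K : sset) (hK : is_sset K) (hI : innerfill C).
Variables (i : smap A K) (i_inj : forall n, injective (i n)).
Variables (N : nat) (k0 : 'I_N.+2) (hk0 : 0 < k0) (b : C N.+1).
Variables (t : 'I_N.+2 -> slice K N) (yA : forall k, A k -> C (k + N.+1).+1).
Hypothesis ct : compat (fun j => j != k0) t.
Hypothesis hb : forall j, j != k0 -> (sval (t j)).1 = sact C (delta j) b.
Hypothesis hA : slice_ax b yA.
Hypothesis tA : forall j, j != k0 -> forall k s,
  sact C (joinm (mono_id k) (delta j)) (yA s) = (sval (t j)).2 k (i k s).

(** A simplex of [K] with a value that a filler may take there. These pairs form a simplicial set
    over [K], fillers are its sections, and [yA] prescribes the section on [A]. *)
Definition lift_ax k (sc : K k * C (k + N.+1).+1) :=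
  sact C (joinm_inl k N.+1) sc.2 = b /\
  forall j, j != k0 -> sact C (joinm (mono_id k) (delta j)) sc.2 = (sval (t j)).2 k sc.1.

Definition lift_act k' k (a : mono k' k) (z : {sc | @lift_ax k sc}) : {sc | @lift_ax k' sc}.
Proof.
exists (sact K a (sval z).1, sact C (joinm a (mono_id _)) (sval z).2).
case: z => [[s c] [h1 h2]]; rewrite /= in h1 h2 *; split=> /= [|j hj].
  by rewrite sact_comp // joinm_comp_inl -sact_comp // h1 sact_id.
case: (proj2_sig (t j)) => n1 _; rewrite n1 -h2 // !sact_comp // !joinm_comp.
by congr (sact C (joinm _ _) _); apply: mono_eq.
Defined.

Definition lift_sset : sset := @SSet (fun k => {sc | @lift_ax k sc}) lift_act.

Definition lift_fst : smap lift_sset K :=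
  @SMap lift_sset K (fun k z => (sval z).1) (fun _ _ _ _ => erefl).

Lemma is_sset_lift : is_sset lift_sset.
Proof.
split=> [n [[s c] h]|m n p f g [[s c] h]|m n f g x h].
- by apply: sig_eq => /=; rewrite joinm_id !sact_id.
- by apply: sig_eq => /=; rewrite !sact_comp // joinm_comp.
- by have -> : f = g by apply: mono_eq => l; rewrite h.
Qed.

Lemma slice_faces (j l : 'I_N.+2) k s m (u v : mono m (k + N).+1) :
  j < l -> j != k0 -> l != k0 -> m = k + N ->
  (forall a, u a = bump l.-1 a :> nat) -> (forall a, v a = bump j a :> nat) ->
  sact C u ((sval (t j)).2 k s) = sact C v ((sval (t l)).2 k s).
Proof.
move: (N) k0 hk0 t ct j l u v => [|M] k1 hk1 t1 ct1 j l u v jl hj hl em hu hv.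
  exfalso; move: hj hl; rewrite -!val_eqE /=; have := ltn_ord k1; have := ltn_ord l; lia.
have e' : m = (k + M).+1 by lia.
have -> : u = mono_comp (joinm (mono_id k) (delta (inord l.-1))) (castm e').
  by apply: mono_eq => a; rewrite [RHS]joinm_deltar inordK ?hu //; have := ltn_ord l; lia.
have -> : v = mono_comp (joinm (mono_id k) (delta (inord j))) (castm e').
  by apply: mono_eq => a; rewrite [RHS]joinm_deltar inordK ?hv //; have := ltn_ord l; lia.
have /(congr1 (fun z => (sval z).2 k s)) /= E := compat_eq ct1 jl hj hl.
by rewrite -!sact_comp // E.
Qed.

(** A horn in dimension [N + 2]: its faces are the [t j] and, opposite to the vertex of [K], the
    simplex [b]. This extra face makes the horn inner even when [k0 = N + 1], so [0 < k0]
    suffices. *)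
Lemma lift_fill0 (s : K 0) : exists z, lift_fst 0 z = s.
Proof.
pose u (j : 'I_N.+3) : C N.+1 := if j < N.+2 then (sval (t (inord j))).2 0 s else b.
have hk : (inord k0 : 'I_N.+3) = k0 :> nat by rewrite inordK //; have := ltn_ord k0; lia.
have nk (j : 'I_N.+3) : j != inord k0 -> j < N.+2 -> (inord j : 'I_N.+2) != k0.
  by move=> h lt; move: h; rewrite -!val_eqE /= hk inordK.
case: (hI (N := N.+1) (k := inord k0) _ (t := u)) => [||c hc].
- by rewrite hk hk0 /=; exact: ltn_ord.
- apply: compat_faces => // j l jl hj hl; rewrite /u.
  have jlt : j < N.+2 by have := ltn_ord l; lia.
  have hj' := nk _ hj jlt.
  rewrite jlt; case: ifP => hl'.
    apply: (@slice_faces (inord j) (inord l) 0 s N) ; rewrite ?inordK //;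
      by [exact: nk | move=> a /=; rewrite inordK //; lia].
  have el : l = N.+2 :> nat by have := ltn_ord l; lia.
  transitivity (sact C (joinm_inl 0 N) ((sval (t (inord j))).2 0 s)).
    by apply: sact_eq => a /=; rewrite el inordK //= /bump; have := ltn_ord a; lia.
  case: (proj2_sig (t (inord j))) => _ ->; rewrite hb //.
have face (j : 'I_N.+2) : j != k0 -> sact C (joinm (mono_id 0) (delta j)) c = (sval (t j)).2 0 s.
  move=> hj; have lj : j < N.+3 by have := ltn_ord j; lia.
  have hj' : (inord j : 'I_N.+3) != inord k0 by rewrite -val_eqE /= hk inordK.
  have := hc _ hj'; rewrite /u inordK // ltn_ord inord_val => <-.
  by apply: sact_eq => a; rewrite joinm_deltar /= inordK.
have base : sact C (joinm_inl 0 N.+1) c = b.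
  have hm : (ord_max : 'I_N.+3) != inord k0.
    by rewrite -val_eqE /= hk; have := ltn_ord k0; lia.
  have := hc _ hm; rewrite /u /= ltnn => <-; apply: sact_eq => a /=.
  by rewrite /bump; have := ltn_ord a; lia.
have ax : @lift_ax 0 (s, c) by split.
by exists (exist _ (s, c) ax).
Qed.

Lemma lift_faces k (z : 'I_k.+2 -> lift_sset k) (j l : 'I_k.+2) (u v : mono (k + N.+1) (k + N.+1).+1) :
  compat (fun _ => True) z -> j < l ->
  (forall a, u a = bump (N.+2 + l.-1) a :> nat) -> (forall a, v a = bump (N.+2 + j) a :> nat) ->
  sact C u (sval (z j)).2 = sact C v (sval (z l)).2.
Proof.
case: k z j l u v => [|k] z j l u v cz jl hu hv.
  (* For [k = 0] the two values meet only in the base simplex [b]. *)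
  transitivity b; [case: (proj2_sig (z j)) => <- _ | case: (proj2_sig (z l)) => <- _].
    by apply: sact_eq => -[a ha]; rewrite hu /= /bump; have := ltn_ord l; lia.
  by symmetry; apply: sact_eq => -[a ha]; rewrite hv /= /bump; have := ltn_ord l; lia.
have /(congr1 (fun w => (sval w).2)) /= E := compat_eq cz jl I I.
transitivity (sact C (joinm (delta (inord l.-1)) (mono_id N.+1)) (sval (z j)).2).
  by apply: sact_eq => a; rewrite hu joinm_deltal inordK //; have := ltn_ord l; lia.
rewrite E; apply: sact_eq => a; rewrite hv joinm_deltal inordK //; have := ltn_ord l; lia.
Qed.

(** The join of the horn with a full simplex, together with the join of a full simplex with the
    boundary, is again the horn of index [k0], now in dimension [k + N + 3], hence inner. Faces
    below [N + 2] come from [t], the others from [z]. *)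
Lemma lift_fill k (s : K k.+1) (z : 'I_k.+2 -> lift_sset k) :
  (forall l, lift_fst k (z l) = sact K (delta l) s) -> compat (fun _ => True) z ->
  exists w, lift_fst k.+1 w = s /\ forall l, sact lift_sset (delta l) w = z l.
Proof.
move=> hz cz.
have ce : (k + N.+1).+1 = (k.+1 + N).+1 by lia.
pose u (j : 'I_(k + N.+1).+3) : C (k + N.+1).+1 :=
  if j < N.+2 then sact C (castm ce) ((sval (t (inord j))).2 k.+1 s)
  else (sval (z (inord (j - N.+2)))).2.
have hk : (inord k0 : 'I_(k + N.+1).+3) = k0 :> nat by rewrite inordK //; have := ltn_ord k0; lia.
have nk (j : 'I_(k + N.+1).+3) : j != inord k0 -> j < N.+2 -> (inord j : 'I_N.+2) != k0.
  by move=> h lt; move: h; rewrite -!val_eqE /= hk inordK.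
case: (hI (N := (k + N.+1).+1) (k := inord k0) _ (t := u)) => [||c hc].
- by rewrite hk hk0 /=; have := ltn_ord k0; lia.
- apply: compat_faces => // j l jl hj hl; rewrite /u.
  have := ltn_ord l => ll.
  case: (ltnP j N.+2) => jlt; case: (ltnP l N.+2) => llt.
  + rewrite !sact_comp //; apply: (@slice_faces (inord j) (inord l) k.+1 s (k + N.+1)) ; rewrite ?inordK //;
      by [exact: nk | lia | move=> a /=; rewrite inordK //; lia].
  + have hj' := nk _ hj jlt.
    case: (proj2_sig (z (inord (l - N.+2)))) => _ /(_ _ hj').
    have -> : (sval (z (inord (l - N.+2)))).1 = sact K (delta (inord (l - N.+2))) s by rewrite -hz.
    case: (proj2_sig (t (inord j))) => -> _ E.
    have ce' : k + N.+1 = (k + N).+1 by lia.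
    transitivity (sact C (castm ce') (sact C (joinm (delta (inord (l - N.+2))) (mono_id N)) ((sval (t (inord j))).2 k.+1 s))).
      rewrite !sact_comp //; apply: sact_eq => a; rewrite [RHS]joinm_deltal /= !inordK; try lia.
      by rewrite /bump; lia.
    rewrite -E sact_comp //; apply: sact_eq => a; rewrite [LHS]joinm_deltar /= !inordK //; lia.
  + by lia.
  + apply: lift_faces => // [|a|a]; rewrite /= /bump !inordK; lia.
have face (j : 'I_N.+2) : j != k0 -> sact C (joinm (mono_id k.+1) (delta j)) c = (sval (t j)).2 k.+1 s.
  move=> hj; have lj : j < (k + N.+1).+3 by have := ltn_ord j; lia.
  have hj' : (inord j : 'I_(k + N.+1).+3) != inord k0 by rewrite -val_eqE /= hk inordK.
  have := hc _ hj'; rewrite /u inordK // ltn_ord inord_val => E.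
  have := congr1 (sact C (castm (esym ce))) E; rewrite !sact_comp // => E'.
  rewrite -[RHS](sact_id hC); transitivity (sact C (mono_comp (castm ce) (castm (esym ce))) ((sval (t j)).2 k.+1 s)); last exact: sact_eq.
  by rewrite -E'; apply: sact_eq => a; rewrite joinm_deltar /= inordK.
have facel (l : 'I_k.+2) : sact C (joinm (delta l) (mono_id N.+1)) c = (sval (z l)).2.
  have ll : N.+2 + l < (k + N.+1).+3 by have := ltn_ord l; lia.
  have hl : (inord (N.+2 + l) : 'I_(k + N.+1).+3) != inord k0.
    by rewrite -val_eqE /= hk inordK //; have := ltn_ord k0; lia.
  have := hc _ hl; rewrite /u inordK //.
  have -> : (N.+2 + l < N.+2) = false by lia.
  rewrite addKn inord_val => <-; apply: sact_eq => a; rewrite joinm_deltal /= inordK //.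
have base : sact C (joinm_inl k.+1 N.+1) c = b.
  case: (proj2_sig (z ord0)) => <- _; rewrite -facel sact_comp // joinm_comp_inl.
  exact: sact_eq.
have ax : @lift_ax k.+1 (s, c) by split.
exists (exist _ (s, c) ax); split=> // l; apply: sig_eq => /=.
by rewrite facel -hz; case: (z l) => [[]].
Qed.

Lemma slice_lift : exists w : slice K N.+1,
  [/\ (sval w).1 = b, (forall j, j != k0 -> sact (slice K) (delta j) w = t j) &
      (forall k s, (sval w).2 k (i k s) = yA s)].
Proof.
have axA k (s : A k) : @lift_ax k (i k s, yA s).
  by split=> [|j hj] /=; [case: hA => _ -> | apply: tA].
have nA m n (f : mono m n) (s : A n) :
    exist (@lift_ax m) _ (axA m (sact A f s)) = lift_act f (exist (@lift_ax n) _ (axA n s)).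
  by apply: sig_eq => /=; case: hA => -> _; rewrite snat.
pose tau : smap A lift_sset := @SMap A lift_sset (fun k s => exist _ _ (axA k s)) nA.
have tf : trivfib lift_fst by split=> [s|k s z hz cz]; [exact: lift_fill0 | exact: lift_fill].
case: (trivfib_section is_sset_lift hK tf (i := i) (tau := tau) i_inj) => // sec [h1 h2].
have ax : slice_ax b (fun k s => (sval (sec k s)).2).
  split=> [k k' a s|k s]; first by rewrite snat.
  by case: (proj2_sig (sec k s)).
exists (exist _ (b, fun k s => (sval (sec k s)).2) ax); split=> //=.
  move=> j hj; apply: slice_eq => [|k s] /=; first by rewrite hb.
  by case: (proj2_sig (sec k s)) => _ -> //; congr ((sval (t j)).2 k _); exact: h1.
by move=> k s; rewrite h2.
Qed.
End Lift.

Lemma slice_restr_rightfib A K (i : smap A K) : is_sset K -> innerfill C ->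
  (forall n, injective (i n)) -> rightfib (slice_restr i).
Proof.
move=> hK hI i_inj N k0 hk0 y t ct ht.
have := @slice_lift A K hK hI i i_inj N k0 hk0 (sval y).1 t (fun k s => (sval y).2 k s) ct.
case=> [j hj||j hj k s|w [h1 h2 h3]].
- by have := congr1 (fun z => (sval z).1) (ht j hj).
- exact: (proj2_sig y).
- by have := congr1 (fun z => (sval z).2 k s) (ht j hj).
- by exists w; split=> //; apply: slice_eq.
Qed.

Definition sempty : sset := @SSet (fun _ => False) (fun _ _ _ x => x).

(** The projection to [C] is restriction along the empty simplicial set, so this is [slice_lift]
    with nothing prescribed. *)
Lemma slice_base_rightfib K : is_sset K -> innerfill C -> rightfib (slice_base K).
Proof.
move=> hK hI N k0 hk0 y t ct ht.
have ni m n (f : mono m n) (x : sempty n) :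
  False_rect (K m) (sact sempty f x) = sact K f (False_rect (K n) x) by case: x.
pose i : smap sempty K := @SMap sempty K (fun n x => False_rect (K n) x) ni.
have i_inj n : injective (i n) by case.
have := @slice_lift sempty K hK hI i i_inj N k0 hk0 y t (fun k s => False_rect _ s) ct ht.
case=> [|j hj k []|w [h1 h2 _]]; first by split=> k; [move=> ? ? []|case].
by exists w.
Qed.
End Slice.

Definition edge01 N : mono 1 N.+1.
Proof.
refine (Mono (fun i => inord i) _) => i j h.
by rewrite !inordK; have := ltn_ord i; have := ltn_ord j; lia.
Defined.

Lemma edge01E N (i : 'I_2) : edge01 N i = i :> nat.
Proof. by rewrite /= inordK //; have := ltn_ord i; lia. Qed.

(** The edge 01 is read in the last face, which contains it because the dimension [N + 2] is at
    least 2. *)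
Definition leftfill (C : sset) := forall N (t : 'I_N.+3 -> C N.+1),
  compat (fun j => j != ord0) t -> is_equiv (sact C (edge01 N) (t ord_max)) ->
  exists c, forall j, j != ord0 -> sact C (delta j) c = t j.

Definition simplex N : sset := @SSet (fun m => mono m N) (fun m n f g => mono_comp g f).

Lemma is_sset_simplex N : is_sset (simplex N).
Proof.
split=> [n x|m n p f g x|m n f g x h]; apply: mono_eq => i //=; by rewrite h.
Qed.

Definition bdry N m (f : simplex N m) := exists j, forall i, (f : mono m N) i != j.

Lemma bdry_closed N : act_closed (@bdry N).
Proof. by move=> m n f g [j h]; exists j => i /=. Qed.

(* With [A] the boundary of [K := simplex N], the horn is an edge of the slice over
   [A] together with a lift of its source to the slice over [K]; lifting this
   edge fills the horn. *)
Theorem qcat_leftfill (C : sset) : is_sset C -> innerfill C -> leftfill C.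
Proof.
move=> hC hI N t ct he; case: (horn_glue hC ct) => h hh.
pose A := sub (@bdry_closed N).
pose i : smap A (simplex N) := sub_incl (@bdry_closed N).
have i_inj n : injective (i n) by move=> x y /= e; apply: sig_eq.
have hK := is_sset_simplex N.
have hA : is_sset A by apply: is_sset_sub.
have ce : (N + 1).+1 = N.+2 by lia.
(* The simplex of dimension [N + 2] is the join of the edge 01 with [simplex N]: [b] moves the first
   two vertices and [a] the others. *)
pose hj k p (a : mono k N) (b : mono p 1) : mono (k + p).+1 N.+2 :=
  mono_comp (castm ce) (joinm a b).
have hjn k k' p p' (a : mono k N) (b : mono p 1) (a' : mono k' k) (b' : mono p' p) :
    mono_comp (hj _ _ a b) (joinm a' b') = hj _ _ (mono_comp a a') (mono_comp b b').
  by rewrite /hj -joinm_comp; apply: mono_eq.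
have hji k p (a : mono k N) (b : mono p 1) l :
    hj _ _ a b (joinm_inl k p l) = b l :> nat.
  by have /(congr1 (fun f : mono _ _ => (f l : nat))) /= := joinm_comp_inl a b.
(* Reasons for a simplex to lie in the horn: it misses vertex 1 ([horn1]), a vertex of [simplex N]
   ([horn2]), or the last vertex ([horn0]). *)
have horn1 k (a : mono k N) : exists j : 'I_N.+3, j != ord0 /\ forall l, hj k 0 a (cst 0 ord0) l != j.
  exists (inord 1); split; first by rewrite -val_eqE /= inordK.
  by move=> l; rewrite -val_eqE /= /joinm_fun inordK //; case: ifP => //= _; lia.
have horn2 k p (a : mono k N) (b : mono p 1) : bdry (a : simplex N k) ->
    exists j : 'I_N.+3, j != ord0 /\ forall l, hj k p a b l != j.
  case=> j haj; have lj : j.+2 < N.+3 by have := ltn_ord j; lia.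
  exists (Ordinal lj); split=> // l; rewrite -val_eqE /= /joinm_fun.
  case: ifP => _; first by have := ltn_ord (b (inord l)); lia.
  by have := haj (inord (l - p.+1)); rewrite -val_eqE /=; lia.
have horn0 p (b : mono p N.+2) : (forall l, b l < 2) ->
    exists j : 'I_N.+3, j != ord0 /\ forall l, b l != j.
  by move=> hb; exists ord_max; split=> // l; rewrite -val_eqE /=; have := hb l; lia.
pose bm p (b : mono p 1) : mono p N.+2 := mono_comp (edge01 N.+1) b.
have bmP p (b : mono p 1) l : bm p b l < 2 by rewrite -[bm p b l]/(edge01 N.+1 (b l)) edge01E.
pose yb p (b : mono p 1) : C p := h p (exist _ (bm p b) (horn0 _ _ (bmP p b))).
(* [x] is the face opposite to vertex 1, seen as a vertex of the slice over [simplex N]; [f] below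
   collects the remaining faces as an edge of the slice over the boundary. *)
have xax : @slice_ax C (simplex N) 0 (yb 0 (cst 0 ord0))
    (fun k a => h _ (exist _ (hj k 0 a (cst 0 ord0)) (horn1 k a))).
  split=> [k k' a s|k s]; rewrite -snat; congr (h _ _); apply: sig_eq => /=.
    by rewrite hjn; congr (hj _ _ _ _); apply: mono_eq.
  by apply: mono_eq => l; rewrite [LHS]hji [RHS]edge01E.
pose x : slice hC (simplex N) 0 := exist _ (_, _) xax.
have fax : @slice_ax C A 1 (yb 1 (mono_id 1))
    (fun k a => h _ (exist _ (hj k 1 (sval a) (mono_id 1)) (horn2 k 1 _ _ (proj2_sig a)))).
  split=> [k k' a s|k s]; rewrite -snat; congr (h _ _); apply: sig_eq => /=.
    by rewrite hjn; congr (hj _ _ _ _); apply: mono_eq.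
  by apply: mono_eq => l; rewrite [LHS]hji [RHS]edge01E.
pose f : slice hC A 1 := exist _ (_, _) fax.
have sAC := @slice_base_rightfib C hC A hA hI.
have sKA := @slice_restr_rightfib C hC A _ i hK hI i_inj.
have isA := is_sset_slice hC A; have isK := is_sset_slice hC (simplex N).
have hIA := rightfib_innerfill sAC hI; have hIK := rightfib_innerfill sKA hIA.
have max0 : (ord_max : 'I_N.+3) != ord0 by [].
(* The projection to [C] sends [f] to the edge 01, and right fibrations are conservative. *)
have ef : is_equiv f.
  apply: (rightfib_conservative isA hC sAC hIA) => /=.
  move: he; rewrite -(hh _ max0) -snat; congr (is_equiv (h _ _)); apply: sig_eq => /=.
  apply: mono_eq => l; rewrite [RHS]edge01E /= inordK; last by have := ltn_ord l; lia.
  by rewrite /bump; have := ltn_ord l; lia.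
case: (rightfib_lift_equiv isK isA sKA hIK ef (x := x)) => [|e [pe se]].
  apply: slice_eq => [|k s] /=; rewrite -snat; congr (h _ _); apply: sig_eq => /=.
    by apply: mono_eq => l; rewrite !edge01E.
  by rewrite hjn; congr (hj _ _ _ _); apply: mono_eq.
pose c := sact C (castm (esym ce)) ((sval e).2 N (mono_id N)).
exists c => j hj0; rewrite -(hh _ hj0).
have hjp : 0 < j by move: (hj0); rewrite -val_eqE /=; lia.
rewrite /c sact_comp //.
(* Face 1 is the source of [e]; the others come from the restriction of [e] to the boundary. *)
case: (leqP j 1) => hj1.
  have e1 : N.+1 = (N + 0).+1 by lia.
  have /(congr1 (fun z => sact C (castm e1) ((sval z).2 N (mono_id N)))) := se.
  rewrite /= -snat sact_comp // => E; transitivity (sact C (mono_comp (joinm (mono_id N) (cst 0 ord0)) (castm e1)) ((sval e).2 N (mono_id N))).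
    apply: sact_eq => l /=; rewrite /joinm_fun /= /bump.
    by case: (leqP l 0) => hl; rewrite ?inordK; have := ltn_ord l; lia.
  rewrite E; congr (h _ _); apply: sig_eq => /=; apply: mono_eq => l /=; rewrite /joinm_fun /= /bump.
  by case: (leqP l 0) => hl; rewrite ?inordK; have := ltn_ord l; lia.
(* When [N = 0] the boundary is empty, and face 2 is the base edge of [e]. *)
have [N0|N0] : N = 0 \/ 0 < N by lia.
  have /(congr1 (fun z => (sval z).1)) /= E := pe.
  case: (proj2_sig e) => _ /(_ N (mono_id N)); rewrite E => E'.
  have e1 : N.+1 = 1 by lia.
  have := congr1 (sact C (castm e1)) E'; rewrite -snat sact_comp // => E2.
  have ej : j = 2 :> nat by have := ltn_ord j; lia.
  transitivity (sact C (mono_comp (joinm_inl N 1) (castm e1)) ((sval e).2 N (mono_id N))).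
    by apply: sact_eq => l /=; rewrite ej /bump; have := ltn_ord l; lia.
  rewrite E2; congr (h _ _); apply: sig_eq => /=; apply: mono_eq => l.
  by rewrite [LHS]edge01E /= ej /bump; have := ltn_ord l; lia.
have e3 : N.-1.+1 = N by lia.
(* Face [j] of the join forgets the vertex [j - 2] of [simplex N]. *)
have [dl dlE] : exists dl : mono N.-1 N, forall l, dl l = bump (j - 2) l :> nat.
  exists (mono_comp (castm e3) (delta (inord (j - 2)))) => l.
  by rewrite /= inordK //; have := ltn_ord j; lia.
have bdl : bdry (dl : simplex N N.-1).
  have lj : j - 2 < N.+1 by have := ltn_ord j; lia.
  by exists (Ordinal lj) => l; rewrite -val_eqE /= dlE /bump; lia.
have /(congr1 (fun z : slice hC A 1 => (sval z).2 N.-1 (exist _ dl bdl : A N.-1))) /= E := pe.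
case: (proj2_sig e) => /(_ _ _ dl (mono_id N)) E' _.
have e1 : N.+1 = (N.-1 + 1).+1 by lia.
have := congr1 (sact C (castm e1)) E'.
have -> : sact (simplex N) dl (mono_id N) = dl by apply: mono_eq.
rewrite E -snat sact_comp // => E2.
transitivity (sact C (mono_comp (joinm dl (mono_id 1)) (castm e1)) ((sval e).2 N (mono_id N))).
  apply: sact_eq => l; rewrite /= /joinm_fun. rewrite dlE /bump.
  by case: (leqP l 1) => hl; rewrite ?inordK; have := ltn_ord l; lia.
rewrite -E2; congr (h _ _); apply: sig_eq => /=; apply: mono_eq => l; rewrite /= /joinm_fun dlE /bump.
by case: (leqP l 1) => hl; rewrite ?inordK; have := ltn_ord l; lia.
Qed.

(** * Opposites and attaching simplices *)

Definition opS (X : sset) : sset := @SSet X (fun m n f x => sact X (revm f) x).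

Lemma revm_comp m n p (g : mono n p) (f : mono m n) :
  revm (mono_comp g f) = mono_comp (revm g) (revm f).
Proof. by apply: mono_eq => i /=; rewrite rev_ordK. Qed.

Lemma revm_id n : revm (mono_id n) = mono_id n.
Proof. by apply: mono_eq => i /=; have := ltn_ord i; lia. Qed.

Lemma is_sset_op X : is_sset X -> is_sset (opS X).
Proof.
move=> hX; split=> [n x|m n p f g x|m n f g x h] /=.
- by rewrite revm_id sact_id.
- by rewrite sact_comp // revm_comp.
- by have -> : f = g by apply: mono_eq => i; rewrite h.
Qed.

Lemma revm_delta N (j : 'I_N.+2) : revm (delta j) = delta (rev_ord j).
Proof.
apply: mono_eq => i /=; rewrite /bump; have := ltn_ord i; have := ltn_ord j; lia.
Qed.

Lemma compat_op (X : sset) N (J : 'I_N.+2 -> Prop) (t : 'I_N.+2 -> X N) :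
  compat J t -> @compat (opS X) N (fun j => J (rev_ord j)) (fun j => t (rev_ord j)).
Proof.
move=> ct i j Ji Jj m u v e; apply: ct => // a.
have E : mono_comp (delta i) u = mono_comp (delta j) v.
  by apply: mono_eq => b; exact: (congr1 val (e b)).
have /(congr1 (fun f : mono _ _ => f a)) := congr1 (@revm _ _) E.
by rewrite !revm_comp !revm_delta.
Qed.

Lemma innerfill_op X : innerfill X -> innerfill (opS X).
Proof.
move=> hI N k hk t ct.
case: (hI N (rev_ord k) _ (fun j => t (rev_ord j))) => [|i j hi hj m u v e|c hc].
- by rewrite /=; lia.
- have := @compat_op (opS X) _ _ _ ct i j; rewrite !(can2_eq rev_ordK rev_ordK) => H.
  by have := H hi hj m u v e; rewrite /= !revmK.
- exists c => j hj /=; rewrite revm_delta hc; last by rewrite (inj_eq rev_ord_inj).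
  by rewrite rev_ordK.
Qed.

Lemma tri_op (X : sset) (a b c : X 1) : @tri (opS X) b a c <-> tri a b c.
Proof.
split=> -[s [h2 h0 h1]]; exists s; move: h2 h0 h1; rewrite /= !revm_delta => h2 h0 h1.
  by split; [rewrite -h0|rewrite -h2|rewrite -h1]; congr (sact X (delta _) s); apply: val_inj.
by split; [rewrite -h0|rewrite -h2|rewrite -h1]; congr (sact X (delta _) s); apply: val_inj.
Qed.

Lemma src_op (X : sset) (e : X 1) : @src (opS X) e = tgt e.
Proof. by rewrite /src /tgt /=; apply: sact_eq. Qed.
Lemma tgt_op (X : sset) (e : X 1) : @tgt (opS X) e = src e.
Proof. by rewrite /src /tgt /=; apply: sact_eq. Qed.
Lemma idedge_op (X : sset) (x : X 0) : @idedge (opS X) x = idedge x.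
Proof. by rewrite /idedge /=; apply: sact_eq. Qed.

Lemma is_equiv_op (X : sset) (e : X 1) : @is_equiv (opS X) e <-> is_equiv e.
Proof.
split=> /is_equivP [g [h1 h2]]; apply/is_equivP; exists g; move: h1 h2;
  by rewrite src_op tgt_op !idedge_op => h1 h2; split; apply/tri_op.
Qed.

Definition rightfill (C : sset) := forall N (t : 'I_N.+3 -> C N.+1),
  compat (fun j => j != ord_max) t -> is_equiv (sact C (revm (edge01 N)) (t ord0)) ->
  exists c, forall j, j != ord_max -> sact C (delta j) c = t j.

Lemma qcat_rightfill C : is_sset C -> innerfill C -> rightfill C.
Proof.
move=> hC hI N t ct he.
have rm : rev_ord (ord_max : 'I_N.+3) = ord0 by apply: val_inj => /=; lia.
have r0 : rev_ord (ord0 : 'I_N.+3) = ord_max by apply: val_inj => /=; lia.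
case: (qcat_leftfill (is_sset_op hC) (innerfill_op hI) (t := fun j => t (rev_ord j))).
- move=> i j hi hj; apply: (compat_op ct); by rewrite -r0 (inj_eq rev_ord_inj).
- by rewrite rm; apply/is_equiv_op.
move=> c hc; exists c => j hj; have := hc (rev_ord j).
rewrite /= revm_delta !rev_ordK; apply.
by rewrite -rm (inj_eq rev_ord_inj).
Qed.

(** An operator either misses some vertex other than [k], or the face opposite to [k] factors
    through it; this detects the simplices that involve the missing face of a horn. *)
Lemma mono_hit_section m n (f : mono m n.+1) (k : 'I_n.+2) :
  (forall j, j != k -> exists i, f i = j) -> exists u, mono_comp f u = delta k.
Proof.
move=> h.
have [u hu] : exists u, forall j, f (u j) = delta k j.
  by apply: (functional_choice (fun j i => f i = delta k j)) => j; apply: h; apply: delta_neq.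
have hm (i j : 'I_n.+1) : i <= j -> u i <= u j.
  rewrite leq_eqVlt => /orP [/eqP /val_inj -> //|lt].
  rewrite leqNgt; apply/negP => /ltnW /(monoP f); rewrite !hu /= /bump; lia.
by exists (Mono u hm); apply: mono_eq => j /=; rewrite hu.
Qed.

(** * Attaching a family of simplices along horns *)

Section Attach.
Variables (B C : sset) (hB : is_sset B) (hC : is_sset C).
Variables (K : forall n, B n -> Prop) (hK : act_closed K) (phi : smap (sub hK) C).
Variables (n : nat) (k : 'I_n.+2) (Sg : B n.+1 -> Prop).

Definition attached m (s : B m) :=
  K s \/ exists sg (f : mono m n.+1), Sg sg /\ s = sact B f sg.

Lemma attached_closed : act_closed attached.
Proof.
move=> m p f b [h|[sg [g [h e]]]]; first by left; apply: hK.
by right; exists sg, (mono_comp g f); split=> //; rewrite e sact_comp.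
Qed.

Hypothesis Sg_inj : forall sg, Sg sg -> forall m (f g : mono m n.+1),
  sact B f sg = sact B g sg -> f = g.
Hypothesis Sg_faces : forall sg j, Sg sg -> j != k -> K (sact B (delta j) sg).
Hypothesis Sg_new : forall sg, Sg sg -> ~ K (sact B (delta k) sg).
Hypothesis Sg_uniq : forall sg sg' (h : mono n n.+1), Sg sg -> Sg sg' ->
  sact B (delta k) sg = sact B h sg' -> sg = sg'.

Lemma horn_family (sg : B n.+1) : Sg sg -> exists t : 'I_n.+2 -> C n,
  compat (fun j => j != k) t /\
  forall j (h : K (sact B (delta j) sg)), j != k -> t j = phi n (exist _ _ h).
Proof.
move=> hs.
have [t ht] : exists t : 'I_n.+2 -> C n,
    forall j, forall h : K (sact B (delta j) sg), j != k -> t j = phi n (exist _ _ h).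
  apply: (functional_choice (fun j v =>
    forall h : K (sact B (delta j) sg), j != k -> v = phi n (exist _ _ h))) => j.
  have [ej|hj] : j == k \/ j != k by case: eqP; [left|right].
    (* The entry at [j = k] is a default, taken from another face. *)
    have [j0 h0] : exists j0, j0 != k.
      exists (if k == ord0 then ord_max else ord0).
      by case: ifP => [/eqP ->|h] //; rewrite eq_sym h.
    by exists (phi n (exist _ _ (Sg_faces hs h0))) => h hn; exfalso; move: hn; rewrite ej.
  by exists (phi n (exist _ _ (Sg_faces hs hj))) => h _; congr (phi n _); apply: sig_eq.
exists t; split=> // i j hi hj m u v e.
rewrite (ht i (Sg_faces hs hi) hi) (ht j (Sg_faces hs hj) hj) -!snat.
congr (phi m _); apply: sig_eq; rewrite /= !sact_comp //.
by apply: sact_eq => a; exact: (congr1 val (e a)).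
Qed.

Hypothesis fill : forall sg, Sg sg -> forall t : 'I_n.+2 -> C n, compat (fun j => j != k) t ->
  (forall j (h : K (sact B (delta j) sg)), j != k -> t j = phi n (exist _ _ h)) ->
  exists c, forall j, j != k -> sact C (delta j) c = t j.

(** The value at the restriction of [sg] along [f] is that of the filler of [sg]. By
    [mono_hit_section] such a restriction lies in [K] only if [f] misses a vertex other than [k]
    ([key]); outside [K] it determines [sg] through its missing face, and then [f] ([agree]). *)
Lemma attach : exists phi' : smap (sub attached_closed) C,
  forall m s (h : K s) (h' : attached s), phi' m (exist _ s h') = phi m (exist _ s h).
Proof.
have [c hc] : exists c : {sg | Sg sg} -> C n.+1, forall sg j (h : K (sact B (delta j) (sval sg))),
    j != k -> sact C (delta j) (c sg) = phi n (exist _ _ h).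
  apply: (functional_choice (fun sg c => forall j (h : K (sact B (delta j) (sval sg))),
    j != k -> sact C (delta j) c = phi n (exist _ _ h))) => -[sg hs].
  case: (horn_family hs) => t [ct ht]; case: (fill hs ct ht) => c hc.
  by exists c => j h hj; rewrite hc //; apply: ht.
have key sg m (f : mono m n.+1) (h : K (sact B f (sval sg))) :
    phi m (exist _ _ h) = sact C f (c sg).
  case: (classic (exists j, j != k /\ forall i, f i != j)) => [[j [hj hf]]|hn].
    case: (mono_factor hf) => g eg; subst f.
    rewrite -[RHS]sact_comp // (hc sg j (Sg_faces (proj2_sig sg) hj) hj) -snat.
    by congr (phi m _); apply: sig_eq; rewrite /= sact_comp.
  exfalso; have [j hj|u eu] := @mono_hit_section m n f k.
    apply: NNPP => hh; apply: hn; exists j; split=> // i; apply/eqP => e; apply: hh.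
    by exists i.
  by apply: (Sg_new (proj2_sig sg)); rewrite -eu -sact_comp //; apply: hK.
have agree sg sg' m (f f' : mono m n.+1) : sact B f (sval sg) = sact B f' (sval sg') ->
    sact C f (c sg) = sact C f' (c sg').
  move=> e; case: (classic (K (sact B f (sval sg)))) => [h|nh].
    have h' := h; rewrite e in h'.
    by rewrite -(key _ _ _ h) -(key _ _ _ h'); congr (phi m _); apply: sig_eq.
  have [j hj|u eu] := @mono_hit_section m n f k.
    apply: NNPP => hh; apply: nh; have hf i : f i != j.
      by apply/eqP => ei; apply: hh; exists i.
    case: (mono_factor hf) => g ->; rewrite -sact_comp //; apply: hK.
    exact: Sg_faces (proj2_sig sg) hj.
  have E : sval sg = sval sg'.
    apply: (@Sg_uniq _ _ (mono_comp f' u) (proj2_sig sg) (proj2_sig sg')).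
    by rewrite -eu -!sact_comp // e.
  have E' := sig_eq E; subst sg'; congr (sact C _ _).
  exact: (Sg_inj (proj2_sig sg)).
pose Rel m (s : sub attached_closed m) (v : C m) :=
  (forall h : K (sval s), v = phi m (exist _ _ h)) /\
  (forall sg f, sval s = sact B f (sval sg) -> v = sact C f (c sg)).
have [|||phi' hphi] := @smap_of_rel (sub attached_closed) C Rel.
- move=> m [s hs]; case: (classic (K s)) => [h|nh].
    exists (phi m (exist _ _ h)); split=> [h'|sg f /= e].
      by congr (phi m _); apply: sig_eq.
    by subst s; apply: key.
  case: hs => [//|[sg [f [hs e]]]].
  exists (sact C f (c (exist _ sg hs))); split=> [h|sg' f' /= e'] //.
  by apply: agree; rewrite /= -e.
- move=> m [s hs] y y' [h1 h2] [h1' h2'].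
  case: (hs) => [h|[sg [f [hsg e]]]]; first by rewrite (h1 h) (h1' h).
  by rewrite (h2 (exist _ sg hsg) f e) (h2' (exist _ sg hsg) f e).
- move=> m p f [s hs] y [h1 h2]; split=> [h|sg g /= e].
    case: (hs) => [h'|[sg [g [hsg e]]]].
      by rewrite (h1 h') -snat; congr (phi m _); apply: sig_eq.
    rewrite (h2 (exist _ sg hsg) g e) sact_comp //; symmetry.
    have h'' : K (sact B (mono_comp g f) sg) by rewrite -sact_comp // -e.
    rewrite -(key (exist _ sg hsg) _ _ h''); congr (phi m _); apply: sig_eq.
    by rewrite /= e sact_comp.
  case: (hs) => [h'|[sg' [g' [hsg' e']]]].
    have h'' : K (sact B g (sval sg)) by rewrite -e; apply: hK.
    rewrite (h1 h') -(key sg _ _ h'') -snat; congr (phi m _); exact: sig_eq.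
  rewrite (h2 (exist _ sg' hsg') g' e') sact_comp //; apply: agree.
  by rewrite -sact_comp //= -e'.
by exists phi' => m s h h'; case: (hphi m (exist _ s h')) => h1 _; apply: h1.
Qed.
End Attach.

Section Extend.
Variables (B C : sset).

Lemma smap_sub_eq (K L : forall n, B n -> Prop) (hK : act_closed K) (hL : act_closed L)
    (phi : smap (sub hK) C) : (forall m s, L m s -> K m s) ->
  exists psi : smap (sub hL) C, forall m s (h : K m s) (h' : L m s), psi m (exist _ s h') = phi m (exist _ s h).
Proof.
move=> LK.
have nat m n (f : mono m n) (x : sub hL n) :
    phi m (exist _ (sval (sact (sub hL) f x)) (LK _ _ (proj2_sig (sact (sub hL) f x)))) =
    sact C f (phi n (exist _ (sval x) (LK _ _ (proj2_sig x)))).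
  by rewrite -snat; congr (phi m _); apply: sig_eq.
exists (@SMap (sub hL) C (fun n x => phi n (exist _ (sval x) (LK _ _ (proj2_sig x)))) nat).
by move=> m s h h' /=; congr (phi m _); apply: sig_eq.
Qed.

Lemma smap_union (K L : forall n, B n -> Prop) (hK : act_closed K) (hL : act_closed L)
    (M : forall n, B n -> Prop) (hM : act_closed M)
    (phi : smap (sub hK) C) (psi : smap (sub hL) C) :
  (forall m s, M m s -> K m s \/ L m s) ->
  (forall m s (h : K m s) (h' : L m s), phi m (exist _ s h) = psi m (exist _ s h')) ->
  exists chi : smap (sub hM) C,
    (forall m s (h : K m s) (h' : M m s), chi m (exist _ s h') = phi m (exist _ s h)) /\
    (forall m s (h : L m s) (h' : M m s), chi m (exist _ s h') = psi m (exist _ s h)).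
Proof.
move=> MKL agree.
pose Rel m (s : sub hM m) (v : C m) :=
  (forall h, v = phi m (exist _ (sval s) h)) /\ (forall h, v = psi m (exist _ (sval s) h)).
have [|||chi hchi] := @smap_of_rel (sub hM) C Rel.
- move=> m [s hs]; case: (MKL _ _ hs) => h.
    exists (phi m (exist _ s h)); split=> h' /=; last exact: agree.
    by congr (phi m _); apply: sig_eq.
  exists (psi m (exist _ s h)); split=> h' /=; first by rewrite (agree _ _ h' h).
  by congr (psi m _); apply: sig_eq.
- move=> m [s hs] y y' [h1 h2] [h1' h2'].
  by case: (MKL _ _ hs) => h; [rewrite (h1 h) (h1' h)|rewrite (h2 h) (h2' h)].
- move=> m n f [s hs] y [h1 h2]; case: (MKL _ _ hs) => h0.
    rewrite (h1 h0) -snat; split=> h /=.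
      by congr (phi m _); apply: sig_eq.
    by rewrite -(agree _ _ (hK _ _ f _ h0) h); congr (phi m _); apply: sig_eq.
  rewrite (h2 h0) -snat; split=> h /=.
    by rewrite (agree _ _ h (hL _ _ f _ h0)); congr (psi m _); apply: sig_eq.
  by congr (psi m _); apply: sig_eq.
by exists chi; split=> m s h h'; case: (hchi m (exist _ s h')) => h1 h2; [apply: h1|apply: h2].
Qed.
End Extend.

(** * Homotopy extension *)

(** Cosimplicial sets with a relation in each degree. The instances are [prismX], with the prisms as
    nerves, and [sd_max]; their function complexes glue along faces for the same reason. *)
Record cosrel := CosRel {
  cosX :> nat -> Type;
  cosR : forall n, cosX n -> cosX n -> Prop;
  cosmap : forall m n, mono m n -> cosX m -> cosX n;
  cosmapR : forall m n (f : mono m n) x y, cosR x y -> cosR (cosmap f x) (cosmap f y);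
  cosmap_id : forall n (x : cosX n), cosmap (mono_id n) x = x;
  cosmap_comp : forall m n p (f : mono m n) (g : mono n p) x,
    cosmap g (cosmap f x) = cosmap (mono_comp g f) x }.

Arguments cosR {c n} _ _.
Arguments cosmap {c m n} _ _.

Definition mkchain T (R : T -> T -> Prop) n (s : 'I_n.+1 -> T)
  (h : forall i j : 'I_n.+1, i <= j -> R (s i) (s j)) : chain R n :=
  exist (fun s => forall i j : 'I_n.+1, i <= j -> R (s i) (s j)) s h.

Lemma chain_eq T (R : T -> T -> Prop) n (s s' : chain R n) :
  (forall i, sval s i = sval s' i) -> s = s'.
Proof. by move=> h; apply: sig_eq; apply: functional_extensionality. Qed.

Lemma is_sset_nerve T (R : T -> T -> Prop) : is_sset (nerve R).
Proof.
split=> [n x|m n p f g x|m n f g x h]; apply: chain_eq => i //=.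
by rewrite (val_inj (congr1 val (h i))).
Qed.

Section CosMap.
Variables (X : cosrel) (C : sset).

Definition cosnerve n : sset := nerve (@cosR X n).

Definition cosnmap m n (f : mono m n) : smap (cosnerve m) (cosnerve n) :=
  nerve_map (@cosmapR X m n f).

Definition cosfun : sset :=
  @SSet (fun n => smap (cosnerve n) C) (fun m n f h => smap_comp h (cosnmap f)).

Lemma is_sset_cosfun : is_sset cosfun.
Proof.
split=> [n x|m n p f g x|m n f g x h].
- apply: smap_ext => k s /=; congr (x k _); apply: chain_eq => i /=; exact: cosmap_id.
- apply: smap_ext => k s /=; congr (x k _); apply: chain_eq => i /=; exact: cosmap_comp.
- by have -> : f = g by apply: mono_eq => i; rewrite h.
Qed.

(** Faces are full embeddings, and two of them meet only in their common face (in nothing, at the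
    bottom). This is what makes compatible families on the faces glue. *)
Definition cos_reedy :=
  [/\ (forall N (j : 'I_N.+2) (x y : X N), cosmap (delta j) x = cosmap (delta j) y -> x = y),
      (forall N (j : 'I_N.+2) (x y : X N), cosR (cosmap (delta j) x) (cosmap (delta j) y) -> cosR x y),
      (forall (i j : 'I_2) (x y : X 0), cosmap (delta i) x = cosmap (delta j) y -> i = j) &
      (forall N (i j : 'I_N.+3) (x y : X N.+1), i < j -> cosmap (delta i) x = cosmap (delta j) y ->
        exists w, x = cosmap (delta (inord j.-1)) w /\ y = cosmap (delta (inord i)) w)].

Definition in_faces N (J : 'I_N.+2 -> Prop) m (s : cosnerve N.+1 m) :=
  exists j s', J j /\ s = cosnmap (delta j) m s'.

Lemma in_faces_closed N (J : 'I_N.+2 -> Prop) : act_closed (@in_faces N J).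
Proof. by move=> m n f b [j [s' [Jj ->]]]; exists j, (sact _ f s'); rewrite snat. Qed.

Hypothesis reedy : cos_reedy.

Lemma glue_agree_lt N (J : 'I_N.+2 -> Prop) (t : 'I_N.+2 -> cosfun N) : compat J t ->
  forall i j, J i -> J j -> i < j -> forall m s s',
  cosnmap (delta i) m s = cosnmap (delta j) m s' -> t i m s = t j m s'.
Proof.
case: reedy => r1 r2 r3 r4; case: N J t => [|N] J t ct i j Ji Jj ij m s s' e.
  have := congr1 (fun u => sval u ord0) e => /= /r3 E.
  by move: ij; rewrite E ltnn.
(* The common preimages are chosen vertex by vertex; they form a chain because faces are full. *)
have [w hw] : exists w : 'I_m.+1 -> X N, forall a,
    sval s a = cosmap (delta (inord j.-1)) (w a) /\ sval s' a = cosmap (delta (inord i)) (w a).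
  apply: (functional_choice (fun a w => sval s a = cosmap (delta (inord j.-1)) w /\
    sval s' a = cosmap (delta (inord i)) w)) => a.
  by apply: r4 => //; have := congr1 (fun u => sval u a) e.
have cw (a b : 'I_m.+1) : a <= b -> cosR (w a) (w b).
  move=> ab; apply: (r2 _ (inord i)); case: (hw a) => _ <-; case: (hw b) => _ <-.
  exact: (proj2_sig s').
pose W : cosnerve N m := exist _ w cw.
have -> : s = cosnmap (delta (inord j.-1)) m W by apply: chain_eq => a /=; case: (hw a).
have -> : s' = cosnmap (delta (inord i)) m W by apply: chain_eq => a /=; case: (hw a).
by have := congr1 (fun h : smap _ _ => h m W) (compat_eq ct ij Ji Jj).
Qed.

Lemma glue_faces N (J : 'I_N.+2 -> Prop) (t : 'I_N.+2 -> cosfun N) : compat J t ->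
  exists phi : smap (sub (@in_faces_closed N J)) C,
    forall m j s (h : in_faces J (cosnmap (delta j) m s)), J j -> phi m (exist _ _ h) = t j m s.
Proof.
move=> ct; case: (reedy) => r1 r2 r3 r4.
have agree i j m s s' : J i -> J j -> cosnmap (delta i) m s = cosnmap (delta j) m s' -> t i m s = t j m s'.
  move=> Ji Jj e; case: (ltngtP i j) => [ij|ij|/val_inj E].
  - exact: (glue_agree_lt ct).
  - by symmetry; apply: (glue_agree_lt ct).
  - subst j; congr (t i m _); apply: chain_eq => a; apply: (r1 _ i).
    by have := congr1 (fun u => sval u a) e.
pose Rel m (s : sub (@in_faces_closed N J) m) (v : C m) :=
  forall j s', J j -> sval s = cosnmap (delta j) m s' -> v = t j m s'.
have [|||phi hphi] := @smap_of_rel _ C Rel.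
- move=> m [s [j [s' [Jj e]]]]; exists (t j m s') => i s'' Ji /= e'.
  by apply: agree => //; rewrite -e.
- move=> m [s [j [s' [Jj e]]]] y y' h h'; by rewrite (h j s' Jj e) (h' j s' Jj e).
- move=> m n f [s [j [s' [Jj e]]]] y h i s'' Ji e'.
  rewrite (h j s' Jj e) -snat; apply: agree => //.
  by transitivity (sact (cosnerve N.+1) f s); [rewrite e snat | exact: e'].
by exists phi => m j s h Jj; apply: (hphi m (exist _ _ h)).
Qed.
End CosMap.

Definition prismX : cosrel.
Proof.
refine (@CosRel (fun n => ('I_n.+1 * bool)%type) (fun n p q => p.1 <= q.1 /\ (p.2 ==> q.2))
  (fun m n f p => (f p.1, p.2)) _ _ _).
- by move=> m n f x y [h1 h2]; split=> //=; apply: monoP.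
- by move=> n [].
- by [].
Defined.

Lemma prism_reedy : cos_reedy prismX.
Proof.
split.
- move=> N j [x a] [y b] /= e.
  by have /lift_inj -> := congr1 fst e; have /= -> := congr1 snd e.
- move=> N j [x a] [y b] /= [h1 h2]; split=> //=; move: h1; rewrite /= /bump; lia.
- move=> i j [x a] [y b] /= e; have /(congr1 val) /= h := congr1 fst e.
  apply: val_inj; have := ltn_ord i; have := ltn_ord j.
  by move: h; rewrite /bump (ord1 x) (ord1 y) /=; lia.
- move=> N i j [x a] [y b] ij /= e.
  have /(congr1 val) /= h := congr1 fst e; have /= -> := congr1 snd e.
  have [|w [e1 e2]] := @delta_pullback N 0 i j (cst 0 x) (cst 0 y) ij.
    by move=> l; apply: val_inj.
  exists (w ord0, b); split; congr pair.
    by have := congr1 (fun f : mono _ _ => f ord0) e1.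
  by have := congr1 (fun f : mono _ _ => f ord0) e2.
Qed.

Section Homotopy.
Variables (C : sset) (hC : is_sset C).

(** The path object of [C]: its [n]-simplices are the maps to [C] from the prism over the
    [n]-simplex. *)
Definition paths := cosfun prismX C.

Lemma endp_ax n b (i j : 'I_n.+1) : i <= j -> @cosR prismX n (i, b) (j, b).
Proof. by move=> h; split=> //=; rewrite implybb. Qed.

Definition endp_chain n b : cosnerve prismX n n := exist _ (fun i => (i, b)) (@endp_ax n b).

Definition endp b n (h : paths n) : C n := (h : smap _ _) n (endp_chain n b).

Lemma endp_nat b m n (f : mono m n) (h : paths n) : endp b (sact paths f h) = sact C f (endp b h).
Proof. by rewrite /endp /= -snat; congr (h _ _); apply: chain_eq. Qed.

Lemma vert_ax n (v : 'I_n.+1) (i j : 'I_2) : i <= j ->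
  @cosR prismX n (v, i == ord_max) (v, j == ord_max).
Proof.
move=> h; split=> //=; apply/implyP => /eqP E; apply/eqP; apply: val_inj => /=.
by move: h; rewrite E /=; have := ltn_ord j; lia.
Qed.

Definition vert n (v : 'I_n.+1) : cosnerve prismX n 1 := exist _ (fun i => (v, i == ord_max)) (vert_ax v).

Definition vert_equiv n (h : paths n) := forall v, is_equiv ((h : smap _ _) 1 (vert v)).

Lemma vert_equiv_act m n (f : mono m n) (h : paths n) : vert_equiv h -> vert_equiv (sact paths f h).
Proof.
move=> hv v; have := hv (f v); congr (is_equiv (h _ _)); exact: chain_eq.
Qed.

Definition fstm n m (s : cosnerve prismX n m) : mono m n :=
  Mono (fun i => (sval s i).1) (fun i j h => proj1 (proj2_sig s i j h)).

Definition const_homotopy n (x : C n) : paths n.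
Proof.
refine (@SMap (cosnerve prismX n) C (fun m s => sact C (fstm s) x) _).
by move=> m p f s; rewrite sact_comp //; apply: sact_eq.
Defined.

Lemma const_homotopy_endp b n (x : C n) : endp b (const_homotopy x) = x.
Proof. by rewrite /endp /= -[RHS](sact_id hC); apply: sact_eq. Qed.

Lemma const_homotopy_equiv n (x : C n) : vert_equiv (const_homotopy x).
Proof.
move=> v /=; suff -> : sact C (fstm (vert v)) x = idedge (sact C (cst 0 v) x).
  exact: is_equiv_idedge.
by rewrite /idedge sact_comp //; apply: sact_eq.
Qed.

Hypothesis hI : innerfill C.

Section Prism.
Variables (N : nat) (x : C N.+1) (t : 'I_N.+2 -> paths N).
Hypothesis ct : compat (fun _ => True) t.
Hypothesis tx : forall j, endp false (t j) = sact C (delta j) x.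
Hypothesis tv : forall j, vert_equiv (t j).

Let Q := cosnerve prismX N.+1.
Let hQ : is_sset Q := is_sset_nerve _.

Definition allfalse m (s : Q m) := forall i, (sval s i).2 = false.
Definition prism_base m (s : Q m) := in_faces (fun _ => True) s \/ allfalse s.

Lemma in_facesP m (s : Q m) j : (forall i, (sval s i).1 != j) -> in_faces (fun _ => True) s.
Proof.
move=> h; case: (@mono_factor _ _ (fstm s) j h) => g eg.
have gE i : (sval s i).1 = delta j (g i).
  by have := congr1 (fun f : mono _ _ => f i) eg.
have gax (a b : 'I_m.+1) : a <= b -> @cosR prismX N (g a, (sval s a).2) (g b, (sval s b).2).
  by move=> ab; split=> /=; [apply: monoP|case: (proj2_sig s a b ab)].
exists j, (exist _ (fun i => (g i, (sval s i).2)) gax); split=> //; apply: chain_eq => i /=.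
by rewrite [LHS]surjective_pairing gE.
Qed.

(** Such an [s] lies in the maximal simplex (0,0), ..., (l',0), (l',1), ..., (N+1,1) for some l' at
    least [l]. *)
Definition below l m (s : Q m) := exists l', [/\ l <= l', l' <= N.+1 &
  forall i, if (sval s i).2 then l' <= (sval s i).1 else (sval s i).1 <= l'].

Definition stage l m (s : Q m) := prism_base s \/ below l s.

Lemma prism_base_closed : act_closed prism_base.
Proof.
move=> m n f b [h|h]; first by left; apply: in_faces_closed.
by right=> i /=.
Qed.

Lemma stage_closed l : act_closed (stage l).
Proof.
move=> m n f b [h|[l' [h1 h2 h3]]]; first by left; apply: prism_base_closed.
by right; exists l'; split=> // i; apply: h3.
Qed.

Definition prism_simplex_fun (l i : nat) : 'I_N.+2 * bool :=
  if i <= l then (inord i, false) else (inord i.-1, true).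

Lemma prism_simplex_ax l (i j : 'I_N.+3) : l <= N.+1 -> i <= j ->
  @cosR prismX N.+1 (prism_simplex_fun l i) (prism_simplex_fun l j).
Proof.
move=> hl ij; rewrite /prism_simplex_fun; have := ltn_ord i; have := ltn_ord j.
by case: (leqP i l) => h1; case: (leqP j l) => h2 h3 h4; split=> //=; rewrite ?inordK; lia.
Qed.

Definition prism_simplex l (hl : l <= N.+1) : Q N.+2 :=
  @mkchain _ (@cosR prismX N.+1) N.+2 (fun i : 'I_N.+3 => prism_simplex_fun l i)
    (fun i j => @prism_simplex_ax l i j hl).

Lemma prism_simplex_inj l (hl : l <= N.+1) m (f g : mono m N.+2) :
  sact Q f (prism_simplex hl) = sact Q g (prism_simplex hl) -> f = g.
Proof.
move=> e; apply: mono_eq => i; have /= := congr1 (fun u => sval u i) e.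
rewrite /prism_simplex_fun; have := ltn_ord (f i); have := ltn_ord (g i).
case: (leqP (f i) l) => h1; case: (leqP (g i) l) => h2 h3 h4 //;
  by case=> /(congr1 val); rewrite /= !inordK; lia.
Qed.

(* The simplex (0,0), ..., (l,0), (l,1), ..., (m,1) is attached along the horn
   missing the face opposite to (l,0), for l = m, ..., 0; the horn is inner
   unless l = 0, when its first edge is a vertical edge, hence an equivalence. *)
Lemma stage_step l (phi : smap (sub (stage_closed (l := l.+1))) C) : l <= N.+1 ->
  (forall h : stage l.+1 (vert ord0), is_equiv (phi 1 (exist _ (vert ord0) h))) ->
  exists psi : smap (sub (stage_closed (l := l))) C,
    forall m s (h : stage l.+1 s) (h' : stage l s), psi m (exist _ s h') = phi m (exist _ s h).
Proof.
move=> hl hv; pose sg := prism_simplex hl.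
have lt : l < N.+3 by lia.
pose k : 'I_N.+3 := Ordinal lt.
have [| | | | |psi hpsi] := @attach Q C hQ hC _ (stage_closed (l := l.+1)) phi N.+1 k (fun s => s = sg).
- by move=> _ -> m f g; apply: prism_simplex_inj.
- move=> _ j -> hj; have {}hj : (j : nat) <> l by move=> e; case/eqP: hj; apply: val_inj.
  have lj := ltn_ord j.
  (* The face misses column [j] or [j - 1] unless [j = l + 1]; in that case it lies in the next
     maximal simplex, or in the bottom when [l = N + 1]. *)
  case: (ltngtP j l.+1) => [jl|jl|jl].
  + left; left; apply: (@in_facesP _ _ (inord j)) => i /=.
    rewrite /prism_simplex_fun -val_eqE /=; have h2 := ltn_ord i.
    by case: ifP; rewrite /bump => h1 /=; rewrite ?inordK; lia.
  + left; left; apply: (@in_facesP _ _ (inord j.-1)) => i /=.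
    rewrite /prism_simplex_fun -val_eqE /=; have h2 := ltn_ord i.
    by case: ifP; rewrite /bump => h1 /=; rewrite ?inordK; lia.
  + case: (ltnP l N.+1) => hl'.
      right; exists l.+1; split=> // i /=; rewrite /prism_simplex_fun jl; have h2 := ltn_ord i.
      by case: (leqP (bump l.+1 i) l); rewrite /bump => h1 /=; rewrite ?inordK; lia.
    left; right=> i /=; rewrite /prism_simplex_fun jl; have := ltn_ord i => h2.
    by rewrite ifT // /bump; lia.
(* The missing face meets every column and contains [(l, true)], so it lies neither on a wall, nor
   in the bottom, nor in a simplex that switches after [l]. *)
- have hit (j : 'I_N.+2) : exists i, (sval (sact Q (delta k) sg) i).1 = j.
    exists j; rewrite /= /prism_simplex_fun /=; have := ltn_ord j => h1.
    by case: ifP; rewrite /bump => h2; apply: val_inj; rewrite /= inordK; lia.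
  have li : l < N.+2 by lia.
  have vl : sval (sact Q (delta k) sg) (Ordinal li) = (inord l, true).
    rewrite /= /prism_simplex_fun /= /bump leqnn ifF /=; last by lia.
    by [].
  move=> _ ->; case=> [[[j [s' [_ e]]]|h]|[l' [h1 h2 h3]]].
  + case: (hit j) => i; have -> /= := congr1 (fun u => sval u i) e.
    by move=> /eqP; apply/negP; apply: delta_neq.
  + by have := h (Ordinal li); rewrite vl.
  + by have := h3 (Ordinal li); rewrite vl /= inordK; lia.
- by move=> s s' h -> ->.
- move=> _ -> u cu hu; case: (posnP l) => hl0; last by apply: hI => //=; lia.
  have k0 : k = ord0 by apply: val_inj.
  rewrite k0 in cu hu *; apply: (qcat_leftfill hC hI cu).
  have [hK eK] : exists hK : stage l.+1 (sact Q (delta ord_max) sg), True.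
    suff hK : stage l.+1 (sact Q (delta ord_max) sg) by exists hK.
    left; left; apply: (@in_facesP _ _ ord_max) => i /=.
    rewrite /prism_simplex_fun -val_eqE /=; have h2 := ltn_ord i.
    by case: ifP; rewrite /bump => h1 /=; rewrite ?inordK; lia.
  rewrite (hu _ hK) // -snat.
  set w := sact _ _ _; have ew : sval w = vert ord0.
    apply: chain_eq => i; rewrite /w /= /prism_simplex_fun inordK; last by have := ltn_ord i; lia.
    rewrite hl0 /bump; case: (ord2_cases i) => -> /=; congr pair; apply: val_inj; by rewrite /= inordK.
  have hvk : stage l.+1 (vert ord0) by rewrite -ew; apply: (proj2_sig w).
  by have -> : w = exist _ _ hvk by apply: sig_eq.
have LK m (s : Q m) : stage l s -> attached (stage l.+1) (fun s => s = sg) s.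
  case=> [h|[l' [h1 h2 h3]]]; first by left; left.
  case: (ltnP l l') => hl'; first by left; right; exists l'.
  have E : l' = l by lia.
  subst l'; right; exists sg.
  have ax (i j : 'I_m.+1) : i <= j ->
      (inord ((sval s i).1 + (sval s i).2) : 'I_N.+3) <= (inord ((sval s j).1 + (sval s j).2) : 'I_N.+3).
    move=> ij; have [] := proj2_sig s i j ij; case: (sval s i) => a b; case: (sval s j) => a' b' /=.
    have := ltn_ord a; have := ltn_ord a'.
    by case: b; case: b' => //= h6 h7 h8 _; rewrite !inordK; lia.
  exists (Mono _ ax); split=> //; apply: chain_eq => i /=; rewrite /prism_simplex_fun.
  have := h3 i; case: (sval s i) => a b /=; have := ltn_ord a => h4.
  case: b => h5 /=; rewrite inordK; try lia.
    by rewrite ifF; [congr pair; apply: val_inj; rewrite /= inordK; lia | lia].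
  by rewrite ifT; [congr pair; apply: val_inj; rewrite /= inordK; lia | lia].
have [psi' hpsi'] := @smap_sub_eq Q C _ _ _ (stage_closed (l := l)) psi LK.
exists psi' => m s h h'; rewrite (hpsi' _ _ (or_introl h)); exact: hpsi.
Qed.

(** Since the base has positive dimension, every vertical edge lies on a wall, where [tv] makes it
    an equivalence. This serves both the outer horn at [l = 0] and the conclusion. *)
Lemma prism_fill : exists h : paths N.+1,
  [/\ endp false h = x, vert_equiv h & forall j, sact paths (delta j) h = t j].
Proof.
have [phiU hphiU] := glue_faces prism_reedy ct.
have af_closed : act_closed allfalse by move=> m n f b h i /=.
have natF m n (f : mono m n) (s : sub af_closed n) :
    sact C (fstm (sval (sact (sub af_closed) f s))) x = sact C f (sact C (fstm (sval s)) x).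
  by rewrite sact_comp //; apply: sact_eq.
pose phiF : smap (sub af_closed) C :=
  @SMap (sub af_closed) C (fun m s => sact C (fstm (sval s)) x) natF.
have [|m s h h'|phi0 [h0U h0F]] := @smap_union Q C _ _ (@in_faces_closed prismX N _) af_closed _ prism_base_closed phiU phiF.
- by move=> m s; case; [left|right].
- have [j [s' [_ es]]] := h; subst s; rewrite hphiU //=.
  have -> : s' = sact _ (fstm s') (endp_chain N false).
    apply: chain_eq => i /=; rewrite [LHS]surjective_pairing; congr pair.
    by have := h' i.
  rewrite snat -/(endp false (t j)) tx sact_comp //; apply: sact_eq => i //.
(* Stage [N + 2] is the bottom and the walls alone, as no switch exceeds [N + 1]; stage 0 is the
   whole prism. *)
have steps d : d <= N.+2 -> exists phi : smap (sub (stage_closed (l := N.+2 - d))) C,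
    forall m s (h : prism_base s) (h' : stage (N.+2 - d) s), phi m (exist _ s h') = phi0 m (exist _ s h).
  elim: d => [_|d IH hd].
    apply: smap_sub_eq => m s [//|[l' [h1 h2 _]]]; lia.
  case: IH => [|phi hphi]; first lia.
  have el : N.+2 - d = (N.+2 - d.+1).+1 by lia.
  move: phi hphi; rewrite el => phi hphi.
  have [||psi hpsi] := @stage_step (N.+2 - d.+1) phi; first by lia.
    move=> h; have hb : prism_base (vert (ord0 : 'I_N.+2)).
      by left; apply: (@in_facesP _ _ ord_max) => i.
    rewrite (hphi _ _ hb); case: (hb) => [hU|/(_ ord_max)] //.
    rewrite (h0U _ _ hU).
    have E : vert (ord0 : 'I_N.+2) = @cosnmap prismX _ _ (delta ord_max) 1 (vert ord0).
      by apply: chain_eq => i /=; congr pair; apply: val_inj.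
    have hU' : in_faces (fun _ => True) (@cosnmap prismX _ _ (delta ord_max) 1 (vert (ord0 : 'I_N.+1))).
      by rewrite -E.
    have -> : exist _ _ hU = exist _ _ hU' :> sub (@in_faces_closed prismX N (fun _ => True)) 1 by apply: sig_eq.
    by rewrite hphiU //; apply: tv.
  exists psi => m s h h'; rewrite (hpsi _ _ (or_introl h)); exact: hphi.
have [phi hphi] := steps N.+2 (leqnn _).
have all m (s : Q m) : stage (N.+2 - N.+2) s.
  rewrite subnn; right; case: (classic (exists i, (sval s i).2 = false)) => [[i0 hi0]|h]; last first.
    exists 0; split=> // i; case e: (sval s i).2 => //; case: h; by exists i.
  (* The switch is the largest column reached before the second coordinate turns true. *)
  case: (@arg_maxnP _ i0 (fun i => ~~ (sval s i).2) (fun i => (sval s i).1 : nat)); first by rewrite hi0.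
  move=> i /negbTE hi hmax; exists (sval s i).1; split=> // [|j]; first by have := ltn_ord (sval s i).1; lia.
  case e: (sval s j).2; last by apply: hmax; rewrite e.
  case: (leqP i j) => ij; first by case: (proj2_sig s i j ij).
  by case: (proj2_sig s j i (ltnW ij)) => _; rewrite e hi.
have natH m n (f : mono m n) (s : Q n) :
    phi m (exist _ (sact Q f s) (all _ _)) = sact C f (phi n (exist _ s (all _ s))).
  by rewrite -snat; congr (phi m _); apply: sig_eq.
pose H : paths N.+1 := @SMap Q C (fun m s => phi m (exist _ s (all _ s))) natH.
have EH j : sact paths (delta j) H = t j.
  apply: smap_ext => m s; rewrite -[LHS]/(phi m (exist _ (@cosnmap prismX _ _ (delta j) m s) (all _ _))).
  have hU : in_faces (fun _ => True) (@cosnmap prismX _ _ (delta j) m s) by exists j, s.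
  by rewrite (hphi _ _ (or_introl hU)) (h0U _ _ hU) hphiU.
exists H; split=> //.
- rewrite /endp /=.
  have hF : allfalse (endp_chain N.+1 false) by move=> i.
  rewrite (hphi _ _ (or_intror hF)) (h0F _ _ hF) /= -[RHS](sact_id hC).
  exact: sact_eq.
- move=> v; have [j [v' ev]] : exists j v', v = delta (j : 'I_N.+2) v'.
    case: (eqVneq v ord0) => [->|hv].
      by exists ord_max, ord0; apply: val_inj.
    exists ord0, (inord v.-1); apply: val_inj => /=; move: hv; rewrite -val_eqE /= => hv.
    by rewrite /bump inordK; have := ltn_ord v; lia.
  have := tv j v'; rewrite -EH ev; congr (is_equiv (H _ _)); exact: chain_eq.
Qed.
End Prism.

Section HEP.
Variables (A B : sset) (hB : is_sset B) (i : smap A B) (i_inj : forall n, injective (i n)).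
Variables (g : smap B C) (H : smap A paths).
Hypothesis Hg : forall n a, endp false (H n a) = g n (i n a).
Hypothesis Hv : forall n a, vert_equiv (H n a).

(** Sections of the projection of these pairs to [B] are homotopies starting at [g], so extending
    [H] is an instance of [trivfib_section]. *)
Definition homotopy_extension_ax m (z : B m * paths m) := endp false z.2 = g m z.1 /\ vert_equiv z.2.

Definition hep_act m n (f : mono m n) (z : {z | @homotopy_extension_ax n z}) : {z | @homotopy_extension_ax m z}.
Proof.
exists (sact B f (sval z).1, sact paths f (sval z).2).
case: z => [[b h] [h1 h2]]; split; last exact: vert_equiv_act.
by rewrite endp_nat snat; congr (sact C f _).
Defined.

Definition hep_sset : sset := @SSet (fun m => {z | @homotopy_extension_ax m z}) hep_act.

Lemma is_sset_hep : is_sset hep_sset.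
Proof.
have hP := is_sset_cosfun prismX C.
split=> [n [[b h] hz]|m n p f f' [[b h] hz]|m n f f' x h].
- by apply: sig_eq; congr pair; [apply: (sact_id hB)|apply: (sact_id hP)].
- by apply: sig_eq; congr pair; [apply: (sact_comp hB)|apply: (sact_comp hP)].
- by have -> : f = f' by apply: mono_eq => l; rewrite h.
Qed.

Definition hep_fst : smap hep_sset B := @SMap hep_sset B (fun m z => (sval z).1) (fun _ _ _ _ => erefl).

Lemma hep_trivfib : trivfib hep_fst.
Proof.
split=> [b|N b t tb ct].
  have ax : @homotopy_extension_ax 0 (b, const_homotopy (g 0 b)).
    by split; [apply: const_homotopy_endp|apply: const_homotopy_equiv].
  by exists (exist _ _ ax).
have [|||h [h1 h2 h3]] := @prism_fill N (g N.+1 b) (fun j => (sval (t j)).2).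
- move=> j l _ _ m u v e.
  by have /(congr1 (fun z => (sval z).2)) := ct j l I I m u v e.
- by move=> j; case: (proj2_sig (t j)) => -> _; rewrite -snat; congr (g N _); apply: tb.
- by move=> j; case: (proj2_sig (t j)).
have ax : @homotopy_extension_ax N.+1 (b, h) by [].
exists (exist _ _ ax); split=> // j; apply: sig_eq; rewrite [RHS]surjective_pairing.
by congr pair; [rewrite -[RHS]/(hep_fst N (t j)) tb|apply: h3].
Qed.

Lemma homotopy_extension : exists f : smap B C, forall n a, f n (i n a) = endp true (H n a).
Proof.
have axA n (a : A n) : @homotopy_extension_ax n (i n a, H n a) by split; [apply: Hg|apply: Hv].
have nA m n (f : mono m n) (a : A n) :
    exist (@homotopy_extension_ax m) _ (axA m (sact A f a)) = hep_act f (exist (@homotopy_extension_ax n) _ (axA n a)).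
  by apply: sig_eq; rewrite /= !snat.
pose tau : smap A hep_sset := @SMap A hep_sset (fun n a => exist _ _ (axA n a)) nA.
case: (trivfib_section is_sset_hep hB hep_trivfib (i := i) (tau := tau) i_inj) => // sec [h1 h2].
have nf m n (f : mono m n) (b : B n) :
    endp true (sval (sec m (sact B f b))).2 = sact C f (endp true (sval (sec n b)).2).
  by rewrite snat -endp_nat.
exists (@SMap B C (fun n b => endp true (sval (sec n b)).2) nf) => n a /=.
by rewrite h2.
Qed.
End HEP.
End Homotopy.

(** * The nerve of the preorder of maxima *)

Lemma sd_eq n (A B : sdT n) : sval A = sval B -> A = B.
Proof. by case: A B => [A hA] [B hB] /= e; subst B; rewrite (bool_irrelevance hA hB). Qed.

Lemma maxo_in n (A : sdT n) : maxo A \in sval A.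
Proof.
case: (maxS_ex (proj2_sig A)) => a ha ea; suff -> : maxo A = a by [].
exact: val_inj.
Qed.

Lemma maxo_dimg m n (f : mono m n) (A : sdT m) : maxo (dimg f A) = f (maxo A).
Proof. by apply: val_inj; apply: (maxS_img f (maxo_in A)). Qed.

Lemma maxS_sub n (A B : {set 'I_n.+1}) : A \subset B -> maxS A <= maxS B.
Proof. by move=> /subsetP h; apply: maxS_lub => a /h; apply: maxS_ub. Qed.

Lemma dimg_id n (A : sdT n) : dimg (mono_id n) A = A.
Proof. by apply: sd_eq => /=; apply: imset_id. Qed.

Lemma dimg_comp m n p (f : mono m n) (g : mono n p) (A : sdT m) :
  dimg g (dimg f A) = dimg (mono_comp g f) A.
Proof. by apply: sd_eq => /=; rewrite -imset_comp. Qed.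

Definition sd_max : cosrel.
Proof.
refine (@CosRel sdT (fun n A B => maxo A <= maxo B) (fun m n f => dimg f) _ dimg_id dimg_comp).
by move=> m n f A B h; rewrite !maxo_dimg; apply: monoP.
Defined.

Lemma sd_max_reedy : cos_reedy sd_max.
Proof.
split.
- move=> N j x y /(congr1 (fun A => sval A)) /= e; apply: sd_eq.
  exact: (imset_inj (@delta_inj _ j)) e.
- move=> N j x y; rewrite /= -![maxS _]/(nat_of_ord (maxo (dimg (delta j) _))) !maxo_dimg /= /bump; lia.
- move=> i j x y /(congr1 (@maxo _)) /=; rewrite !maxo_dimg (ord1 (maxo x)) (ord1 (maxo y)).
  move=> /(congr1 val); rewrite /= /bump /= => h.
  by apply: val_inj => /=; have := ltn_ord i; have := ltn_ord j; lia.
- move=> N i j x y ij e.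
  have eS : delta i @: sval x = delta j @: sval y by have := congr1 (fun A : sdT _ => sval A) e.
  have pb (a b : 'I_N.+2) : delta i a = delta j b ->
      exists c, a = delta (inord j.-1) c /\ b = delta (inord i) c.
    move=> eab; have [|w [e1 e2]] := @delta_pullback N 0 i j (cst 0 a) (cst 0 b) ij; first by [].
    exists (w ord0); split.
      by have := congr1 (fun f : mono _ _ => f ord0) e1.
    by have := congr1 (fun f : mono _ _ => f ord0) e2.
  (* [W] is the set in the common face of codimension 2 from which both [x] and [y] come. *)
  pose W := [set c | delta (inord j.-1) c \in sval x].
  have hx : sval x = delta (inord j.-1) @: W.
    apply/setP => a; apply/idP/imsetP => [ha|[c]]; last by rewrite inE => hc ->.
    have : delta i a \in delta j @: sval y by rewrite -eS imset_f.
    by case/imsetP => b hb /pb [c [ea _]]; exists c => //; rewrite inE -ea.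
  have hy : sval y = delta (inord i) @: W.
    apply/setP => b; apply/idP/imsetP => [hb|[c]].
      have : delta j b \in delta i @: sval x by rewrite eS imset_f.
      case/imsetP => a ha /esym /pb [c [ea eb]]; exists c => //; by rewrite inE -ea.
    rewrite inE => hc ->.
    have : delta i (delta (inord j.-1) c) \in delta j @: sval y by rewrite -eS imset_f.
    have -> : delta i (delta (inord j.-1) c) = delta j (delta (inord i) c).
      by have := congr1 (fun f : mono _ _ => f c) (delta_delta ij).
    by case/imsetP => b' hb' /delta_inj ->.
  have nW : W != set0 by have := proj2_sig x; rewrite {1}hx imset_eq0.
  by exists (exist _ W nW); split; apply: sd_eq.
Qed.

Lemma sing_ax n (i : 'I_n.+1) : [set i] != set0.
Proof. by apply/set0Pn; exists i; rewrite inE. Qed.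
Definition sing n (i : 'I_n.+1) : sdT n := exist _ [set i] (sing_ax i).

Lemma maxo_sing n (i : 'I_n.+1) : maxo (sing i) = i.
Proof. by have := maxo_in (sing i); rewrite inE => /eqP. Qed.

Lemma dimg_sing m n (f : mono m n) i : dimg f (sing i) = sing (f i).
Proof. by apply: sd_eq; rewrite /= imset_set1. Qed.

Section SetMaps.
Variables (C : sset) (hC : is_sset C) (hI : innerfill C).

Definition maxMaps := cosfun sd_max C.
Definition maxNerve n := cosnerve sd_max n.
Lemma is_sset_maxNerve n : is_sset (maxNerve n). Proof. exact: is_sset_nerve. Qed.

(** Sets with the same maximum are isomorphic in the preorder: every word in [x] and [y] is a chain,
    and the inverse and its two witnesses are such words. *)
Lemma maxNerve_equiv n (e : maxNerve n 1) : maxo (sval e ord0) = maxo (sval e ord_max) -> is_equiv e.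
Proof.
move=> he; pose x := sval e ord0; pose y := sval e ord_max.
have ax k (f : 'I_k.+1 -> bool) (i j : 'I_k.+1) : i <= j ->
    @cosR sd_max n (if f i then y else x) (if f j then y else x).
  by move=> _; rewrite /= /x /y; case: (f i); case: (f j); rewrite ?he ?leqnn //=;
     have := congr1 val he => /= ->.
pose ch k f : maxNerve n k := mkchain (ax k f).
apply/is_equivP; exists (ch 1 (fun i => i == ord0)); split.
  exists (ch 2 (fun i => i == o1)); split; apply: chain_eq => i;
    by case: (ord2_cases i) => ->.
exists (ch 2 (fun i => i != o1)); split; apply: chain_eq => i;
  by case: (ord2_cases i) => ->.
Qed.

Lemma maxMaps_equiv n (h : maxMaps n) (e : maxNerve n 1) :
  maxo (sval e ord0) = maxo (sval e ord_max) -> is_equiv ((h : smap _ _) 1 e).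
Proof. by move=> he; apply: (is_equiv_map h); apply: maxNerve_equiv. Qed.

Lemma max_sing_chain_ax n m (s : maxNerve n m) (i j : 'I_m.+1) : i <= j ->
  @cosR sd_max n (sing (maxo (sval s i))) (sing (maxo (sval s j))).
Proof. by move=> h; rewrite -[cosR _ _]/(is_true (maxo _ <= maxo _)) !maxo_sing; apply: (proj2_sig s). Qed.
Definition max_sing_chain n m (s : maxNerve n m) : maxNerve n m := mkchain (max_sing_chain_ax s).

(** The homotopy from {max x} to [x] evaluated along [s]. *)
Definition prism_vertex n m (s : maxNerve n m) (p : 'I_m.+1 * bool) : sdT n :=
  if p.2 then sval s p.1 else sing (maxo (sval s p.1)).

Lemma maxo_prism_vertex n m (s : maxNerve n m) p : maxo (prism_vertex s p) = maxo (sval s p.1).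
Proof. by rewrite /prism_vertex; case: p.2; rewrite ?maxo_sing. Qed.

Lemma prism_chain_ax n m (s : maxNerve n m) k (p : cosnerve prismX m k) (i j : 'I_k.+1) : i <= j ->
  @cosR sd_max n (prism_vertex s (sval p i)) (prism_vertex s (sval p j)).
Proof.
move=> h; rewrite -[cosR _ _]/(is_true (maxo _ <= maxo _)) !maxo_prism_vertex.
by apply: (proj2_sig s); case: (proj2_sig p i j h).
Qed.
Definition prism_chain n m (s : maxNerve n m) k (p : cosnerve prismX m k) : maxNerve n k := mkchain (prism_chain_ax s p).

Lemma max_edge_ax n (x : sdT n) (i j : 'I_2) : i <= j ->
  @cosR sd_max n (if i == ord_max then x else sing (maxo x)) (if j == ord_max then x else sing (maxo x)).
Proof.
move=> _; rewrite -[cosR _ _]/(is_true (maxo _ <= maxo _)).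
by case: (i == _); case: (j == _); rewrite ?maxo_sing.
Qed.
Definition max_edge n (x : sdT n) : maxNerve n 1 := mkchain (max_edge_ax x).

Lemma max_edge_max n (x : sdT n) : maxo (sval (max_edge x) ord0) = maxo (sval (max_edge x) ord_max).
Proof. by rewrite /= maxo_sing. Qed.

Section ExtD.
Variables (n : nat) (L : forall m, maxNerve n m -> Prop) (hL : act_closed L) (phi : smap (sub hL) C).
Hypothesis L_max : forall m (s : maxNerve n m), L (max_sing_chain s).
Hypothesis L_prism_chain : forall m (s : maxNerve n m), L s -> forall k p, L (@prism_chain n m s k p).
Hypothesis L_equiv : forall m (s : maxNerve n m) i (h : L (max_edge (sval s i))), L s ->
  is_equiv (phi 1 (exist _ _ h)).

(* Homotopy extension along [sing (maxo x) -> x], starting from the map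
   [s |-> phi (max_sing_chain s)], which is defined on all of [maxNerve n]. *)
Lemma extend_from_prism_closed : exists psi : smap (maxNerve n) C, forall m s (h : L s), psi m s = phi m (exist _ s h).
Proof.
have ng m k (f : mono m k) (s : maxNerve n k) :
    phi m (exist _ _ (L_max (sact (maxNerve n) f s))) = sact C f (phi k (exist _ _ (L_max s))).
  by rewrite -snat; congr (phi m _); apply: sig_eq; apply: chain_eq.
pose g : smap (maxNerve n) C := @SMap (maxNerve n) C (fun m s => phi m (exist _ _ (L_max s))) ng.
have nH m (s : sub hL m) k l (f : mono k l) p :
    phi k (exist _ _ (L_prism_chain (proj2_sig s) (sact (cosnerve prismX m) f p))) =
    sact C f (phi l (exist _ _ (L_prism_chain (proj2_sig s) p))).
  by rewrite -snat; congr (phi k _); apply: sig_eq; apply: chain_eq.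
pose Hf m (s : sub hL m) : paths C m :=
  @SMap (cosnerve prismX m) C (fun k p => phi k (exist _ _ (L_prism_chain (proj2_sig s) p))) (nH m s).
have nHf m k (f : mono m k) (s : sub hL k) : Hf m (sact (sub hL) f s) = sact (paths C) f (Hf k s).
  by apply: smap_ext => l p /=; congr (phi l _); apply: sig_eq; apply: chain_eq.
pose H : smap (sub hL) (paths C) := @SMap (sub hL) (paths C) Hf nHf.
have inj m : injective (sub_incl hL m) by move=> a b /= e; apply: sig_eq.
case: (homotopy_extension hC hI (is_sset_maxNerve n) (i := sub_incl hL) inj (g := g) (H := H)).
- move=> m s; rewrite /endp /=; congr (phi m _); apply: sig_eq; exact: chain_eq.
- move=> m s v /=.
  have E : prism_chain (sval s) (vert v) = max_edge (sval (sval s) v).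
    by apply: chain_eq => i /=; rewrite /prism_vertex /=.
  have hE : L (max_edge (sval (sval s) v)) by rewrite -E; apply: L_prism_chain; apply: (proj2_sig s).
  have -> : exist _ _ (L_prism_chain (proj2_sig s) (vert v)) = exist _ _ hE :> sub hL 1 by apply: sig_eq.
  exact: L_equiv (proj2_sig s).
move=> f hf; exists f => m s h.
have := hf m (exist _ s h) => /= ->; rewrite /endp /=; congr (phi m _); apply: sig_eq.
exact: chain_eq.
Qed.
End ExtD.

Lemma in_faces_of_avoid N (J : 'I_N.+2 -> Prop) m (s : maxNerve N.+1 m) j : J j ->
  (forall i, j \notin sval (sval s i)) -> in_faces J s.
Proof.
move=> Jj h.
have nz i : [set c | delta j c \in sval (sval s i)] != set0.
  case/set0Pn: (proj2_sig (sval s i)) => a ha.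
  have : exists c, delta j c = a.
    have na : j != a by apply/eqP => e; have := h i; rewrite e ha.
    by case: (unlift_some na) => c ec _; exists c.
  by case=> c ec; apply/set0Pn; exists c; rewrite inE ec.
pose s' i : sdT N := exist (fun A : {set 'I_N.+1} => A != set0) _ (nz i).
have es i : sval s i = dimg (delta j) (s' i).
  apply: sd_eq => /=; apply/setP => a; apply/idP/imsetP => [ha|[c]]; last by rewrite inE => hc ->.
  have na : j != a by apply/eqP => e; have := h i; rewrite e ha.
  by case: (unlift_some na) => c ec _; exists c; rewrite ?inE // /= -ec.
have ax (a b : 'I_m.+1) : a <= b -> @cosR sd_max N (s' a) (s' b).
  case: sd_max_reedy => _ r2 _ _ ab; apply: (r2 _ j).
  by have := proj2_sig s a b ab; rewrite (es a) (es b).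
by exists j, (mkchain ax); split=> //; apply: chain_eq => i /=; apply: es.
Qed.

Lemma in_faces_avoid N (J : 'I_N.+2 -> Prop) m (s : maxNerve N.+1 m) : in_faces J s ->
  exists2 j, J j & forall i, j \notin sval (sval s i).
Proof.
case=> j [s' [Jj ->]]; exists j => // i /=; apply/imsetP => -[c _ e].
by have := neq_lift j c; rewrite -e eqxx.
Qed.

Lemma prism_chain_cosnmap m n (f : mono m n) l (s : maxNerve m l) k p :
  @prism_chain n l (@cosnmap sd_max _ _ f l s) k p = @cosnmap sd_max _ _ f k (prism_chain s p).
Proof.
apply: chain_eq => i /=; rewrite /prism_vertex /=; case: (sval p i).2 => //.
by rewrite maxo_dimg dimg_sing.
Qed.

Lemma max_edge_dimg m n (f : mono m n) x : max_edge (dimg f x) = @cosnmap sd_max _ _ f 1 (max_edge x).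
Proof.
by apply: chain_eq => i /=; case: (i == ord_max); rewrite // maxo_dimg dimg_sing.
Qed.

Lemma allsing_ax n (i j : 'I_n.+1) : i <= j -> @cosR sd_max n (sing i) (sing j).
Proof. by rewrite -[cosR _ _]/(is_true (maxo _ <= maxo _)) !maxo_sing. Qed.
Definition allsing n : maxNerve n n := mkchain (@allsing_ax n).

Lemma sing_inj n : injective (@sing n).
Proof. by move=> a b /(congr1 (@maxo n)); rewrite !maxo_sing. Qed.

(** Filling the inner horn that the singletons span in [C] adds the simplex of all singletons to the
    given faces. The result is stable under the homotopy {max x} -> x, so [extend_from_prism_closed]
    gives the rest. *)
Lemma maxMaps_innerfill : innerfill maxMaps.
Proof.
move=> N k hk t ct.
have [phi hphi] := glue_faces sd_max_reedy ct.
pose sg := allsing N.+1.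
have faceE j : sact (maxNerve N.+1) (delta j) sg = @cosnmap sd_max _ _ (delta j) N (allsing N).
  by apply: chain_eq => i; exact: (esym (dimg_sing (delta j) i)).
have [| | | | |psi hpsi] := @attach (maxNerve N.+1) C (is_sset_maxNerve _) hC _ _ phi N k (fun s => s = sg).
- move=> _ -> m f g e; apply: mono_eq => i; have /= := congr1 (fun u => sval u i) e.
  by move/sing_inj => ->.
- by move=> _ j -> hj; rewrite faceE; exists j, (allsing N).
- move=> _ -> /in_faces_avoid [j hj h]; case: (@unlift_some _ k j).
    by rewrite eq_sym.
  by move=> c ec _; have /negP := h c; apply; rewrite /= inE ec.
- by move=> s s' h -> ->.
- by move=> _ -> u cu hu; apply: hI.
set att := attached _ _ in psi hpsi.
have [||m s i h hs|chi hchi] := @extend_from_prism_closed N.+1 _ _ psi.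
- move=> m s; right; exists sg.
  by exists (Mono (fun i => maxo (sval s i)) (proj2_sig s)); split=> //; apply: chain_eq.
- move=> m s [[j [s' [Jj ->]]]|[_ [f [-> ->]]]] l p.
    by left; rewrite prism_chain_cosnmap; exists j, (prism_chain s' p).
  right; exists sg, (mono_comp f (fstm p)); split=> //; apply: chain_eq => i /=.
  by rewrite /prism_vertex /=; case: (sval p i).2; rewrite ?maxo_sing.
- case: hs => [[j [s' [Jj e]]]|[_ [f [-> e]]]]; subst s.
    have h' : in_faces (fun j => j != k) (max_edge (sval (@cosnmap sd_max _ _ (delta j) m s') i)).
      by exists j, (max_edge (sval s' i)); split=> //; rewrite -max_edge_dimg.
    rewrite (hpsi _ _ h'); move: h'; rewrite /= max_edge_dimg => h'.
    by rewrite hphi //; apply: maxMaps_equiv; apply: max_edge_max.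
  (* At a singleton the edge from {max x} to [x] is degenerate, so its image is an identity. *)
  suff [z ez] : exists z, max_edge (sval (sact (maxNerve N.+1) f sg) i) = idedge z :> maxNerve N.+1 1.
    have hz : att 0 z.
      have -> : z = sact (maxNerve N.+1) (cst 0 ord0) (max_edge (sval (sact (maxNerve N.+1) f sg) i)).
        by rewrite ez -[_ (idedge z)]/(src (idedge z)) src_idedge //; apply: is_sset_maxNerve.
      exact: (attached_closed (is_sset_maxNerve _) (@in_faces_closed sd_max N (fun j => j != k)) (cst 0 ord0) h).
    have -> : psi 1 (exist _ _ h) = idedge (psi 0 (exist _ z hz)).
      by rewrite -idedge_map; congr (psi 1 _); apply: sig_eq.
    exact: is_equiv_idedge.
  exists (sact (maxNerve N.+1) (cst 0 i) (sact (maxNerve N.+1) f sg)); apply: chain_eq => a /=.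
  by case: ifP; rewrite ?maxo_sing.
exists chi => j hj; apply: smap_ext => m s.
rewrite -[LHS]/(chi m (@cosnmap sd_max _ _ (delta j) m s)).
have hU : in_faces (fun j => j != k) (@cosnmap sd_max _ _ (delta j) m s) by exists j, s.
by rewrite (hchi _ _ (or_introl hU)) (hpsi _ _ hU) hphi.
Qed.
End SetMaps.

(** * Flags *)

Lemma card_ord_lt n i : i <= n -> #|[set j : 'I_n | j < i]| = i.
Proof.
move=> hi; have wi : injective (widen_ord hi) by move=> a b /(congr1 val) /= /val_inj.
rewrite -[RHS](card_ord i) -(card_imset predT wi).
apply: eq_card => j; rewrite inE; apply/idP/imsetP => [h|[a _ ->]]; last exact: (ltn_ord a).
by exists (Ordinal h) => //; apply: val_inj.
Qed.

Lemma downset_card n (S : {set 'I_n}) : (forall i j : 'I_n, i <= j -> j \in S -> i \in S) ->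
  forall i : 'I_n, (i \in S) = (i < #|S|).
Proof.
move=> h i; apply/idP/idP => hi.
  rewrite -[X in X <= _](@card_ord_lt n i.+1) //; apply: subset_leq_card; apply/subsetP => j.
  by rewrite inE ltnS => ji; apply: h hi.
apply: contraLR hi => hi; rewrite -leqNgt -[X in _ <= X](@card_ord_lt n i); last exact: ltnW.
apply: subset_leq_card; apply/subsetP => j hj; rewrite inE ltnNge; apply: contra hi => ij.
exact: h hj.
Qed.

Section Flags.
Variable N : nat.
Notation D := (maxNerve N.+1).

Definition single (x : sdT N.+1) := #|sval x| == 1.

(** The relation is not transitive, as {0}, {1}, {1,2} shows. So [flag] imposes it on all pairs,
    which forces every non-singleton to contain all the singletons. *)
Definition flag_rel (x y : sdT N.+1) : bool :=
  (sval x \subset sval y) || [&& single x, single y & maxo x <= maxo y].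

Lemma single_sing x : single x -> x = sing (maxo x).
Proof.
move=> /cards1P [a ea]; apply: sd_eq => /=; have := maxo_in x.
by rewrite ea inE => /eqP ->.
Qed.

Lemma sing_single a : single (sing a).
Proof. by rewrite /single /= cards1. Qed.

Lemma sub_single (x y : sdT N.+1) : sval x \subset sval y -> single y -> x = y.
Proof.
move=> h /cards1P [a ea]; apply: sd_eq; move: h; rewrite ea subset1.
by rewrite (negbTE (proj2_sig x)) orbF => /eqP.
Qed.

Lemma flag_rel_sub x y : flag_rel x y -> ~~ single y -> sval x \subset sval y.
Proof. by case/orP => // /and3P [_ -> _]. Qed.

Lemma flag_rel_nonsingle x y : flag_rel x y -> ~~ single x -> sval x \subset sval y /\ ~~ single y.
Proof.
case/orP => [h ns|/and3P [-> //]]; split=> //; apply/negP => sy.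
by have e := sub_single h sy; rewrite e sy in ns.
Qed.

Lemma flag_rel_antisym x y : flag_rel x y -> flag_rel y x -> x = y.
Proof.
case/orP => [h1|/and3P [sx sy h1]]; case/orP => [h2|/and3P [sx' sy' h2]].
- by apply: sd_eq; apply/eqP; rewrite eqEsubset h1 h2.
- exact: sub_single.
- by symmetry; apply: sub_single.
- by rewrite (single_sing sx) (single_sing sy); congr sing; apply: val_inj; apply/eqP; rewrite eqn_leq; apply/andP.
Qed.

Lemma flag_rel_max x y : flag_rel x y -> maxo x <= maxo y.
Proof. by case/orP => [/maxS_sub|/and3P []]. Qed.

Definition flag m (s : D m) := forall i j : 'I_m.+1, i <= j -> flag_rel (sval s i) (sval s j).
Definition single_union m (s : D m) : {set 'I_N.+2} := \bigcup_(i | single (sval s i)) sval (sval s i).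
Definition vertex_inj m (s : D m) := injective (sval s).

Lemma in_single_unionP m (s : D m) a : (a \in single_union s) <-> exists i, sval s i = sing a.
Proof.
split=> [/bigcupP [i si]|[i ei]].
  by rewrite (single_sing si) inE => /eqP ->; exists i; apply: single_sing.
by apply/bigcupP; exists i; rewrite ei ?sing_single // inE.
Qed.

Lemma flag_act m p (f : mono p m) (s : D m) : flag s -> flag (sact D f s).
Proof. by move=> h i j ij /=; apply: h; apply: monoP. Qed.

Lemma single_union_act m p (f : mono p m) (s : D m) : single_union (sact D f s) \subset single_union s.
Proof. by apply/subsetP => a /in_single_unionP [i /= e]; apply/in_single_unionP; exists (f i). Qed.

Lemma single_union_keep m p (f : mono p m) (s : D m) :
  (forall i, single (sval s i) -> exists a, f a = i) -> single_union (sact D f s) = single_union s.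
Proof.
move=> h; apply/eqP; rewrite eqEsubset single_union_act; apply/subsetP => a /in_single_unionP [i e].
case: (h i) => [|b eb]; first by rewrite e sing_single.
by apply/in_single_unionP; exists b; rewrite /= eb.
Qed.

Lemma single_sub_union m (s : D m) i : single (sval s i) -> sval (sval s i) \subset single_union s.
Proof. by move=> h; apply: (bigcup_sup i). Qed.

Lemma single_union_sub_nonsingle m (s : D m) i : flag s -> ~~ single (sval s i) -> single_union s \subset sval (sval s i).
Proof.
move=> fs ns; apply/bigcupsP => j sj; case: (leqP j i) => ji.
  exact: (flag_rel_sub (fs _ _ ji)).
by case: (flag_rel_nonsingle (fs _ _ (ltnW ji)) ns) => _; rewrite sj.
Qed.

(** Singletons precede non-singletons in a flag, and without repetitions taking maxima is a
    bijection from them to [single_union s], whose cardinality is thus the position where they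
    end. *)
Lemma single_lt m (s : D m) : flag s -> vertex_inj s -> forall i, single (sval s i) = (i < #|single_union s|).
Proof.
move=> fs cs i; pose S := [set i | single (sval s i)].
have -> : #|single_union s| = #|S|.
  rewrite -(@card_in_imset _ _ (fun i => maxo (sval s i)) S).
    apply: eq_card => a; apply/idP/imsetP => [/in_single_unionP [j ej]|[j]].
      by exists j; rewrite ?inE ej ?sing_single ?maxo_sing.
    by rewrite inE => sj ->; apply/in_single_unionP; exists j; apply: single_sing.
  move=> a b; rewrite !inE => sa sb e; apply: cs.
  by rewrite (single_sing sa) (single_sing sb) e.
rewrite -downset_card ?inE // => a b ab; rewrite !inE; apply: contraLR => ns.
by case: (flag_rel_nonsingle (fs _ _ ab) ns).
Qed.

Notation Fc := (in_faces (fun _ : 'I_N.+2 => True)).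

Lemma in_facesP_avoid m (s : D m) : Fc s <-> exists j, forall i, j \notin sval (sval s i).
Proof.
split=> [/in_faces_avoid [j _ h]|[j h]]; first by exists j.
exact: in_faces_of_avoid h.
Qed.

(** If the vertices [a < b] coincide, antisymmetry makes vertex [a + 1] equal to them; dropping it
    exhibits the flag as a degeneracy of its own face. *)
Lemma dedupe m (s : D m) : flag s -> exists m0 (u : mono m0 m) (e : mono m m0),
  s = sact D e (sact D u s) /\ vertex_inj (sact D u s).
Proof.
elim: m s => [|m IH] s fs.
  exists 0, (mono_id 0), (mono_id 0); split; first exact: chain_eq.
  by move=> a b _; rewrite (ord1 a) (ord1 b).
case: (classic (vertex_inj s)) => [cs|ncs].
  by exists m.+1, (mono_id _), (mono_id _); split; first exact: chain_eq.
have [a [b [ab e]]] : exists a b : 'I_m.+2, a < b /\ sval s a = sval s b.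
  case/not_all_ex_not: ncs => a /not_all_ex_not [b nab].
  have [e ne] : sval s a = sval s b /\ a <> b by split; [apply: NNPP => h; apply: nab|move=> h; apply: nab].
  case: (ltngtP a b) => h; [by exists a, b|by exists b, a|by case: ne; apply: val_inj].
have lb := ltn_ord b.
have la : a.+1 < m.+2 by lia.
have ea : sval s (Ordinal la) = sval s a.
  by apply: flag_rel_antisym; [rewrite e|]; apply: fs => /=; lia.
have lg (i : 'I_m.+2) : i - (a < i) < m.+1 by have := ltn_ord i; lia.
have mg (i j : 'I_m.+2) : i <= j -> Ordinal (lg i) <= Ordinal (lg j) by move=> ij /=; lia.
pose dg : mono m.+1 m := Mono _ mg.
have es : s = sact D dg (sact D (delta (Ordinal la)) s).
  apply: chain_eq => i /=.
  have [ei|ni] : i = Ordinal la \/ (i : nat) <> a.+1.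
    by case: (eqVneq i (Ordinal la)) => [|/eqP h]; [left|right=> h'; apply: h; apply: val_inj].
    rewrite ei ea; congr (sval s _); apply: val_inj; rewrite /= /bump; lia.
  by congr (sval s _); apply: val_inj; rewrite /= /bump; lia.
case: (IH (sact D (delta (Ordinal la)) s)) => [|m0 [u [e' [h1 h2]]]]; first exact: flag_act.
have hD := is_sset_maxNerve N.+1.
exists m0, (mono_comp (delta (Ordinal la)) u), (mono_comp e' dg).
rewrite -(sact_comp hD u) ; split=> //.
by rewrite -sact_comp // -h1.
Qed.

(** Filtration by the number of distinct singletons: up to 1 the flags are the subset chains, and
    [N + 2] allows all flags. *)
Definition flag_stage q m (s : D m) := Fc s \/ (flag s /\ #|single_union s| <= q).

Lemma Fc_closed : act_closed (@in_faces sd_max N (fun _ => True)).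
Proof. exact: in_faces_closed. Qed.

Lemma flag_stage_closed q : act_closed (flag_stage q).
Proof.
move=> m n f s [h|[h1 h2]]; first by left; apply: Fc_closed.
right; split; first exact: flag_act.
exact: leq_trans (subset_leq_card (single_union_act f s)) h2.
Qed.

(* The simplices (m_0 < ... < m_q; M; x_1 < ... < x_(d+1)) with M = {m_0,...,m_q};
   each is attached along the horn missing the face opposite to M. *)
Definition mixed_simplex q d (s : D (q + d).+2) :=
  [/\ flag s, vertex_inj s, #|single_union s| = q.+1, sval (sval s (inord q.+1)) = single_union s & ~ Fc s].

Definition mixed_stage q d m (s : D m) := flag_stage q s \/
  exists d' (sg : D (q + d').+2) (f : mono m (q + d').+2), [/\ d' < d, mixed_simplex sg & s = sact D f sg].

Lemma mixed_stage_closed q d : act_closed (mixed_stage q d).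
Proof.
move=> m n f s [h|[d' [sg [g [h1 h2 h3]]]]]; first by left; apply: flag_stage_closed.
right; exists d', sg, (mono_comp g f); split=> //.
by rewrite h3 sact_comp //; apply: is_sset_maxNerve.
Qed.

Section Step.
Variables (q : nat) (hq : 0 < q <= N).
Let hD := is_sset_maxNerve N.+1.

Section Facts.
Variables (d : nat) (sg : D (q + d).+2) (hs : mixed_simplex sg).
Let k : 'I_(q + d).+3 := inord q.+1.

Lemma missing_indexE : k = q.+1 :> nat.
Proof. by rewrite inordK //; lia. Qed.

Lemma mixed_simplex_single i : single (sval sg i) = (i < q.+1).
Proof. by case: hs => h1 h2 h3 _ _; rewrite single_lt // h3. Qed.

Lemma single_union_face (j : 'I_(q + d).+3) : q < j -> single_union (sact D (delta j) sg) = single_union sg.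
Proof.
move=> hj; apply: single_union_keep => i; rewrite mixed_simplex_single => hi.
have ne : j != i by rewrite -val_eqE /=; lia.
by case: (unlift_some ne) => c ec _; exists c.
Qed.

Lemma mixed_simplex_small_face (j : 'I_(q + d).+3) : j <= q -> flag_stage q (sact D (delta j) sg).
Proof.
case: hs => h1 h2 h3 h4 h5 hj; right; split; first exact: flag_act.
rewrite -ltnS -h3; apply: proper_card; apply/properP; split; first exact: single_union_act.
have sj : single (sval sg j) by rewrite mixed_simplex_single ltnS.
exists (maxo (sval sg j)); first by apply/in_single_unionP; exists j; apply: single_sing.
apply/negP => /in_single_unionP [i /= e]; have /h2 e' : sval sg (lift j i) = sval sg j by rewrite e -single_sing.
by have := neq_lift j i; rewrite e' eqxx.
Qed.

Lemma mixed_simplex_union_proper : exists a, a \notin single_union sg.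
Proof.
case: hs => h1 h2 h3 h4 h5; apply: NNPP => h.
have : #|[set: 'I_N.+2]| <= #|single_union sg|.
  apply: subset_leq_card; apply/subsetP => a _; apply/negP => ha; apply: h.
  by exists a; apply/negP.
by rewrite cardsT card_ord h3; lia.
Qed.

(** Dropping a singleton shrinks [single_union]. Dropping a set after M leaves a mixed simplex with
    [d] smaller by one unless it falls into the faces; for [d = 0] it does, since what remains lies
    in M, a proper subset. *)
Lemma mixed_simplex_face (j : 'I_(q + d).+3) : j != k -> mixed_stage q d (sact D (delta j) sg).
Proof.
move=> hjk; case: (leqP j q) => hj; first by left; apply: mixed_simplex_small_face.
have hj' : q.+1 < j by move: hjk; rewrite -val_eqE /= missing_indexE; lia.
case: (classic (Fc (sact D (delta j) sg))) => [h|nF]; first by left; left.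
case: (posnP d) => [d0|dp].
  exfalso; apply: nF; apply/in_facesP_avoid; case: mixed_simplex_union_proper => a ha; exists a => i /=.
  apply: contra ha; apply/subsetP.
  case: (leqP (lift j i) q) => hi; first by apply: single_sub_union; rewrite mixed_simplex_single ltnS.
  have -> : lift j i = k; last by case: hs => _ _ _ -> _.
  apply: val_inj; rewrite /= missing_indexE; move: hi; rewrite /= /bump; have := ltn_ord i; have := ltn_ord j; lia.
right; have ed : (q + d).+1 = (q + d.-1).+2 by lia.
case: hs => h1 h2 h3 h4 h5.
exists d.-1, (sact D (mono_comp (delta j) (castm (esym ed))) sg), (castm ed); split; first lia.
  have E : single_union (sact D (mono_comp (delta j) (castm (esym ed))) sg) = single_union sg.
    rewrite -sact_comp // single_union_keep ?single_union_face //.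
    move=> i _; exists (castm ed i); exact: val_inj.
  split.
  - exact: flag_act.
  - move=> a b /= /h2 /lift_inj /(congr1 val) /= /val_inj //.
  - by rewrite E.
  - rewrite E -h4; congr (sval (sval sg _)); apply: val_inj; rewrite /= !inordK; try lia.
    by rewrite /bump; lia.
  - move=> /(Fc_closed (castm ed)); rewrite sact_comp // => h; apply: nF.
    by move: h; congr (Fc _); apply: chain_eq => i /=; congr (sval sg _); apply: val_inj.
by rewrite sact_comp //; apply: chain_eq => i /=; congr (sval sg _); apply: val_inj.
Qed.

(* The missing face determines M, which is not one of its vertices. *)
Lemma mixed_simplex_missing d' (sg' : D (q + d').+2) (f : mono (q + d).+1 (q + d').+2) : mixed_simplex sg' ->
  sact D (delta k) sg = sact D f sg' -> 
  [/\ single_union sg' = single_union sg, injective f & forall i, (f i : nat) <> q.+1].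
Proof.
case: hs => h1 h2 h3 h4 h5 [g1 g2 g3 g4 g5] e.
have E : single_union (sact D (delta k) sg) = single_union sg by apply: single_union_face; rewrite missing_indexE.
have EM : single_union sg' = single_union sg.
  apply/esym/eqP; rewrite eqEcard h3 g3 leqnn andbT -E e; exact: single_union_act.
split=> //.
  move=> a b eab; have /(congr1 (fun u => sval u a)) /= ea := e.
  have /(congr1 (fun u => sval u b)) /= eb := e.
  by apply: (@lift_inj _ k); apply: h2; rewrite ea eb eab.
move=> i ei; have /(congr1 (fun u => sval u i)) /= ea := e.
have ef : f i = inord q.+1 by apply: val_inj; rewrite /= ei inordK //; lia.
have /h2 : sval sg (lift k i) = sval sg k.
  by apply: sd_eq; rewrite ea ef g4 h4.
by move=> e'; have := neq_lift k i; rewrite e' eqxx.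
Qed.

(** If an element were avoided by the missing face, it would be avoided by M, the union of its
    singletons, and so by all of [sg]. The number of singletons is still [q + 1]. A mixed simplex
    with smaller [d] has too few vertices besides M for the injection of [mixed_simplex_missing]. *)
Lemma mixed_simplex_new : ~ mixed_stage q d (sact D (delta k) sg).
Proof.
have E : single_union (sact D (delta k) sg) = single_union sg by apply: single_union_face; rewrite missing_indexE.
case: (hs) => h1 h2 h3 h4 h5.
case=> [[/in_facesP_avoid [j hj]|[_]]|[d' [sg' [f [hd hs' e]]]]].
- apply: h5; apply/in_facesP_avoid; exists j => i; case: (unliftP k i) => [c ->|->]; first exact: (hj c).
  rewrite h4 -E; apply/negP => /in_single_unionP [c ec]; have := hj c; rewrite ec inE eqxx //.
- by rewrite E h3 ltnn.
- have [_ fi fk] := mixed_simplex_missing hs' e.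
  have : #|'I_(q + d).+2| <= #|[set j : 'I_(q + d').+3 | (j : nat) != q.+1]|.
    rewrite -(card_imset predT fi); apply: subset_leq_card; apply/subsetP => j /imsetP [i _ ->].
    by rewrite inE; apply/eqP; apply: fk.
  have -> : [set j : 'I_(q + d').+3 | (j : nat) != q.+1] = [set~ inord q.+1].
    apply/setP => j; rewrite !inE -val_eqE /= inordK //; lia.
  by rewrite cardsC1 !card_ord; lia.
Qed.
End Facts.

(** The map [h] is injective and avoids position [q + 1], hence is the same face map; the vertex M
    is recovered as the union of the singletons. *)
Lemma mixed_simplex_uniq d (sg sg' : D (q + d).+2) (h : mono (q + d).+1 (q + d).+2) : mixed_simplex sg -> mixed_simplex sg' ->
  sact D (delta (inord q.+1)) sg = sact D h sg' -> sg = sg'.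
Proof.
move=> hs hs' e; have [EM hi hk] := mixed_simplex_missing hs hs' e.
case: (mono_inj_delta hi) => l el.
have lk : l = inord q.+1.
  apply: NNPP => hl; have ne : l != inord q.+1 by apply/eqP.
  case: (unlift_some ne) => c ec _; apply: (hk c); rewrite el -[delta l c]/(lift l c) -ec inordK //; lia.
apply: chain_eq => i; case: (unliftP (inord q.+1) i) => [c ->|->].
  by have /(congr1 (fun u => sval u c)) /= := e; rewrite el lk.
by apply: sd_eq; case: hs => _ _ _ -> _; case: hs' => _ _ _ -> _.
Qed.

Variables (C : sset) (hC : is_sset C) (hI : innerfill C).

Lemma mixed_stage_step d (phi : smap (sub (mixed_stage_closed (q := q) (d := d))) C) :
  exists psi : smap (sub (mixed_stage_closed (q := q) (d := d.+1))) C,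
    forall m s (h : mixed_stage q d s) (h' : mixed_stage q d.+1 s), psi m (exist _ s h') = phi m (exist _ s h).
Proof.
have [| | | | |psi hpsi] := @attach D C hD hC _ (mixed_stage_closed (q := q) (d := d)) phi (q + d).+1 (inord q.+1) (@mixed_simplex q d).
- move=> sg [h1 h2 _ _ _] m f g e; apply: mono_eq => i; have /(congr1 (fun u => sval u i)) /= := e.
  by move=> /h2 ->.
- by move=> sg j hs hj; apply: mixed_simplex_face.
- by move=> sg hs; apply: mixed_simplex_new.
- by move=> sg sg' h hs hs'; apply: mixed_simplex_uniq.
(* M stands at position [q + 1], after the singletons and before at least one more vertex, so the
   horn is inner. *)
- by move=> sg hs t ct _; apply: hI => //; rewrite inordK; lia.
have LK m (s : D m) : mixed_stage q d.+1 s -> attached (mixed_stage q d) (@mixed_simplex q d) s.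
  case=> [h|[d' [sg [f [h1 h2 h3]]]]]; first by left; left.
  have [e|lt] : d' = d \/ d' < d by lia.
    by subst d'; right; exists sg, f.
  by left; right; exists d', sg, f.
have [psi' hpsi'] := @smap_sub_eq D C _ _ _ (mixed_stage_closed (q := q) (d := d.+1)) psi LK.
exists psi' => m s h h'; rewrite (hpsi' _ _ (or_introl h)); exact: hpsi.
Qed.
End Step.

(** Otherwise all vertices lie in M, which omits an element because [q <= N], and [s] lies in a
    face. *)
Lemma exists_not_sub_union q m (s : D m) : q <= N -> #|single_union s| = q.+1 -> ~ Fc s ->
  exists i, ~~ (sval (sval s i) \subset single_union s).
Proof.
move=> hq h3 nF; apply: NNPP => h; apply: nF.
have [a ha] : exists a, a \notin single_union s.
  apply: NNPP => h'.
  have : #|[set: 'I_N.+2]| <= #|single_union s|.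
    apply: subset_leq_card; apply/subsetP => a _; apply/negP => ha; apply: h'.
    by exists a; apply/negP.
  by rewrite cardsT card_ord h3; lia.
apply/in_facesP_avoid; exists a => i; apply: contra ha; apply/subsetP; apply/negP => hi; apply: h.
by exists i; apply/negP.
Qed.

(** After removing repetitions, either M is already a vertex, necessarily right after the
    singletons, or it can be inserted there; then the flag is the missing face of a mixed
    simplex. *)
Lemma flag_mixed_simplex q m (s : D m) : 0 < q <= N -> flag s -> #|single_union s| = q.+1 -> ~ Fc s ->
  exists d (sg : D (q + d).+2) (f : mono m (q + d).+2), mixed_simplex sg /\ s = sact D f sg.
Proof.
move=> hq fs cM nF; have hD := is_sset_maxNerve N.+1.
case: (dedupe fs) => m0 [u [e [es ci]]].
have fs0 := flag_act u fs.
have M0 : single_union (sact D u s) = single_union s.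
  apply/eqP; rewrite eqEsubset single_union_act /= {1}es; exact: single_union_act.
have nF0 : ~ Fc (sact D u s) by move=> h; apply: nF; rewrite es; apply: Fc_closed.
rewrite -M0 in cM; move: (sact D u s) es ci fs0 cM nF0 => s0 es ci fs0 cM nF0.
clear M0 nF fs u; subst s.
have sl i : single (sval s0 i) = (i <= q) by rewrite single_lt // cM.
have hqN : q <= N by lia.
(* This vertex supplies the set that must follow M in a mixed simplex. *)
have [b0 hb0] := exists_not_sub_union hqN cM nF0.
have lb0 : q < b0.
  rewrite ltnNge; apply/negP; rewrite -sl => /single_sub_union h; by rewrite h in hb0.
have lm := ltn_ord b0.
case: (classic (exists a, sval (sval s0 a) = single_union s0)) => [[a ea]|nM].
  have la : q < a.
    (* M has at least two elements because [0 < q], so it is not a singleton. *)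
    rewrite ltnNge; apply/negP; rewrite -sl /single ea cM; lia.
  have na : a <> b0 by move=> e'; move: hb0; rewrite -e' ea subxx.
  have na' : (a : nat) <> b0 by move=> /val_inj.
  have la' := ltn_ord a.
  have [d ed] : exists d, m0 = (q + d).+2 by exists (m0 - q).-2; lia.
  subst m0; exists d, s0, e; split=> //; split=> //.
  have lk : (inord q.+1 : 'I_(q + d).+3) = q.+1 :> nat by rewrite inordK //; lia.
  have ns : ~~ single (sval s0 (inord q.+1)) by rewrite sl lk; lia.
  apply/eqP; rewrite eqEsubset single_union_sub_nonsingle // andbT -ea.
  have ka : (inord q.+1 : 'I_(q + d).+3) <= a by rewrite lk.
  by case: (flag_rel_nonsingle (fs0 _ _ ka) ns).
have [d ed] : exists d, m0 = (q + d).+1 by exists (m0 - q).-1; lia.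
subst m0; pose k : 'I_(q + d).+3 := inord q.+1.
have lk : k = q.+1 :> nat by rewrite inordK //; lia.
have nz : single_union s0 != set0 by rewrite -card_gt0 cM.
pose MM : sdT N.+1 := exist (fun A : {set 'I_N.+2} => A != set0) _ nz.
pose sf i := if unlift k i is Some c then sval s0 c else MM.
have sfl c : sf (lift k c) = sval s0 c by rewrite /sf liftK.
have sfk : sf k = MM by rewrite /sf unlift_none.
have R (i j : 'I_(q + d).+3) : i <= j -> flag_rel (sf i) (sf j).
  case: (unliftP k i) => [a ->|->]; case: (unliftP k j) => [b ->|->]; rewrite ?sfl ?sfk.
  - by rewrite /= /bump => ab; apply: fs0; move: ab; lia.
  - rewrite /= lk /bump => ab; apply/orP; left; apply: single_sub_union.
    by rewrite sl; move: ab; lia.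
  - rewrite /= lk /bump => ab; apply/orP; left; apply: single_union_sub_nonsingle => //.
    by rewrite sl; move: ab; lia.
  - by move=> _; apply/orP; left.
pose sg : D (q + d).+2 := @mkchain _ (@cosR sd_max N.+1) _ sf (fun i j ij => flag_rel_max (R i j ij)).
have es0 : s0 = sact D (delta k) sg by apply: chain_eq => i; rewrite -[RHS]/(sf (lift k i)) sfl.
have nMM : ~~ single MM by rewrite /single /= cM; lia.
have EM : single_union sg = single_union s0.
  rewrite es0; symmetry; apply: single_union_keep => i; case: (unliftP k i) => [c ->|->]; first by exists c.
  by rewrite -[sval sg k]/(sf k) sfk (negbTE nMM).
exists d, sg, (mono_comp (delta k) e); split; last by rewrite es0 -sact_comp.
split=> //.
- move=> i j; rewrite -[sval sg i]/(sf i) -[sval sg j]/(sf j).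
  case: (unliftP k i) => [a ->|->]; case: (unliftP k j) => [b ->|->]; rewrite ?sfl ?sfk //.
  + by move=> /ci ->.
  + by move=> e'; case: nM; exists a; rewrite e'.
  + by move=> e'; case: nM; exists b; rewrite -e'.
- by rewrite EM.
- by rewrite EM -[sval sg _]/(sf k) sfk.
- by move=> h; apply: nF0; rewrite es0; apply: Fc_closed.
Qed.

Section Stages.
Variables (C : sset) (hC : is_sset C) (hI : innerfill C).

Lemma flag_stage_step q (phi : smap (sub (flag_stage_closed (q := q))) C) : 0 < q <= N ->
  exists psi : smap (sub (flag_stage_closed (q := q.+1))) C,
    forall m s (h : flag_stage q s) (h' : flag_stage q.+1 s), psi m (exist _ s h') = phi m (exist _ s h).
Proof.
move=> hq.
have steps d : exists psi : smap (sub (mixed_stage_closed (q := q) (d := d))) C,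
    forall m s (h : flag_stage q s) (h' : mixed_stage q d s), psi m (exist _ s h') = phi m (exist _ s h).
  elim: d => [|d [psi hpsi]].
    apply: smap_sub_eq => m s [//|[d' [sg [f [//]]]]].
  have [psi' hpsi'] := mixed_stage_step hq hC hI psi.
  exists psi' => m s h h'; rewrite (hpsi' _ _ (or_introl h)); exact: hpsi.
(* The vertices of a mixed simplex are distinct subsets, so the number of subsets bounds [d]. *)
have [psi hpsi] := steps #|{set 'I_N.+2}|.
have LK m (s : D m) : flag_stage q.+1 s -> mixed_stage q #|{set 'I_N.+2}| s.
  case=> [h|[fs cM]]; first by left; left.
  case: (classic (Fc s)) => [h|nF]; first by left; left.
  case: (leqP #|single_union s| q) => hM; first by left; right.
  have {}cM : #|single_union s| = q.+1 by lia.
  case: (flag_mixed_simplex hq fs cM nF) => d [sg [f [hs e]]]; right; exists d, sg, f; split=> //.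
  case: hs => _ ci _ _ _.
  have : #|'I_(q + d).+3| <= #|{set 'I_N.+2}|.
    by apply: (leq_card (fun i => sval (sval sg i))) => i j /sd_eq /ci.
  by rewrite card_ord; lia.
have [psi' hpsi'] := @smap_sub_eq D C _ _ _ (flag_stage_closed (q := q.+1)) psi LK.
exists psi' => m s h h'; rewrite (hpsi' _ _ (or_introl h)); exact: hpsi.
Qed.

Lemma full_ax : [set: 'I_N.+2] != set0.
Proof. by apply/set0Pn; exists ord0. Qed.
Definition full : sdT N.+1 := exist (fun A : {set 'I_N.+2} => A != set0) _ full_ax.

Lemma maxo_full : maxo full = ord_max.
Proof.
apply: val_inj; apply/eqP; rewrite eqn_leq; apply/andP; split; first by have := ltn_ord (maxo full).
by apply: (@maxS_ub _ _ ord_max); rewrite inE.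
Qed.

(** When the singletons exhaust [N+1], M is the whole set and must be the last vertex. The missing
    face is opposite to it, so the horn is outer; its last edge, from {N+1} to the whole set, is
    [max_edge full]. *)
Lemma flag_stage_last (phi : smap (sub (flag_stage_closed (q := N.+1))) C) :
  (forall h : flag_stage N.+1 (max_edge full), is_equiv (phi 1 (exist _ _ h))) ->
  exists psi : smap (sub (flag_stage_closed (q := N.+2))) C,
    forall m s (h : flag_stage N.+1 s) (h' : flag_stage N.+2 s), psi m (exist _ s h') = phi m (exist _ s h).
Proof.
move=> hE; have hD := is_sset_maxNerve N.+1.
pose sf (i : 'I_N.+3) := if unlift ord_max i is Some c then sing c else full.
have sfl c : sf (lift ord_max c) = sing c by rewrite /sf liftK.
have sfk : sf ord_max = full by rewrite /sf unlift_none.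
have nfull : ~~ single full by rewrite /single /= cardsT card_ord.
have R (i j : 'I_N.+3) : i <= j -> flag_rel (sf i) (sf j).
  case: (unliftP ord_max j) => [b ->|->]; last by move=> _; rewrite sfk; apply/orP; left; exact: subsetT.
  case: (unliftP ord_max i) => [a ->|->]; rewrite ?sfl.
    rewrite /= /bump => ab; apply/orP; right; rewrite !sing_single !maxo_sing /=.
    by move: ab; have := ltn_ord a; have := ltn_ord b; lia.
  by case: b => b hb; rewrite /= /bump => ab; exfalso; lia.
pose sg : D N.+2 := @mkchain _ (@cosR sd_max N.+1) _ sf (fun i j ij => flag_rel_max (R i j ij)).
have fsg : flag sg by move=> i j; apply: R.
have isg : vertex_inj sg.
  move=> i j; rewrite -[sval sg i]/(sf i) -[sval sg j]/(sf j).
  case: (unliftP ord_max i) => [a ->|->]; case: (unliftP ord_max j) => [b ->|->]; rewrite ?sfl ?sfk //.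
  + by move=> /sing_inj ->.
  + by move=> e'; move: nfull; rewrite -e' sing_single.
  + by move=> e'; move: nfull; rewrite e' sing_single.
have fE j : j != ord_max -> flag_stage N.+1 (sact D (delta j) sg).
  move=> hj; right; split; first exact: flag_act.
  have [c ec] : exists c, j = lift ord_max c.
    by case: (unliftP ord_max j) hj => [c ->|->]; [exists c|rewrite eqxx].
  have : #|single_union (sact D (delta j) sg)| <= #|[set~ c]|; last by rewrite cardsC1 card_ord.
  apply: subset_leq_card; apply/subsetP => a /in_single_unionP [i]; rewrite !inE -[sval _ i]/(sf (lift j i)) => ei.
  apply/eqP => ea; have /isg e' : sval sg (lift j i) = sval sg j.
    by rewrite -[LHS]/(sf _) -[RHS]/(sf _) ei ec sfl ea.
  by have := neq_lift j i; rewrite e' eqxx.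
have MT : single_union (sact D (delta ord_max) sg) = setT.
  apply/setP => a; rewrite inE; apply/in_single_unionP; exists a; rewrite -[LHS]/(sf (lift ord_max a)); exact: sfl.
have [| | | | |psi hpsi] := @attach D C hD hC _ (flag_stage_closed (q := N.+1)) phi N.+1 ord_max (fun s => s = sg).
- move=> _ -> m f g e; apply: mono_eq => i; have /(congr1 (fun u => sval u i)) /= := e.
  by move=> /isg ->.
- by move=> _ j ->; apply: fE.
- move=> _ -> [/in_facesP_avoid [j hj]|[_]]; last by rewrite MT cardsT card_ord ltnn.
  have : j \in single_union (sact D (delta ord_max) sg) by rewrite MT inE.
  by move=> /in_single_unionP [i ei]; have := hj i; rewrite ei inE eqxx.
- by move=> s s' h -> ->.
- move=> _ -> t ct ht; apply: (qcat_rightfill hC hI ct).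
  rewrite (ht _ (fE ord0 isT)) // -snat.
  set w := sact _ _ _; have ew : sval w = max_edge full.
    apply: chain_eq => i; rewrite /w -[LHS]/(sf (lift ord0 (revm (edge01 N) i))) -[RHS]/(if _ then _ else _).
    case: (ord2_cases i) => -> /=; rewrite ?maxo_full -?sfl -?sfk; congr sf; apply: val_inj;
      by rewrite /= inordK /bump /=; lia.
  have hw : flag_stage N.+1 (max_edge full) by rewrite -ew; apply: (proj2_sig w).
  have -> : phi 1 w = phi 1 (exist _ _ hw) by congr (phi 1 _); apply: sig_eq.
  exact: hE.
have LK m (s : D m) : flag_stage N.+2 s -> attached (flag_stage N.+1) (fun s => s = sg) s.
  case=> [h|[fs _]]; first by left; left.
  case: (leqP #|single_union s| N.+1) => hM; first by left; right.
  (* Non-singletons contain the union of the singletons, so they equal [full], and the flag is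
     pulled back from [sg]. *)
  have MsT : single_union s = setT.
    by apply/eqP; rewrite eqEcard subsetT cardsT card_ord.
  have ns i : ~~ single (sval s i) -> sval s i = full.
    move=> h; apply: sd_eq; apply/eqP; rewrite eqEsubset subsetT /= -MsT; exact: single_union_sub_nonsingle.
  right; exists sg.
  pose g i : 'I_N.+3 := if single (sval s i) then lift ord_max (maxo (sval s i)) else ord_max.
  have mg (i j : 'I_m.+1) : i <= j -> g i <= g j.
    move=> ij; rewrite /g; case: ifP => si; case: ifP => sj.
    - rewrite /=; have := proj2_sig s i j ij; rewrite -[cosR _ _]/(is_true (maxo _ <= maxo _)).
      exact: bump_mono.
    - by rewrite -ltnS; apply: ltn_ord.
    - by case: (flag_rel_nonsingle (fs _ _ ij) (negbT si)) => _; rewrite sj.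
    - by [].
  exists (Mono g mg); split=> //; apply: chain_eq => i; rewrite -[RHS]/(sf (g i)) /g.
  by case: ifP => si; [rewrite sfl -single_sing|rewrite sfk ns // si].
have [psi' hpsi'] := @smap_sub_eq D C _ _ _ (flag_stage_closed (q := N.+2)) psi LK.
exists psi' => m s h h'; rewrite (hpsi' _ _ (or_introl h)); exact: hpsi.
Qed.
End Stages.
End Flags.

(** * The map max *)

Lemma natmark_equiv (C : sset) (e : C 1) : is_sset C -> natmark e -> is_equiv e.
Proof. by move=> hC [//|[x ->]]; apply: is_equiv_idedge. Qed.

Lemma is_sset_Ex (X : sset) W : is_sset (@Ex_plus X W).
Proof.
split=> [n x|m n p f g x|m n f g x h].
- apply: sig_eq; apply: smap_ext => k s /=; congr (sval x k _); apply: chain_eq => i /=; exact: dimg_id.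
- apply: sig_eq; apply: smap_ext => k s /=; congr (sval x k _); apply: chain_eq => i /=; exact: dimg_comp.
- by have -> : f = g by apply: mono_eq => i; rewrite h.
Qed.

Section MaxEquivalence.
Variables (C : sset) (hC : is_sset C) (hI : innerfill C).
Let E := Ex_plus (@natmark C).
Let T := maxMaps C.

Definition sd_incl n : smap (sd n) (maxNerve n) :=
  @nerve_map _ _ (@sd_le n) (@cosR sd_max n) id (fun a b h => maxS_sub h).

Lemma sd_marked_max n (e : sd n 1) : sd_marked e ->
  maxo (sval e ord0) = maxo (sval e ord_max).
Proof. by move=> h; apply: val_inj. Qed.

Lemma restr_ax n (h : T n) (e : sd n 1) : sd_marked e ->
  natmark (smap_comp (h : smap _ _) (sd_incl n) 1 e).
Proof. by move=> he; left; apply: (maxMaps_equiv h); apply: sd_marked_max. Qed.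

Definition restr : smap T E.
Proof.
refine (@SMap T E (fun n h => exist _ (smap_comp (h : smap _ _) (sd_incl n)) (@restr_ax n h)) _).
move=> m n f h; apply: sig_eq; apply: smap_ext => k s /=; congr (h k _); exact: chain_eq.
Defined.

Definition subset_chain n m (s : maxNerve n m) := forall i j : 'I_m.+1, i <= j -> sd_le (sval s i) (sval s j).

Lemma subset_chain_closed n : act_closed (@subset_chain n).
Proof. by move=> m p f s h i j ij /=; apply: h; apply: monoP. Qed.

Definition sd_of n m (s : maxNerve n m) (h : subset_chain s) : sd n m := mkchain h.

Definition sub_ex n (e : E n) : smap (sub (@subset_chain_closed n)) C.
Proof.
refine (@SMap (sub (@subset_chain_closed n)) C (fun m s => sval e m (sd_of (proj2_sig s))) _).
by move=> m p f s; rewrite -snat; congr (sval e m _); apply: chain_eq.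
Defined.

(** [0] has a single non-empty subset, so both nerves have the same simplices. *)
Lemma restr_trivfib0 (e : E 0) : exists h, restr 0 h = e.
Proof.
have uq (A B : sdT 0) : A = B.
  apply: sd_eq; have h (A' : sdT 0) : sval A' = setT.
    apply/setP => a; rewrite inE (ord1 a); case/set0Pn: (proj2_sig A') => b.
    by rewrite (ord1 b) => ->.
  by rewrite !h.
have all m (s : maxNerve 0 m) : subset_chain s by move=> i j _; rewrite (uq (sval s i) (sval s j)); apply: subxx.
have nat m n (f : mono m n) (s : maxNerve 0 n) :
    sval e m (sd_of (all m (sact (maxNerve 0) f s))) = sact C f (sval e n (sd_of (all n s))).
  by rewrite -snat; congr (sval e m _); apply: chain_eq.
exists (@SMap (maxNerve 0) C (fun m s => sval e m (sd_of (all m s))) nat).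
by apply: sig_eq; apply: smap_ext => m s /=; congr (sval e m _); apply: chain_eq.
Qed.

(** With [flag_subset_chain], this identifies the first stage of the filtration: a second singleton
    could not be comparable by inclusion. *)
Lemma subset_chain_flag N m (s : maxNerve N.+1 m) : subset_chain s -> flag s /\ #|single_union s| <= 1.
Proof.
move=> h; split=> [i j ij|]; first by apply/orP; left; apply: h.
case: (classic (exists a, a \in single_union s)) => [[a ha]|n0]; last first.
  by rewrite (_ : single_union s = set0) ?cards0 //; apply/setP => a; rewrite inE; apply/negP => ha; apply: n0; exists a.
rewrite -(cards1 a); apply: subset_leq_card; apply/subsetP => b /in_single_unionP [j ej]; rewrite inE.
case/in_single_unionP: ha => i ei; apply/eqP.
have key (i' j' : 'I_m.+1) : i' <= j' -> forall c d, sval s i' = sing c -> sval s j' = sing d -> c = d.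
  by move=> /h hh c d ec ed; move: hh; rewrite /sd_le ec ed sub1set inE => /eqP.
by case/orP: (leq_total i j) => ij; [symmetry|]; apply: (key _ _ ij).
Qed.

Lemma flag_subset_chain N m (s : maxNerve N.+1 m) : flag s -> #|single_union s| <= 1 -> subset_chain s.
Proof.
move=> fs cM i j ij; case/orP: (fs _ _ ij) => // /and3P [si sj _].
have [ai aj] : maxo (sval s i) \in single_union s /\ maxo (sval s j) \in single_union s.
  by split; apply/in_single_unionP; [exists i|exists j]; apply: single_sing.
have /card_le1_eqP h := cM.
by rewrite /sd_le (single_sing si) (single_sing sj) (h _ _ ai aj).
Qed.

Lemma restr_fill N (e : E N.+1) (t : 'I_N.+2 -> T N) :
  (forall j, restr N (t j) = sact E (delta j) e) -> compat (fun _ => True) t ->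
  exists h, restr N.+1 h = e /\ forall j, sact T (delta j) h = t j.
Proof.
move=> te ct; have [phiU hphiU] := glue_faces sd_max_reedy ct.
have MKL m (s : maxNerve N.+1 m) : flag_stage 1 s -> in_faces (fun _ => True) s \/ subset_chain s.
  by case=> [|[h1 h2]]; [left|right; apply: flag_subset_chain].
have [m s h h'|phi1 [h1U h1S]] := @smap_union (maxNerve N.+1) C _ _ _ _ _ (flag_stage_closed (N := N) (q := 1)) phiU (sub_ex e) MKL.
  have [j [s' [_ es]]] := h; subst s; rewrite hphiU //=.
  (* Faces reflect inclusion, so [te] compares [t] and [e] on the overlap. *)
  have hs' : subset_chain s'.
    move=> a b ab; have := h' a b ab; rewrite /sd_le /= => /subsetP hh.
    by apply/subsetP => c hc; have /imsetP [c' hc' /delta_inj ->] := hh _ (imset_f (delta j) hc).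
  have -> : t j m s' = sval (restr N (t j)) m (sd_of hs').
    by rewrite /=; congr (t j m _); apply: chain_eq.
  by rewrite te /=; congr (sval e m _); apply: chain_eq.
have steps q : q <= N -> exists phi : smap (sub (flag_stage_closed (N := N) (q := q.+1))) C,
    forall m s (h : flag_stage 1 s) (h' : flag_stage q.+1 s), phi m (exist _ s h') = phi1 m (exist _ s h).
  elim: q => [_|q IH hq].
    by exists phi1 => m s h h'; congr (phi1 m _); apply: sig_eq.
  case: IH => [|phi hphi]; first lia.
  have [|psi hpsi] := @flag_stage_step N C hC hI q.+1 phi; first lia.
  have h12 m (s : maxNerve N.+1 m) : flag_stage 1 s -> flag_stage q.+1 s.
    by case=> [|[h1 h2]]; [left|right; split=> //; lia].
  by exists psi => m s h h'; rewrite (hpsi _ _ (h12 _ _ h)); apply: hphi.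
have [phi hphi] := steps N (leqnn N).
have sub1 m (s : maxNerve N.+1 m) : subset_chain s -> flag_stage 1 s by move=> /subset_chain_flag [h1 h2]; right.
have subN m (s : maxNerve N.+1 m) : flag_stage 1 s -> flag_stage N.+1 s.
  by case=> [|[h1 h2]]; [left|right; split=> //; lia].
have mxsub (x : sdT N.+1) : subset_chain (max_edge x).
  have sx : sd_le (sing (maxo x)) x by rewrite /sd_le sub1set maxo_in.
  move=> i j ij; case: (ord2_cases i) ij => ->; case: (ord2_cases j) => -> //= _; exact: subxx.
(* The inclusion of {max x} in [x] is marked, so [e] sends it to an equivalence; both the outer horn
   and the homotopy rely on this. *)
have mxequiv (x : sdT N.+1) : is_equiv (sval e 1 (sd_of (mxsub x))).
  apply: natmark_equiv => //; apply: (proj2_sig e).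
  by have := congr1 val (max_edge_max x).
have [h|psi hpsi] := @flag_stage_last N C hC hI phi.
  rewrite (hphi _ _ (sub1 _ _ (mxsub _))) (h1S _ _ (mxsub _)); exact: mxequiv.
have sub2 m (s : maxNerve N.+1 m) : flag_stage N.+1 s -> flag_stage N.+2 s.
  by case=> [|[h1 h2]]; [left|right; split=> //; lia].
have hb m (s : maxNerve N.+1 m) (h : flag_stage 1 s) (h' : flag_stage N.+2 s) : psi m (exist _ s h') = phi1 m (exist _ s h).
  by rewrite (hpsi _ _ (subN _ _ h)); apply: hphi.
have flagN m (s : maxNerve N.+1 m) : flag s -> flag_stage N.+2 s.
  by move=> h; right; split=> //; apply: leq_trans (max_card _) _; rewrite card_ord.
have [||m s i h _|chi hchi] := @extend_from_prism_closed C hC hI N.+1 _ _ psi.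
- move=> m s; apply: flagN => i j ij; apply/orP; right; rewrite !sing_single !maxo_sing.
  exact: (proj2_sig s).
(* The prism over a flag consists of flags, because max x lies in [y] whenever [x] is a subset of
   [y]. *)
- move=> m s [[j [s' [Jj ->]]]|[fs _]] k p.
    by left; rewrite prism_chain_cosnmap; exists j, (prism_chain s' p).
  apply: flagN => i j ij; have [p1 p2] := proj2_sig p i j ij.
  have Rij := fs _ _ p1; rewrite /= /prism_vertex; move: p2.
  case: (sval p i).2; case: (sval p j).2 => //= _.
    case/orP: Rij => [sij|/and3P [si sj mij]].
      by apply/orP; left; rewrite sub1set; apply: (subsetP sij); apply: maxo_in.
    by apply/orP; right; rewrite sing_single sj maxo_sing.
  by apply/orP; right; rewrite !sing_single !maxo_sing; apply: flag_rel_max.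
- rewrite (hb _ _ (sub1 _ _ (mxsub _))) (h1S _ _ (mxsub _)); exact: mxequiv.
exists chi; split.
  apply: sig_eq; apply: smap_ext => m s.
  have hs : subset_chain (sd_incl N.+1 m s) by apply: (proj2_sig s).
  have h1 := sub1 _ _ hs.
  rewrite -[LHS]/(chi m (sd_incl N.+1 m s)) (hchi _ _ (sub2 _ _ (subN _ _ h1))) (hb _ _ h1) (h1S _ _ hs) /=.
  by congr (sval e m _); apply: chain_eq.
move=> j; apply: smap_ext => m s.
rewrite -[LHS]/(chi m (@cosnmap sd_max _ _ (delta j) m s)).
have hU : in_faces (fun _ => True) (@cosnmap sd_max _ _ (delta j) m s) by exists j, s.
have h1 : flag_stage 1 (@cosnmap sd_max _ _ (delta j) m s) by left.
by rewrite (hchi _ _ (sub2 _ _ (subN _ _ h1))) (hb _ _ h1) (h1U _ _ hU) hphiU.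
Qed.

Lemma restr_trivfib : trivfib restr.
Proof. by split; [apply: restr_trivfib0|apply: restr_fill]. Qed.

Definition max_chain n m (s : maxNerve n m) : mono m n :=
  Mono (fun i => maxo (sval s i)) (proj2_sig s).

Definition max_ext_fun n (c : C n) : T n.
Proof.
refine (@SMap (maxNerve n) C (fun m s => sact C (max_chain s) c) _).
by move=> m p f s; rewrite sact_comp //; apply: sact_eq.
Defined.

Definition max_ext : smap C T.
Proof.
refine (@SMap C T max_ext_fun _) => m n f c; apply: smap_ext => k s /=.
by rewrite sact_comp //; apply: sact_eq => i; rewrite [RHS](congr1 val (maxo_dimg f (sval s i))).
Defined.

Lemma restr_max_ext n (c : C n) : restr n (max_ext n c) = maxstar hC n c.
Proof. by apply: sig_eq; apply: smap_ext => k s /=; apply: sact_eq. Qed.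

Lemma init_ax n (i : 'I_n.+1) : [set j : 'I_n.+1 | j <= i] != set0.
Proof. by apply/set0Pn; exists i; rewrite inE. Qed.

(** The initial segments {0, ..., i} form a chain in sd[n] whose maxima are the [i], so evaluation
    there recovers [c]. They are not natural in [n], hence give injectivity but no simplicial
    retraction. *)
Lemma maxstar_inj n : injective (maxstar hC n).
Proof.
move=> c c' e.
pose ini (i : 'I_n.+1) : sdT n := exist (fun A : {set 'I_n.+1} => A != set0) _ (init_ax i).
have ax (i j : 'I_n.+1) : i <= j -> sd_le (ini i) (ini j).
  by move=> ij; apply/subsetP => a; rewrite !inE => /leq_trans; apply.
have mx i : maxo (ini i) = i.
  apply: val_inj; apply/eqP; rewrite eqn_leq; apply/andP; split.
    by apply: maxS_lub => a; rewrite inE.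
  by apply: maxS_ub; rewrite inE.
have := congr1 (fun x : E n => sval x n (mkchain ax)) e => /=.
have -> : max_mono (mkchain ax : sd n n) = mono_id n.
  by apply: mono_eq => i; rewrite [LHS](congr1 val (mx i)).
by rewrite !sact_id.
Qed.

(** Maxima do not change, so this is monotone into D[n] for every [f]; that is why [f] can be any
    map to {0,1}, as J requires. *)
Definition collapse n (f : 'I_n.+1 -> bool) (A : sdT n) : sdT n :=
  if f (maxo A) then A else sing (maxo A).

Lemma maxo_collapse n f (A : sdT n) : maxo (collapse f A) = maxo A.
Proof. by rewrite /collapse; case: ifP; rewrite ?maxo_sing. Qed.

Lemma collapse_le n f (A B : sdT n) : sd_le A B -> @cosR sd_max n (collapse f A) (collapse f B).
Proof.
by move=> h; rewrite -[cosR _ _]/(is_true (maxo _ <= maxo _)) !maxo_collapse; apply: maxS_sub.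
Qed.

Definition collapse_map n f : smap (sd n) (maxNerve n) := nerve_map (@collapse_le n f).

Lemma collapse_marked n f (h : T n) (e : sd n 1) : sd_marked e ->
  natmark (smap_comp (h : smap _ _) (collapse_map f) 1 e).
Proof.
move=> he; left; apply: (maxMaps_equiv h); rewrite !maxo_collapse; exact: sd_marked_max.
Qed.

Theorem maxstar_equiv : innerfill E /\ qcat_equiv (maxstar hC).
Proof.
have hT : is_sset T by apply: is_sset_cosfun.
have hE : is_sset E by apply: is_sset_Ex.
have [S [S1 S2]] := trivfib_section hT hE restr_trivfib maxstar_inj restr_max_ext.
split.
  move=> N k hk t ct; have [c hc] := maxMaps_innerfill hC hI hk (compat_map S ct).
  by exists (restr N.+1 c) => j hj; rewrite -snat hc // S1.
(* Direct images carry singletons to singletons, so restriction to them is natural. *)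
have nG m n (f : mono m n) (e : E n) :
    S m (sact E f e) m (allsing m) = sact C f (S n e n (allsing n)).
  rewrite snat -[RHS]snat -[LHS]/(S n e m (@cosnmap sd_max _ _ f m (allsing m))).
  by congr (S n e m _); apply: chain_eq => i /=; apply: (dimg_sing f).
pose G : smap E C := @SMap E C (fun n e => S n e n (allsing n)) nG.
have nH m n (f : mono m n) (x : prodJ C n) : (sact (prodJ C) f x).1 = sact C f x.1 by [].
(* [G] is a strict retraction of [maxstar hC], so the homotopy on [C] is constant. *)
pose H : smap (prodJ C) C := @SMap (prodJ C) C (fun n x => x.1) nH.
pose Kf n (x : prodJ E n) : E n :=
  exist _ (smap_comp (S n x.1) (collapse_map x.2)) (@collapse_marked n x.2 (S n x.1)).
have nK m n (f : mono m n) (x : prodJ E n) : Kf m (sact (prodJ E) f x) = sact E f (Kf n x).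
  apply: sig_eq; apply: smap_ext => k s; rewrite [LHS]/= snat /=; congr (S n x.1 k _).
  apply: chain_eq => i; rewrite /= /collapse maxo_dimg; case: ifP => // _.
  by rewrite dimg_sing.
pose K : smap (prodJ E) E := @SMap (prodJ E) E Kf nK.
exists G, H, K; split=> [n x|n x|n y|n y] //.
- rewrite /= S2 /= -[LHS](sact_id hC); apply: sact_eq => i.
  by rewrite [RHS](congr1 val (maxo_sing i)).
(* At [false] every A collapses to {max A}, so [K] is the restriction of [S n y] to the singletons,
   composed with max. *)
- apply: sig_eq; apply: smap_ext => k s /=; rewrite -snat; congr (S n y k _).
  by apply: chain_eq => i.
- rewrite -[RHS]S1; apply: sig_eq; apply: smap_ext => k s /=; congr (S n y k _).
  exact: chain_eq.
Qed.
End MaxEquivalence.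

(** * The map min *)

Lemma innerfill_retract X Y (F : smap X Y) (G : smap Y X) :
  (forall n x, G n (F n x) = x) -> innerfill Y -> innerfill X.
Proof.
move=> GF hY N k hk t ct; have [c hc] := hY N k hk _ (compat_map F ct).
by exists (G N.+1 c) => j hj; rewrite -snat hc.
Qed.

Lemma natmark_op (X : sset) (e : X 1) : @natmark (opS X) e <-> natmark e.
Proof.
by split; case=> [/is_equiv_op|[x ex]]; [left|right|left|right] => //; exists x; rewrite ex idedge_op.
Qed.

Definition revset n (A : sdT n) : sdT n.
Proof.
exists (@rev_ord n.+1 @: sval A); rewrite imset_eq0; exact: (proj2_sig A).
Defined.

Lemma revsetK n : involutive (@revset n).
Proof.
move=> A; apply: sd_eq; rewrite /= -imset_comp -[RHS]imset_id; apply: eq_imset => i /=.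
exact: rev_ordK.
Qed.

Lemma revset_dimg m n (f : mono m n) A : revset (dimg f A) = dimg (revm f) (revset A).
Proof. by apply: sd_eq; rewrite /= -!imset_comp; apply: eq_imset => i /=; rewrite rev_ordK. Qed.

Lemma maxo_revset n (A : sdT n) : maxo (revset A) = rev_ord (mino A).
Proof.
case: (minS_ex (proj2_sig A)) => a ha ea.
have ma : mino A = a by apply: val_inj.
rewrite ma; apply: val_inj; apply/eqP; rewrite eqn_leq; apply/andP; split.
  apply: maxS_lub => b /imsetP [c hc ->] /=; have := minS_lb hc; rewrite ea; lia.
by apply: maxS_ub; apply: imset_f.
Qed.

Lemma mino_revset n (A : sdT n) : mino (revset A) = rev_ord (maxo A).
Proof. by apply: rev_ord_inj; rewrite -maxo_revset revsetK rev_ordK. Qed.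

(** Reversing the elements of the sets exchanges minima and maxima, and reversing the chain turns
    decreasing chains into increasing ones. *)
Definition revch n m (s : 'I_m.+1 -> sdT n) (i : 'I_m.+1) : sdT n := revset (s (rev_ord i)).

Lemma revchK n m (s : 'I_m.+1 -> sdT n) i : revch (revch s) i = s i.
Proof. by rewrite /revch revsetK rev_ordK. Qed.

Lemma to_sdop_ax n m (s : sd n m) (i j : 'I_m.+1) : i <= j ->
  sdop_le (revch (sval s) i) (revch (sval s) j).
Proof. by move=> ij; apply: imsetS; apply: (proj2_sig s); rewrite /=; lia. Qed.
Definition to_sdop n m (s : sd n m) : sdop n m := mkchain (to_sdop_ax s).

Lemma to_sd_ax n m (s : sdop n m) (i j : 'I_m.+1) : i <= j ->
  sd_le (revch (sval s) i) (revch (sval s) j).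
Proof. by move=> ij; apply: imsetS; apply: (proj2_sig s); rewrite /=; lia. Qed.
Definition to_sd n m (s : sdop n m) : sd n m := mkchain (to_sd_ax s).

Lemma rev_ord2_0 : rev_ord (ord0 : 'I_2) = ord_max.
Proof. exact: val_inj. Qed.
Lemma rev_ord2_max : rev_ord (ord_max : 'I_2) = ord0.
Proof. exact: val_inj. Qed.

Lemma to_sdop_marked n (e : sd n 1) : sd_marked e -> sdop_marked (to_sdop e).
Proof.
move=> h; have E : maxo (sval e ord0) = maxo (sval e ord_max) by apply: val_inj.
have /(congr1 val) : mino (sval (to_sdop e) ord0) = mino (sval (to_sdop e) ord_max); last by [].
rewrite /= !mino_revset; congr rev_ord.
by rewrite rev_ord2_0 rev_ord2_max.
Qed.

Lemma to_sd_marked n (e : sdop n 1) : sdop_marked e -> sd_marked (to_sd e).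
Proof.
move=> h; have E : mino (sval e ord0) = mino (sval e ord_max) by apply: val_inj.
have /(congr1 val) : maxo (sval (to_sd e) ord0) = maxo (sval (to_sd e) ord_max); last by [].
rewrite /= !maxo_revset; congr rev_ord.
by rewrite rev_ord2_0 rev_ord2_max.
Qed.

Section Duality.
Variable C : sset.
Let Eo := Exop_plus (@natmark C).
Let E' := Ex_plus (@natmark (opS C)).

Definition to_Ex_fun n (h : Eo n) : E' n.
Proof.
unshelve eexists.
  refine (@SMap (sd n) (opS C) (fun m s => sval h m (to_sdop s)) _).
  move=> m p f s /=; rewrite -snat; congr (sval h m _); apply: chain_eq => i /=.
  by rewrite /revch /= rev_ordK.
by move=> e he; apply/natmark_op; apply: (proj2_sig h); apply: to_sdop_marked.
Defined.

(** One half of the comparison of Ex^op_+ of [C] with the opposite of Ex_+ of the opposite of [C];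
    [of_Ex] is the other half. *)
Definition to_Ex : smap Eo (opS E').
Proof.
refine (@SMap Eo (opS E') to_Ex_fun _) => m n f h.
apply: sig_eq; apply: smap_ext => k s /=; congr (sval h k _); apply: chain_eq => i /=.
by rewrite /revch /= -[f in LHS]revmK revset_dimg revmK.
Defined.

Definition of_Ex_fun n (h : E' n) : Eo n.
Proof.
unshelve eexists.
  refine (@SMap (sdop n) C (fun m s => sval h m (to_sd s)) _).
  move=> m p f s /=; have := snat (sval h) _ _ (revm f) (to_sd s); rewrite /= revmK => <-.
  congr (sval h m _); apply: chain_eq => i /=; by rewrite /revch /= rev_ordK.
by move=> e he; apply/natmark_op; apply: (proj2_sig h); apply: to_sd_marked.
Defined.

Definition of_Ex : smap (opS E') Eo.
Proof.
refine (@SMap (opS E') Eo of_Ex_fun _) => m n f h.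
apply: sig_eq; apply: smap_ext => k s /=; congr (sval h k _); apply: chain_eq => i /=.
by rewrite /revch /= revset_dimg.
Defined.

Lemma to_ExK n h : of_Ex n (to_Ex n h) = h.
Proof.
apply: sig_eq; apply: smap_ext => k s /=; congr (sval h k _); apply: chain_eq => i /=.
exact: revchK.
Qed.

Variable hC : is_sset C.

Lemma to_Ex_minstar n (x : C n) : to_Ex n (minstar hC n x) = maxstar (is_sset_op hC) n x.
Proof.
apply: sig_eq; apply: smap_ext => k s /=; apply: sact_eq => i.
rewrite /= -[RHS]/(nat_of_ord (rev_ord (maxo (sval s (rev_ord i))))) -mino_revset.
by [].
Qed.

(** The homotopy data for [opS C] are conjugated by [to_Ex] and [of_Ex]. Order reversal also acts on
    the coordinate in J, which is its own opposite, and it fixes the constant maps that mark the two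
    ends. *)
Theorem minstar_equiv : innerfill C -> innerfill Eo /\ qcat_equiv (minstar hC).
Proof.
move=> hI; have [hE [G [H [K [h1 h2 h3 h4]]]]] := maxstar_equiv (is_sset_op hC) (innerfill_op hI).
split; first exact: (innerfill_retract to_ExK (innerfill_op hE)).
have nG m n (f : mono m n) (y : Eo n) : G m (to_Ex m (sact Eo f y)) = sact C f (G n (to_Ex n y)).
  by rewrite snat /= snat /= revmK.
have nH m n (f : mono m n) (x : prodJ C n) :
    H m ((sact (prodJ C) f x).1, fun i => (sact (prodJ C) f x).2 (rev_ord i)) =
    sact C f (H n (x.1, fun i => x.2 (rev_ord i))).
  have := snat H _ _ (revm f) (x.1, fun i => x.2 (rev_ord i)); rewrite /= revmK => <-.
  by congr (H m (_, _)); apply: functional_extensionality => i; rewrite rev_ordK.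
have nK m n (f : mono m n) (x : prodJ Eo n) :
    of_Ex m (K m (to_Ex m (sact (prodJ Eo) f x).1, fun i => (sact (prodJ Eo) f x).2 (rev_ord i))) =
    sact Eo f (of_Ex n (K n (to_Ex n x.1, fun i => x.2 (rev_ord i)))).
  rewrite -snat; congr (of_Ex m _).
  have := snat K _ _ (revm f) (to_Ex n x.1, fun i => x.2 (rev_ord i)) => /= <-.
  congr (K m (_, _)); first exact: (snat to_Ex _ _ f x.1).
  by apply: functional_extensionality => i; rewrite /= rev_ordK.
exists (@SMap Eo C (fun n y => G n (to_Ex n y)) nG),
  (@SMap (prodJ C) C (fun n x => H n (x.1, fun i => x.2 (rev_ord i))) nH),
  (@SMap (prodJ Eo) Eo (fun n x => of_Ex n (K n (to_Ex n x.1, fun i => x.2 (rev_ord i)))) nK).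
split=> [n x|n x|n y|n y].
- by rewrite -[LHS]/(H n (x, fun _ => false)) h1 -to_Ex_minstar.
- exact: h2.
- rewrite -[LHS]/(of_Ex n (K n (to_Ex n y, fun _ => false))) h3 -to_Ex_minstar; exact: to_ExK.
- rewrite -[LHS]/(of_Ex n (K n (to_Ex n y, fun _ => true))) h4; exact: to_ExK.
Qed.
End Duality.

Lemma is_sset_Exop (X : sset) W : is_sset (@Exop_plus X W).
Proof.
split=> [n x|m n p f g x|m n f g x h].
- apply: sig_eq; apply: smap_ext => k s /=; congr (sval x k _); apply: chain_eq => i /=; exact: dimg_id.
- apply: sig_eq; apply: smap_ext => k s /=; congr (sval x k _); apply: chain_eq => i /=; exact: dimg_comp.
- by have -> : f = g by apply: mono_eq => i; rewrite h.
Qed.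

Theorem theorem8p4 (C : sset) (hC : is_sset C) (hq : quasicategory C) :
  (quasicategory (Ex_plus (@natmark C)) /\ qcat_equiv (maxstar hC)) /\
  (quasicategory (Exop_plus (@natmark C)) /\ qcat_equiv (minstar hC)).
Proof.
have hI := qcat_innerfill hC hq.
have [h1 h2] := maxstar_equiv hC hI; have [h3 h4] := minstar_equiv hC hI.
by do 2 split=> //; apply: innerfill_qcat => //; [apply: is_sset_Ex | apply: is_sset_Exop].
Qed.
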